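(* Let $\Omega\subset\mathbb{C}^2$ be a bounded pseudoconvex domain with smooth boundary and let $\Sigma$ be the Levi-flat set of $\partial\Omega$ (assumed nonempty). Set $$C:=\max\Big\{\max_{\Sigma}|g(\nabla_N\overline{L},\overline{N})|,\ \max_{\Sigma}|g(\nabla_{\overline{L}}L,L)|,\ \max_{\Sigma}|g([N,L],N)|,\ \max_{\Sigma}|g(\nabla_{\overline{L}}N,N)|\Big\},$$ $$C_1:=2C+2\max_\Sigma|\mathrm{Hess}_\delta(N,L)|,\qquad C_2:=\frac12\max_\Sigma\Big(\mathrm{Re}\big(-L\,\mathrm{Hess}_\delta(N,L)+\mathrm{Hess}_\delta(N,\nabla_{\overline{L}}L)\big)\Big).$$ If the Diederich--Fornæss index of $\Omega$ is $\eta_0$, then for any $\eta<\eta_0$ there is a real smooth function $\psi$ defined on a neighborhood of $\Sigma$ such that at every point of $\Sigma$ either $$\frac{1}{1-\eta}-1\ \le\ \frac{C_2-\frac14\mathrm{Hess}_\psi(L,L)}{\left|\frac12\overline{L}\psi+\mathrm{Hess}_\delta(N,L)\right|^2}+\frac{C_1}{\left|\frac12\overline{L}\psi+\mathrm{Hess}_\delta(N,L)\right|}$$ or $$\left|\tfrac12\overline{L}\psi+\mathrm{Hess}_\delta(N,L)\right|=0.$$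
   Context: Signed distance: $\delta(z)=-\mathrm{dist}(z,\partial\Omega)$ for $z\in\Omega$ and $\delta(z)=\mathrm{dist}(z,\partial\Omega)$ otherwise; $\delta$ is smooth with $\|\nabla\delta\|=1$ near $\partial\Omega$. Smooth defining function of $\Omega$: a real smooth function $\rho$ on a neighborhood of $\overline\Omega$ with $\Omega=\{\rho<0\}$, vanishing on $\partial\Omega$ with $\nabla\rho\ne0$ there. Diederich--Fornæss index: a number $0<\tau<1$ is a Diederich--Fornæss exponent of $\Omega$ if there is a smooth defining function $\rho$ of $\Omega$ such that $-(-\rho)^\tau$ is plurisubharmonic in $\Omega$. The index is the supremum of all exponents, over all smooth defining functions. With coordinates $(z,w)$ on $\mathbb{C}^2$, near $\partial\Omega$ put $$L=\frac{1}{\sqrt{|\partial_z\delta|^2+|\partial_w\delta|^2}}\Big(\frac{\partial\delta}{\partial w}\frac{\partial}{\partial z}-\frac{\partial\delta}{\partial z}\frac{\partial}{\partial w}\Big),\qquad N=\frac{1}{\sqrt{|\partial_z\delta|^2+|\partial_w\delta|^2}}\Big(\frac{\partial\delta}{\partial\bar z}\frac{\partial}{\partial z}+\frac{\partial\delta}{\partial\bar w}\frac{\partial}{\partial w}\Big).$$ $g$ is the Euclidean metric, extended to complex vector fields as a Hermitian form (complex linear in the first slot, conjugate linear in the second; thus $\sqrt2L,\sqrt2N$ are orthonormal); $\nabla$ is its flat Levi-Civita connection, $\nabla f$ the real gradient of $f$, $\|\nabla f\|^2=g(\nabla f,\nabla f)$. For $(1,0)$ vector fields $Z,W$, $\mathrm{Hess}_f(Z,W)=g(\nabla_Z\nabla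 f,W)=Z(\overline{W}f)-(\nabla_Z\overline{W})f$. The Levi-flat set $\Sigma$ is the set of points of $\partial\Omega$ where the Levi form vanishes, i.e. $\mathrm{Hess}_\rho(L,L)=0$ for one (equivalently any) smooth defining function $\rho$. *)

(* Defs.v *)
From mathcomp Require Import all_boot all_order all_algebra.
From mathcomp Require Import all_classical all_reals all_analysis.
From mathcomp Require Import complex.

Set Implicit Arguments.
Unset Strict Implicit.
Unset Printing Implicit Defensive.

Import Order.TTheory GRing.Theory Num.Theory.
Import numFieldNormedType.Exports.

Local Open Scope classical_set_scope.
Local Open Scope ring_scope.
Local Open Scope complex_scope.

(* C^2 is represented by R^4 with real coordinates (Re z, Im z, Re w, Im w),
   indexed by 'I_4. *)
Notation pt R := 'rV[R]_4.

(* The topology of 'rV[R]_4 comes from the sup norm, so the Euclidean norm,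
   which the distance to the boundary uses, has to be introduced separately. *)
Definition enorm (R : realType) (x : pt R) : R :=
  Num.sqrt (\sum_(k < 4) x 0 k ^+ 2).

Definition pd (R : realType) (k : 'I_4) (f : pt R -> R) : pt R -> R :=
  fun x => 'D_(delta_mx 0 k : pt R) f x.

Definition pds (R : realType) (s : seq 'I_4) (f : pt R -> R) : pt R -> R :=
  foldr (fun k g => pd k g) f s.

(* C^oo on the open set U: all iterated partial derivatives are
   (Frechet) differentiable, hence continuous, on U. *)
Definition smooth_on (R : realType) (U : set (pt R)) (f : pt R -> R) : Prop :=
  open U /\ forall (s : seq 'I_4) (x : pt R), U x -> differentiable (pds s f) x.

Definition smooth_near (R : realType) (A : set (pt R)) (f : pt R -> R) : Prop :=
  exists2 U, A `<=` U & smooth_on U f.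

Definition cpd (R : realType) (k : 'I_4) (F : pt R -> R[i]) (x : pt R) : R[i] :=
  pd k (fun y => complex.Re (F y)) x +i* pd k (fun y => complex.Im (F y)) x.

(* Complexified tangent vectors, by their components in the frame
   d/dRe z, d/dIm z, d/dRe w, d/dIm w. *)
Notation cvec R := 'rV[R[i]]_4.
Notation vfield R := (pt R -> cvec R).

Definition vconj (R : realType) (X : cvec R) : cvec R := map_mx (@conjc R) X.

Definition fconj (R : realType) (X : vfield R) : vfield R :=
  fun x => vconj (X x).

Definition gdot (R : realType) (X Y : cvec R) : R[i] :=
  \sum_(k < 4) X 0 k * conjc (Y 0 k).

Definition vder (R : realType) (X : cvec R) (F : pt R -> R[i]) (x : pt R)
    : R[i] :=
  \sum_(k < 4) X 0 k * cpd k F x.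

(* The flat connection: components are differentiated along X. *)
Definition nabla (R : realType) (X Y : vfield R) : vfield R :=
  fun x => \row_k vder (X x) (fun y => Y y 0 k) x.

Definition lie (R : realType) (X Y : vfield R) : vfield R :=
  fun x => nabla X Y x - nabla Y X x.

Definition rgrad (R : realType) (f : pt R -> R) : vfield R :=
  fun x => \row_k (pd k f x)%:C.

Definition Hess (R : realType) (f : pt R -> R) (Z W : vfield R) (x : pt R)
    : R[i] :=
  gdot (nabla Z (rgrad f) x) (W x).

Definition cmod (R : realType) (z : R[i]) : R := Normc.normc z.

(* d/dz and d/dw; their conjugates are d/dzbar and d/dwbar. *)
Definition dz (R : realType) : cvec R :=
  2^-1 *: (delta_mx 0 0 - (0 +i* 1) *: delta_mx 0 1).
Definition dw (R : realType) : cvec R :=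
  2^-1 *: (delta_mx 0 2%:R - (0 +i* 1) *: delta_mx 0 3%:R).

Definition bdry (R : realType) (Om : set (pt R)) : set (pt R) :=
  closure Om `\` interior Om.

Definition dist (R : realType) (x : pt R) (A : set (pt R)) : R :=
  inf [set enorm (x - y) | y in A].

Definition sdist (R : realType) (Om : set (pt R)) (x : pt R) : R :=
  if x \in Om then - dist x (bdry Om) else dist x (bdry Om).

Definition sdistC (R : realType) (Om : set (pt R)) (x : pt R) : R[i] :=
  (sdist Om x)%:C.

Definition dnorm (R : realType) (Om : set (pt R)) (x : pt R) : R :=
  Num.sqrt (cmod (vder (dz R) (sdistC Om) x) ^+ 2 +
            cmod (vder (dw R) (sdistC Om) x) ^+ 2).

(* Fields meant near the boundary of Om only, where dnorm does not vanish. *)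
Definition Lf (R : realType) (Om : set (pt R)) : vfield R := fun x =>
  ((dnorm Om x)^-1)%:C *: (vder (dw R) (sdistC Om) x *: dz R
                         - vder (dz R) (sdistC Om) x *: dw R).

Definition Nf (R : realType) (Om : set (pt R)) : vfield R := fun x =>
  ((dnorm Om x)^-1)%:C *: (vder (vconj (dz R)) (sdistC Om) x *: dz R
                         + vder (vconj (dw R)) (sdistC Om) x *: dw R).

(* Values of rho outside the neighborhood U of the closure are irrelevant. *)
Definition smooth_defining (R : realType) (Om : set (pt R)) (rho : pt R -> R)
    : Prop :=
  exists U : set (pt R),
    [/\ closure Om `<=` U, smooth_on U rho,
        Om = [set x | U x /\ rho x < 0] &
        forall x, bdry Om x -> rho x = 0 /\ rgrad rho x != 0].

Definition smooth_boundary (R : realType) (Om : set (pt R)) : Prop :=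
  exists rho, smooth_defining Om rho.

(* Hess rho (L, L) is real for smooth real rho, so that taking the real part
   only changes its type. *)
Definition Levi_form (R : realType) (Om : set (pt R)) (rho : pt R -> R)
    (x : pt R) : R :=
  complex.Re (Hess rho (Lf Om) (Lf Om) x).

(* Pseudoconvexity of a smoothly bounded domain of C^2: the Levi form is
   nonnegative on the complex tangent line, which L spans. *)
Definition pseudoconvex (R : realType) (Om : set (pt R)) : Prop :=
  exists2 rho, smooth_defining Om rho &
    forall x, bdry Om x -> 0 <= Levi_form Om rho x.

Definition Levi_flat (R : realType) (Om : set (pt R)) : set (pt R) :=
  [set x | bdry Om x /\
     exists2 rho, smooth_defining Om rho & Levi_form Om rho x = 0].

(* Multiplication of a vector of C^2 by the complex number s + i t. *)
Definition cmul (R : realType) (s t : R) (b : pt R) : pt R :=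
  s *: b + t *: \row_k [:: - b 0 1; b 0 0; - b 0 3%:R; b 0 2%:R]`_k.

(* Upper semicontinuity and the sub-mean value inequality on the circles
   bounding closed discs, contained in Om, of complex lines. *)
Definition psh (R : realType) (Om : set (pt R)) (u : pt R -> R) : Prop :=
  (forall x c, Om x -> u x < c -> \forall y \near x, u y < c) /\
  (forall a b : pt R,
     (forall s t : R, s ^+ 2 + t ^+ 2 <= 1 -> Om (a + cmul s t b)) ->
     ((2 * pi * u a)%:E <=
        \int[lebesgue_measure]_(t in `[0%R, (2 * pi)%R])
          (u (a + cmul (cos t) (sin t) b))%:E)%E).

Definition DF_exponent (R : realType) (Om : set (pt R)) (tau : R) : Prop :=
  0 < tau < 1 /\
  exists2 rho, smooth_defining Om rho & psh Om (fun x => - ((- rho x) `^ tau)).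

(* The supremum is taken in \bar R, where the supremum of the empty set is -oo
   rather than an arbitrary real number. *)
Definition DF_index (R : realType) (Om : set (pt R)) : \bar R :=
  ereal_sup [set tau%:E | tau in DF_exponent Om].

(* Used for continuous f and compact S, where the supremum is attained. *)
Definition max_on (R : realType) (S : set (pt R)) (f : pt R -> R) : R :=
  sup [set f x | x in S].

Definition HNL (R : realType) (Om : set (pt R)) (x : pt R) : R[i] :=
  Hess (sdist Om) (Nf Om) (Lf Om) x.

Definition constC (R : realType) (Om : set (pt R)) : R :=
  let L := Lf Om in let N := Nf Om in
  let M f := max_on (Levi_flat Om) (fun x => cmod (f x)) in
  Num.max (M (fun x => gdot (nabla N (fconj L) x) (fconj N x)))
 (Num.max (M (fun x => gdot (nabla (fconj L) L x) (L x)))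
 (Num.max (M (fun x => gdot (lie N L x) (N x)))
          (M (fun x => gdot (nabla (fconj L) N x) (N x))))).

Definition constC1 (R : realType) (Om : set (pt R)) : R :=
  2 * constC Om + 2 * max_on (Levi_flat Om) (fun x => cmod (HNL Om x)).

Definition constC2 (R : realType) (Om : set (pt R)) : R :=
  2^-1 * max_on (Levi_flat Om) (fun x =>
    complex.Re (- vder (Lf Om x) (HNL Om) x
        + Hess (sdist Om) (Nf Om) (nabla (fconj (Lf Om)) (Lf Om)) x)).

(* |1/2 Lbar psi + Hess_delta (N, L)| *)
Definition denom (R : realType) (Om : set (pt R)) (psi : pt R -> R) (x : pt R)
    : R :=
  cmod (2^-1 * vder (fconj (Lf Om) x) (fun y => (psi y)%:C) x + HNL Om x).

(* Main.v *)
From HB Require Import structures.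
Require Import Defs.
From mathcomp Require Import all_boot all_order all_algebra.
From mathcomp Require Import all_classical all_reals all_analysis.
From mathcomp Require Import complex ring lra.

(** Let [rho] be a defining function of [Om] such that [- (- rho) ^ t] is
plurisubharmonic for some [t > eta]; the index being larger than [eta], there
is one. Near the boundary write [rho = sg * exp psi0], where [psi0] is half the
logarithm of [|grad rho|^2], so that [sg] is a defining function with gradient
of length 1 on the boundary. The function required by the theorem is
[psi = t * psi0].

Plurisubharmonicity bounds a Hessian from below inside [Om]: the Taylor
expansion of order two and the sub-mean value inequality on small circles of
complex lines ([psh_trace]) give, for every vector [a], an inequality for the
first derivatives and the complex Hessians of [sg] and [psi0] along [a]
([exponent_trace]). At a Levi-flat boundary point [x], with unit normal
[n = grad sg x] and complex tangent vector [X], evaluate it at [x - s n] along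
[X + s w]. Every term is then of order [s^2]: [sg] is of order [s], its derivative along [X + s w] is of order [s],
and its complex Hessian on [X], which vanishes at [x], is of order [s]. Dividing
by [s^2] and letting [s] tend to 0 leaves an inequality at [x] which holds for
every [w] ([boundary_inequality]).

The limit contains third derivatives of [sg], namely [D3 sg x n X X] summed over
[X] and [J X]. They are not free: [|grad sg|^2 = 1] on the boundary, and
differentiating this identity twice along [X] expresses them by second
derivatives ([unit_defining_third], [D3_flat]). What remains is a quadratic
polynomial in [w], and the best [w] in the complex line of the normal gives
[flat_inequality]. In terms of [D = Lbar psi / 2 + h] and [h = Hess_delta (N, L)]
it reads
  [t / (1 - t) * |D|^2 <= c2 - Hess_psi (L, L) / 4 + 2 |D| |h|],
where [c2 = (al^2 + be^2) / 8] comes from the tangential second derivatives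
[al], [be] of [sg].

The constants of the theorem dominate the right-hand side. The expression whose
supremum defines [C2] equals [2 c2] at each Levi-flat point ([c2_value],
[Levi_flat_second]), [C1 >= 2 |h|], and both suprema are finite because they are
those of continuous functions on a compact boundary ([constC2_ge],
[constC1_ge]). Dividing by [|D|^2] ends the proof.

The constants are defined with the signed distance [delta], not with [sg], so
[delta] has to be differentiated three times at boundary points
([sdist_regular]). The implicit function theorem is avoided: the ball around
[x] through its nearest boundary point [proj x] touches the boundary there, so
[x = proj x + delta x * grad sg (proj x)] ([nearest_normal]), and all derivatives
of [delta] are read off from this equation. On the boundary the second
derivatives of [delta] and [sg] agree in tangential directions, which transfers
the computation from [delta] to [sg].

Points of [C^2] are real vectors with four entries, [J] is [Jmap], and
[D2 f x], [D3 f x] are the real second and third derivatives. With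
[A = Amap], an isometry that anticommutes with [J], the vectors [n], [T = J n],
[X = A n], [Y = J X] are orthonormal and [L = (X - i Y) / 2],
[N = (n - i T) / 2]. *)

Set Implicit Arguments.
Unset Strict Implicit.
Unset Printing Implicit Defensive.

Import Order.TTheory GRing.Theory Num.Theory.
Import numFieldNormedType.Exports.

Local Open Scope classical_set_scope.
Local Open Scope ring_scope.

(** * Euclidean products and gradients *)

Section Gradients.
Context {R : realType}.
Implicit Types (f : pt R -> R) (x y v : pt R) (k : 'I_4).

Definition dot (u v : pt R) : R := \sum_(k < 4) u 0 k * v 0 k.

Definition grad f x : pt R := \row_k pd k f x.

Definition is_grad f x (g : pt R) : Prop :=
  forall e : R, 0 < e ->
    \forall v \near (0 : pt R), `|f (x + v) - f x - dot v g| <= e * `|v|.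

Lemma dotE (u v : pt R) : dot u v =
  u 0 0 * v 0 0 + u 0 1 * v 0 1 + u 0 2%:R * v 0 2%:R + u 0 3%:R * v 0 3%:R.
Proof.
rewrite /dot !big_ord_recl big_ord0 addr0 !addrA.
by congr (_ * _ + _ * _ + _ * _ + _ * _); congr (_ 0 _); apply: val_inj.
Qed.

Lemma dot_delta v k : dot (delta_mx 0 k) v = v 0 k.
Proof.
rewrite /dot (bigD1 k) //= big1 ?addr0.
  by rewrite mxE !eqxx mul1r.
by move=> j jk; rewrite mxE eqxx (negbTE jk) mul0r.
Qed.

Lemma dotC u v : dot u v = dot v u.
Proof. by apply: eq_bigr => k _; rewrite mulrC. Qed.

Lemma dotDl u v w : dot (u + v) w = dot u w + dot v w.
Proof. by rewrite -big_split; apply: eq_bigr => k _; rewrite mxE mulrDl. Qed.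

Lemma dotZl c u w : dot (c *: u) w = c * dot u w.
Proof. by rewrite /dot mulr_sumr; apply: eq_bigr => k _; rewrite mxE mulrA. Qed.

Lemma dotDr u v w : dot w (u + v) = dot w u + dot w v.
Proof. by rewrite !(dotC w) dotDl. Qed.

Lemma dotZr c u w : dot w (c *: u) = c * dot w u.
Proof. by rewrite !(dotC w) dotZl. Qed.

Lemma dotNl u w : dot (- u) w = - dot u w.
Proof. by rewrite -scaleN1r dotZl mulN1r. Qed.

Lemma dotNr u w : dot w (- u) = - dot w u.
Proof. by rewrite !(dotC w) dotNl. Qed.

Lemma dotBl u v w : dot (u - v) w = dot u w - dot v w.
Proof. by rewrite dotDl dotNl. Qed.

Lemma dotBr u v w : dot w (u - v) = dot w u - dot w v.
Proof. by rewrite dotDr dotNr. Qed.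

Lemma dot0l v : dot 0 v = 0.
Proof. by rewrite -(scale0r v) dotZl mul0r. Qed.

Lemma dot0r v : dot v 0 = 0.
Proof. by rewrite dotC dot0l. Qed.

Lemma coord_le_norm v k : `|v 0 k| <= `|v|.
Proof.
rewrite [leRHS]/Num.Def.normr /= mx_normrE.
exact: (le_bigmax _ (fun ij => `|v ij.1 ij.2|) (ord0, k)).
Qed.

Lemma norm_le_coord v c : 0 <= c -> (forall k, `|v 0 k| <= c) -> `|v| <= c.
Proof.
move=> c0 H; rewrite [leLHS]/Num.Def.normr /= mx_normrE.
by apply/bigmax_le => // -[i k] _ /=; rewrite (ord1 i).
Qed.

Lemma dot_le_norm u v : `|dot u v| <= 4 * `|u| * `|v|.
Proof.
apply: le_trans (ler_norm_sum _ _ _) _.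
have -> : 4 * `|u| * `|v| = \sum_(k < 4) `|u| * `|v|.
  by rewrite sumr_const card_ord -mulrA mulr_natl.
by apply: ler_sum => k _; rewrite normrM ler_pM ?coord_le_norm.
Qed.

Definition dotlin (g : pt R) : pt R -> R := dot^~ g.

Fact dotlin_linear (g : pt R) : linear (dotlin g : pt R -> R^o).
Proof. by move=> a u v; rewrite /dotlin dotDl dotZl. Qed.

HB.instance Definition _ (g : pt R) :=
  GRing.isLinear.Build R (pt R) R^o _ (dotlin g) (dotlin_linear g).

Lemma dotlin_continuous (g : pt R) : continuous (dotlin g : pt R -> R^o).
Proof.
suff H : continuous (dotlin g : pt R -> R) by exact: H.
rewrite /dotlin /dot => y.
apply: (@cvg_big _ _ _ _ xpredT (@add_continuous R) _ _ _ _ _ (nbhs_filter y)) => k _.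
by apply: cvgM; [exact: coord_continuous|exact: cvg_cst].
Qed.

(** The epsilon form is what the estimates on the nearest-point projection
produce; this turns such an estimate into differentiability. *)
Lemma is_gradP f x (g : pt R) :
  is_grad f x g <-> differentiable f x /\ grad f x = g.
Proof.
split=> [H|[df <-]].
  have E : (f : pt R -> R^o) \o shift x = cst (f x) + (dotlin g : pt R -> R^o) +o_ (0 : pt R) id.
    apply/eqaddoP => _/posnumP[e]; have := H e%:num [gt0 of e%:num].
    apply: filterS => v; rewrite !fctE /=.
    by rewrite [v + x]addrC opprD addrA.
  have D := diff_unique (@dotlin_continuous g) E.
  have df : differentiable f x.
    apply/diff_locallyxP; rewrite D; split; first exact: dotlin_continuous.
    by move=> h; rewrite [LHS](congr1 (fun F => F h) E).
  split=> //; apply/rowP => k; rewrite mxE /pd deriveE // D.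
  by rewrite /= /dotlin dot_delta.
move=> e e0.
have /diff_locallyxP[_ E] := df.
have {}E : (f : pt R -> R^o) \o shift x = cst (f x) + ('d f x : pt R -> R^o) +o_ (0 : pt R) id.
  by apply/funext => h; rewrite /= E.
move/eqaddoP : E => /(_ _ e0); apply: filterS => v; rewrite !fctE /=.
rewrite [v + x]addrC opprD addrA.
suff -> : 'd f x v = dot v (grad f x) by [].
rewrite {1}[v]row_sum_delta linear_sum /=; apply: eq_bigr => k _.
by rewrite linearZ /= -deriveE // mxE.
Qed.

End Gradients.

(** * Calculus of partial derivatives *)

Section PartialCalculus.
Context {R : realType}.
Implicit Types (f g : pt R -> R) (x y v : pt R) (k : 'I_4).

Lemma pd_derivable f x k : differentiable f x ->
  derivable f x (delta_mx 0 k).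
Proof. by move=> df; exact: diff_derivable. Qed.

Lemma pd_cst (c : R) x k : pd k (fun=> c) x = 0.
Proof. exact: derive_cst. Qed.

Lemma pdD f g x k : differentiable f x -> differentiable g x ->
  pd k (fun y => f y + g y) x = pd k f x + pd k g x.
Proof. by move=> df dg; apply: deriveD; exact: pd_derivable. Qed.

Lemma pdN f x k : differentiable f x -> pd k (fun y => - f y) x = - pd k f x.
Proof. by move=> df; apply: deriveN; exact: pd_derivable. Qed.

Lemma pdM f g x k : differentiable f x -> differentiable g x ->
  pd k (fun y => f y * g y) x = pd k f x * g x + f x * pd k g x.
Proof.
move=> df dg; rewrite /pd.
rewrite -[LHS]/('D_(delta_mx 0 k) (f * g) x) deriveM; [|exact: pd_derivable..].
by rewrite /GRing.scale /= addrC [g x * _]mulrC.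
Qed.

Lemma pdV f x k : differentiable f x -> f x != 0 ->
  pd k (fun y => (f y)^-1) x = - ((f x)^-1 * (f x)^-1 * pd k f x).
Proof.
move=> df fx0; rewrite /pd deriveV //; last exact: pd_derivable.
by rewrite /GRing.scale /= expr2 invfM mulNr.
Qed.

Lemma pdZ (c : R) f x k : differentiable f x ->
  pd k (fun y => c * f y) x = c * pd k f x.
Proof. by move=> df; rewrite pdM // pd_cst mul0r add0r. Qed.

Lemma pd_sum (F : 'I_4 -> pt R -> R) x k :
  (forall i, differentiable (F i) x) ->
  pd k (fun y => \sum_(i < 4) F i y) x = \sum_(i < 4) pd k (F i) x.
Proof.
move=> dF; rewrite /pd -(@derive_sum _ _ _ _ F); last first.
  by move=> i; exact: pd_derivable.
by congr derive; apply/funext => y; rewrite fct_sumE.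
Qed.

Lemma differentiable_scomp (h : R -> R) f x :
  differentiable f x -> derivable h (f x) 1 ->
  differentiable (fun y => h (f y)) x.
Proof.
move=> df dh; apply: (@differentiable_comp _ _ _ _ f h) => //.
exact/derivable1_diffP.
Qed.

Lemma pd_scomp (h : R -> R) (dh : R) f x k :
  differentiable f x -> is_derive (f x) 1 h dh ->
  pd k (fun y => h (f y)) x = dh * pd k f x.
Proof.
move=> df [hd <-].
have dhf := differentiable_scomp df hd.
have dh' : differentiable (h : R -> R^o) (f x) by exact/derivable1_diffP.
rewrite /pd !deriveE // -[fun y => h (f y)]/((h : R -> R^o) \o (f : pt R -> R^o)).
rewrite (@diff_comp _ _ _ _ (f : pt R -> R^o) (h : R -> R^o)) //=.
rewrite -[X in 'd h _ X]mulr1 -[LHS]/('d h (f x) (_ *: 1)) linearZ /=.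
by rewrite mulrC.
Qed.

Lemma is_derive_line f x v (t : R) : differentiable f (x + t *: v) ->
  is_derive t 1 (fun s : R => f (x + s *: v)) (dot v (grad f (x + t *: v))).
Proof.
move=> df.
have -> : dot v (grad f (x + t *: v)) = 'D_v f (x + t *: v).
  rewrite deriveE //; move: (x + t *: v) df => y df.
  rewrite [in RHS](row_sum_delta v) linear_sum /=.
  by apply: eq_bigr => k _; rewrite linearZ /= -deriveE // mxE.
have : derivable f (x + t *: v) v by exact: diff_derivable.
rewrite /derivable => H.
have E : (fun h : R => h^-1 *: (((fun s : R => f (x + s *: v)) \o shift t) (h *: 1)
                                - f (x + t *: v))) =
         (fun h : R => h^-1 *: ((f \o shift (x + t *: v)) (h *: v) - f (x + t *: v))).
  apply/funext => h /=; congr (_ *: (f _ - _)).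
  by rewrite [h *: 1]mulr1 scalerDl addrCA.
by apply: DeriveDef; [rewrite /derivable E|rewrite /derive E].
Qed.

Lemma near_differentiable f g x : {near x, f =1 g} ->
  differentiable f x -> differentiable g x.
Proof.
move=> fg df.
have /is_gradP [df' _] : is_grad g x (grad f x) => //.
have /(is_gradP f) H : differentiable f x /\ grad f x = grad f x by [].
move=> e e0; have fgx : f x = g x := nbhs_singleton fg.
have : \forall v \near (0 : pt R), f (x + v) = g (x + v).
  move: fg; rewrite (near_shift (0 : pt R) x) subr0; apply: filterS => v /=.
  by rewrite addrC.
move/filterS2; apply; last exact: H e0.
by move=> v <-; rewrite -fgx.
Qed.

Lemma near_pd f g x k : {near x, f =1 g} -> pd k f x = pd k g x.
Proof. exact: near_eq_derive. Qed.

End PartialCalculus.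

(** * Closure properties of smooth functions *)

Section Smoothness.
Context {R : realType}.
Implicit Types (U : set (pt R)) (f g : pt R -> R) (x : pt R) (n : nat).

(** Smoothness up to a finite order, so that the closure properties below go by
induction on the order. *)
Definition Ck n U f :=
  forall (s : seq 'I_4) x, (size s <= n)%N -> U x -> differentiable (pds s f) x.

Lemma smooth_onE U f : smooth_on U f <-> open U /\ forall n, Ck n U f.
Proof.
split=> -[oU H]; split=> //; first by move=> n s x _; exact: H.
by move=> s x; exact: (H (size s)).
Qed.

Lemma CkS n U f : Ck n.+1 U f <->
  (forall x, U x -> differentiable f x) /\ forall j, Ck n U (pd j f).
Proof.
split=> [H|[H0 H] s x].
  split=> [x Ux|j s x sn Ux]; first exact: (H [::]).
  by have := H (rcons s j) x; rewrite size_rcons ltnS /pds foldr_rcons; apply.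
elim/last_ind: s => [|s j _] sn Ux; first exact: H0.
by rewrite /pds foldr_rcons; apply: H => //; rewrite size_rcons ltnS in sn.
Qed.

Lemma Ck_diff n U f x : Ck n U f -> U x -> differentiable f x.
Proof. by move=> /(_ [::] x (leq0n _)). Qed.

Lemma pds_congr U f g : open U -> (forall x, U x -> f x = g x) ->
  forall s x, U x -> pds s f x = pds s g x.
Proof.
move=> oU fg; elim=> [|k s IH] x Ux /=; first exact: fg.
apply: near_pd; have : nbhs x U by exact: open_nbhs_nbhs.
by apply: filterS => y Uy; exact: IH.
Qed.

Lemma Ck_congr n U f g : open U -> (forall x, U x -> f x = g x) ->
  Ck n U f -> Ck n U g.
Proof.
move=> oU fg H s x sn Ux; apply: (near_differentiable _ (H s x sn Ux)).
have : nbhs x U by exact: open_nbhs_nbhs.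
by apply: filterS => y Uy; exact: (pds_congr oU fg).
Qed.

Lemma Ck0 U f : Ck 0 U f <-> forall x, U x -> differentiable f x.
Proof.
split=> [H x|H s x]; first exact: (Ck_diff H).
by rewrite leqn0 => /eqP/size0nil -> /= Ux; exact: H.
Qed.

Lemma CkW n U f : Ck n.+1 U f -> Ck n U f.
Proof. by move=> H s x sn; apply: H; exact: leqW. Qed.

Lemma CkD n U f g : open U -> Ck n U f -> Ck n U g ->
  Ck n U (fun x => f x + g x).
Proof.
move=> oU; elim: n f g => [|n IH] f g.
  move=> /Ck0 Hf /Ck0 Hg; apply/Ck0 => x Ux.
  by apply: differentiableD; [exact: Hf|exact: Hg].
move=> /CkS[f0 f1] /CkS[g0 g1]; apply/CkS; split=> [x Ux|j].
  by apply: differentiableD; [exact: f0|exact: g0].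
apply: (@Ck_congr n U (fun x => pd j f x + pd j g x)) => // [x Ux|].
  by rewrite pdD //; [exact: f0|exact: g0].
exact: IH.
Qed.

Lemma CkM n U f g : open U -> Ck n U f -> Ck n U g ->
  Ck n U (fun x => f x * g x).
Proof.
move=> oU; elim: n f g => [|n IH] f g.
  move=> /Ck0 Hf /Ck0 Hg; apply/Ck0 => x Ux.
  by apply: differentiableM; [exact: Hf|exact: Hg].
move=> Hf Hg; have [/CkS[f0 f1] /CkS[g0 g1]] := (Hf, Hg).
apply/CkS; split=> [x Ux|j].
  by apply: differentiableM; [exact: f0|exact: g0].
apply: (@Ck_congr n U (fun x => pd j f x * g x + f x * pd j g x)) => //.
  by move=> x Ux; rewrite pdM //; [exact: f0|exact: g0].
by apply: CkD => //; apply: IH => //; exact: CkW.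
Qed.

Lemma Ck_cst n U (c : R) : Ck n U (fun=> c).
Proof.
elim: n c => [|n IH] c; first by apply/Ck0 => x _; exact: differentiable_cst.
apply/CkS; split=> [x _|j]; first exact: differentiable_cst.
have -> : pd j (fun=> c) = (fun=> 0 : R) :> (pt R -> R) by apply/funext => x; rewrite pd_cst.
exact: IH.
Qed.

Lemma Ck_sum n U (F : 'I_4 -> pt R -> R) : open U -> (forall i, Ck n U (F i)) ->
  Ck n U (fun x => \sum_(i < 4) F i x).
Proof.
move=> oU H; rewrite (_ : (fun _ => _) = (fun x =>
  F ord0 x + (F (lift ord0 ord0) x + (F (lift ord0 (lift ord0 ord0)) x +
  F (lift ord0 (lift ord0 (lift ord0 ord0))) x)))).
  by do ![apply: CkD => //].
by apply/funext => x; rewrite !big_ord_recl big_ord0 addr0.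
Qed.

(** The derivative of [1 / f] is a polynomial in [1 / f] and [f'], so the
regularity of [1 / f] lags one order behind that of [f'] and the induction on the
order closes; the same holds for [exp f]. *)
Lemma CkV n U f : open U -> (forall x, U x -> f x != 0) -> Ck n U f ->
  Ck n U (fun x => (f x)^-1).
Proof.
move=> oU fN0; elim: n f fN0 => [|n IH] f fN0.
  by move=> /Ck0 Hf; apply/Ck0 => x Ux; apply: differentiableV; [exact: Hf|exact: fN0].
move=> Hf; have /CkS[f0 f1] := Hf; apply/CkS; split=> [x Ux|j].
  by apply: differentiableV; [exact: f0|exact: fN0].
apply: (@Ck_congr n U (fun x => ((-1) * ((f x)^-1 * (f x)^-1)) * pd j f x)) => //.
  move=> x Ux; rewrite pdV; [|exact: f0|exact: fN0].
  by rewrite mulN1r mulNr.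
have Hi : Ck n U (fun x => (f x)^-1) by apply: IH => //; exact: CkW.
by do ![apply: CkM => //]; exact: Ck_cst.
Qed.

Lemma Ck_exp n U f : open U -> Ck n U f -> Ck n U (fun x => expR (f x)).
Proof.
move=> oU; elim: n f => [|n IH] f.
  move=> /Ck0 Hf; apply/Ck0 => x Ux; apply: differentiable_scomp => //.
  exact: Hf.
move=> Hf; have /CkS[f0 f1] := Hf; apply/CkS; split=> [x Ux|j].
  by apply: differentiable_scomp => //; exact: f0.
apply: (@Ck_congr n U (fun x => expR (f x) * pd j f x)) => //.
  by move=> x Ux; rewrite (@pd_scomp _ (@expR R) (expR (f x))) //; exact: f0.
by apply: CkM => //; apply: IH; exact: CkW.
Qed.

Lemma Ck_ln n U f : open U -> (forall x, U x -> 0 < f x) -> Ck n U f ->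
  Ck n U (fun x => ln (f x)).
Proof.
move=> oU fp; case: n => [|n].
  move=> /Ck0 Hf; apply/Ck0 => x Ux; apply: differentiable_scomp.
    exact: Hf.
  by have [] := is_derive1_ln (fp _ Ux).
move=> Hf; have /CkS[f0 f1] := Hf; apply/CkS; split=> [x Ux|j].
  apply: differentiable_scomp; first exact: f0.
  by have [] := is_derive1_ln (fp _ Ux).
apply: (@Ck_congr n U (fun x => (f x)^-1 * pd j f x)) => //.
  by move=> x Ux; rewrite (pd_scomp j (f0 x Ux) (is_derive1_ln (fp x Ux))).
apply: CkM => //; apply: CkV => //; last exact: CkW.
by move=> x Ux; rewrite gt_eqF ?fp.
Qed.

Lemma smooth_on_diff U f s x : smooth_on U f -> U x -> differentiable (pds s f) x.
Proof. by move=> [_ H]; exact: H. Qed.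

Lemma smooth_on_sub U V f : open V -> V `<=` U -> smooth_on U f -> smooth_on V f.
Proof. by move=> oV VU [oU H]; split=> // s x /VU; exact: H. Qed.

Lemma smooth_pd U f k : smooth_on U f -> smooth_on U (pd k f).
Proof.
move=> [oU H]; split=> // s x Ux.
by have := H (rcons s k) x Ux; rewrite /pds foldr_rcons.
Qed.

Lemma smooth_D U f g : smooth_on U f -> smooth_on U g ->
  smooth_on U (fun x => f x + g x).
Proof.
move=> /smooth_onE[oU Hf] /smooth_onE[_ Hg].
by apply/smooth_onE; split=> // n; apply: CkD.
Qed.

Lemma smooth_M U f g : smooth_on U f -> smooth_on U g ->
  smooth_on U (fun x => f x * g x).
Proof.
move=> /smooth_onE[oU Hf] /smooth_onE[_ Hg].
by apply/smooth_onE; split=> // n; apply: CkM.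
Qed.

Lemma smooth_cst U (c : R) : open U -> smooth_on U (fun=> c).
Proof. by move=> oU; apply/smooth_onE; split=> // n; exact: Ck_cst. Qed.

Lemma smooth_sum U (F : 'I_4 -> pt R -> R) : (forall i, smooth_on U (F i)) ->
  smooth_on U (fun x => \sum_(i < 4) F i x).
Proof.
move=> H; have [oU _] := H 0; apply/smooth_onE; split=> // n.
by apply: Ck_sum => // i; have /smooth_onE[] := H i.
Qed.

Lemma smooth_exp U f : smooth_on U f -> smooth_on U (fun x => expR (f x)).
Proof.
by move=> /smooth_onE[oU Hf]; apply/smooth_onE; split=> // n; apply: Ck_exp.
Qed.

Lemma smooth_ln U f : (forall x, U x -> 0 < f x) -> smooth_on U f ->
  smooth_on U (fun x => ln (f x)).
Proof.
move=> fp /smooth_onE[oU Hf]; apply/smooth_onE; split=> // n.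
exact: Ck_ln.
Qed.

Lemma smooth_N U f : smooth_on U f -> smooth_on U (fun x => - f x).
Proof.
move=> Hf; have [oU _] := Hf.
have -> : (fun x => - f x) = (fun x => (fun=> -1) x * f x).
  by apply/funext => x; rewrite mulN1r.
by apply: smooth_M => //; exact: smooth_cst.
Qed.
End Smoothness.

(** * Mean value, symmetry of second derivatives, Taylor expansion *)

Section TaylorExpansions.
Context {R : realType}.
Implicit Types (f g : pt R -> R) (x y u v w : pt R) (i j k : 'I_4).

Definition D2 f x u v := \sum_(k < 4) u 0 k * dot v (grad (pd k f) x).

Definition D3 f x u v w := \sum_(k < 4) u 0 k * D2 (pd k f) x v w.

Definition near_diff f x := \forall y \near x, differentiable f y.

Definition diff2 f x := near_diff f x /\ forall k, differentiable (pd k f) x.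

Lemma near_radius (P : pt R -> Prop) x : (\forall y \near x, P y) ->
  exists2 d : R, 0 < d & forall v, `|v| < d -> P (x + v).
Proof.
move=> /nbhs_normP[d /= d0 H]; exists d => // v vd; apply: H => /=.
by rewrite opprD addNKr normrN.
Qed.

Lemma diff_radius f x (e : R) : differentiable f x -> 0 < e ->
  exists2 d : R, 0 < d & forall v, `|v| < d ->
    `|f (x + v) - f x - dot v (grad f x)| <= e * `|v|.
Proof.
move=> df e0.
have /(is_gradP f) H : differentiable f x /\ grad f x = grad f x by [].
have [d d0 Hd] := near_radius (H e e0); exists d => // v vd.
by have := Hd v vd; rewrite add0r.
Qed.

Lemma mvt01 (g dg : R -> R) :
  (forall t : R, 0 <= t <= 1 -> is_derive t 1 g (dg t)) ->
  exists2 c : R, 0 < c < 1 & g 1 - g 0 = dg c.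
Proof.
move=> H.
have H1 (t : R) : t \in `]0, 1[%R -> is_derive t 1 g (dg t).
  by rewrite in_itv /= => /andP[t0 t1]; apply: H; rewrite !ltW.
have H2 : {within `[(0 : R), 1], continuous g}.
  apply: derivable_within_continuous => t; rewrite in_itv /= => t01.
  by have [] := H t t01.
have [c c01 E] := MVT ltr01 H1 H2.
by exists c; [move: c01; rewrite in_itv|rewrite E subr0 mulr1].
Qed.

Lemma mvt_line f x v :
  (forall t : R, 0 <= t <= 1 -> differentiable f (x + t *: v)) ->
  exists2 c : R, 0 < c < 1 & f (x + v) - f x = dot v (grad f (x + c *: v)).
Proof.
move=> df.
have D (t : R) : 0 <= t <= 1 -> is_derive t 1 (fun s => f (x + s *: v))
    (dot v (grad f (x + t *: v))).
  by move=> t01; apply: is_derive_line; exact: df.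
have [c c01 E] := @mvt01 _ _ D.
exists c => //.
by move: E; rewrite scale1r scale0r addr0.
Qed.

Lemma norm_delta k : `|delta_mx 0 k : pt R| <= 1.
Proof.
apply: norm_le_coord => // j; rewrite mxE eqxx /=.
by case: (j == k); rewrite ?normr1 ?normr0.
Qed.

Let second_diff f x i j (s : R) :=
  f (x + s *: delta_mx 0 i + s *: delta_mx 0 j) - f (x + s *: delta_mx 0 i)
  - (f (x + s *: delta_mx 0 j) - f x).

(** The mean value theorem applied to the increment of [f] in direction [i],
as a function along direction [j]. The first-order expansion of [pd j f] at [x] then
controls the difference, so the second derivatives may be discontinuous. *)
Lemma second_diffE f x i j (e : R) :
  near_diff f x -> differentiable (pd j f) x -> 0 < e ->
  exists2 d : R, 0 < d & forall s, 0 < s < d ->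
    `|second_diff f x i j s - s ^+ 2 * pd i (pd j f) x| <= e * s ^+ 2.
Proof.
move=> /near_radius[r r0 Hr] dj e0.
have [d d0 Hd] := diff_radius dj (divr_gt0 e0 (ltr0n R 3)).
exists (Num.min r d / 2); first by rewrite divr_gt0 // lt_min r0.
move=> s /andP[s0]; rewrite ltr_pdivlMr // lt_min => /andP[sr sd].
set ei : pt R := delta_mx 0 i; set ej : pt R := delta_mx 0 j.
have nei : `|ei| <= 1 := norm_delta i.
have nej : `|ej| <= 1 := norm_delta j.
have n2 t : 0 <= t <= 1 -> `|t *: (s *: ej)| <= s.
  case/andP=> t0 t1; rewrite !normrZ (ger0_norm t0) (gtr0_norm s0).
  have := ler_pM t0 (mulr_ge0 (ltW s0) (normr_ge0 ej)) t1
    (ler_wpM2l (ltW s0) nej).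
  by rewrite mul1r mulr1.
have n1 t : 0 <= t <= 1 -> `|s *: ei + t *: (s *: ej)| <= s * 2.
  move=> t01; apply: le_trans (ler_normD _ _) _.
  rewrite mulr_natr mulr2n lerD ?n2 // normrZ (gtr0_norm s0).
  by rewrite -[leRHS]mulr1 ler_wpM2l // ltW.
have s2 : s < s * 2 by rewrite ltr_pMr // ltr1n.
have D (t : R) : 0 <= t <= 1 -> is_derive t 1
  (fun t => f ((x + s *: ei) + t *: (s *: ej)) - f (x + t *: (s *: ej)))
  (dot (s *: ej) (grad f ((x + s *: ei) + t *: (s *: ej)))
          - dot (s *: ej) (grad f (x + t *: (s *: ej)))).
  move=> t01; apply: is_deriveB; apply: is_derive_line.
    by rewrite -addrA; apply: Hr; exact: le_lt_trans (n1 _ t01) sr.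
  by apply: Hr; exact: le_lt_trans (n2 _ t01) (lt_trans s2 sr).
have [c /andP[/ltW c0 /ltW c1] E] := mvt01 D.
have c01 : 0 <= c <= 1 by rewrite c0.
move: E; rewrite !scale1r !scale0r !addr0 => E.
rewrite /second_diff -/ei -/ej.
have -> : f (x + s *: ei + s *: ej) - f (x + s *: ei) - (f (x + s *: ej) - f x)
   = s * (pd j f (x + (s *: ei + c *: (s *: ej))) - pd j f (x + c *: (s *: ej))).
  have -> : s * (pd j f (x + (s *: ei + c *: (s *: ej)))
                 - pd j f (x + c *: (s *: ej))) =
      dot (s *: ej) (grad f (x + s *: ei + c *: (s *: ej)))
    - dot (s *: ej) (grad f (x + c *: (s *: ej))).
    by rewrite !dotZl !dot_delta !mxE -mulrBr addrA.
  by rewrite -E; ring.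
have H1 := Hd _ (le_lt_trans (n1 c c01) sd).
have H2 := Hd _ (le_lt_trans (n2 c c01) (lt_trans s2 sd)).
have {}H1 := le_trans H1 (ler_wpM2l (ltW (divr_gt0 e0 (ltr0n R 3))) (n1 c c01)).
have {}H2 := le_trans H2 (ler_wpM2l (ltW (divr_gt0 e0 (ltr0n R 3))) (n2 c c01)).
move: H1; rewrite dotDl [dot (s *: ei) _]dotZl dot_delta mxE => H1.
move: H1 H2; set A := pd j f _; set B := pd j f _; set C := pd j f _.
set T := dot _ _; set G := pd i _ _.
move=> H1 H2.
have -> : s * (A - C) - s ^+ 2 * G = s * ((A - B - (s * G + T)) - (C - B - T)).
  by ring.
rewrite normrM (gtr0_norm s0).
have -> : e * s ^+ 2 = s * (e / 3 * (s * 2) + e / 3 * s) by field.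
apply: ler_wpM2l; first exact: ltW.
exact: le_trans (ler_normB _ _) (lerD H1 H2).
Qed.

Lemma second_diffC f x i j s : second_diff f x i j s = second_diff f x j i s.
Proof. by rewrite /second_diff [x + s *: delta_mx 0 i + _]addrAC; ring. Qed.

(** The second difference is symmetric in [i] and [j], and it computes both mixed
derivatives. *)
Lemma schwarz f x i j : diff2 f x -> pd i (pd j f) x = pd j (pd i f) x.
Proof.
move=> [nf df]; apply/eqP; rewrite -subr_eq0 -normr_le0.
apply/ler_addgt0Pl => e e0; rewrite addr0.
have e2 : 0 < e / 2 by rewrite divr_gt0.
have [d1 d10 H1] := second_diffE i nf (df j) e2.
have [d2 d20 H2] := second_diffE j nf (df i) e2.
pose s := Num.min d1 d2 / 2.
have m0 : 0 < Num.min d1 d2 by rewrite lt_min d10.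
have s0 : 0 < s by rewrite divr_gt0.
have sm : s < Num.min d1 d2 by rewrite /s; lra.
move: sm; rewrite lt_min => /andP[sd1 sd2].
have {}H1 := H1 s; rewrite s0 sd1 in H1; have {}H1 := H1 isT.
have {}H2 := H2 s; rewrite s0 sd2 in H2; have {}H2 := H2 isT.
rewrite second_diffC in H2.
have ss : 0 < s ^+ 2 by rewrite exprn_gt0.
rewrite -(ler_pM2l ss) -{1}(gtr0_norm ss) -normrM.
move: (second_diff _ _ _ _ _) (pd i (pd j f) x) (pd j (pd i f) x) H1 H2.
move=> A P Q H1 H2.
have -> : s ^+ 2 * (P - Q) = (A - s ^+ 2 * Q) - (A - s ^+ 2 * P) by ring.
apply: le_trans (ler_normB _ _) _; apply: le_trans (lerD H2 H1) _.
by rewrite -mulrDl -splitr mulrC.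
Qed.

Lemma D2E f x u v : D2 f x u v = \sum_(k < 4) \sum_(l < 4)
  u 0 k * v 0 l * pd l (pd k f) x.
Proof.
apply: eq_bigr => k _; rewrite /dot mulr_sumr; apply: eq_bigr => l _.
by rewrite mxE mulrA.
Qed.

Lemma D2C f x u v : diff2 f x -> D2 f x u v = D2 f x v u.
Proof.
move=> d2; rewrite !D2E exchange_big; apply: eq_bigr => k _.
by apply: eq_bigr => l _; rewrite schwarz // [u 0 _ * _]mulrC.
Qed.

(** The mean value theorem applied to [s |-> f (x + s v)] minus its expansion
reduces the claim to the first-order expansions of the partial derivatives. *)
Lemma taylor2 f x (e : R) : diff2 f x -> 0 < e ->
  exists2 d : R, 0 < d & forall v, `|v| < d ->
    `|f (x + v) - f x - dot v (grad f x) - 2^-1 * D2 f x v v| <= e * `|v| ^+ 2.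
Proof.
move=> [/near_radius[r r0 Hr] df] e0.
have e4 : 0 < e / 4 by rewrite divr_gt0.
have /choice[d Hd] : forall k, exists d : R, 0 < d /\ forall v, `|v| < d ->
    `|pd k f (x + v) - pd k f x - dot v (grad (pd k f) x)| <= e / 4 * `|v|.
  by move=> k; have [d d0 H] := diff_radius (df k) e4; exists d.
exists (Num.min r (\big[Num.min/r]_(k < 4) d k)).
  rewrite lt_min r0 /=; elim/big_ind: _ => // [a b a0 b0|k _].
    by rewrite lt_min a0.
  by have [] := Hd k.
move=> v; rewrite lt_min => /andP[vr vm].
have vd k : `|v| < d k by apply: lt_le_trans vm _; exact: bigmin_le.
pose Q := D2 f x v v.
pose h (t : R) := f (x + t *: v) - t * dot v (grad f x) - t ^+ 2 * (2^-1 * Q).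
pose dh (t : R) := dot v (grad f (x + t *: v)) - dot v (grad f x) - t * Q.
have D (t : R) : 0 <= t <= 1 -> is_derive t 1 h (dh t).
  case/andP=> t0 t1.
  have dft : is_derive t 1 (fun s => f (x + s *: v)) (dot v (grad f (x + t *: v))).
    apply: is_derive_line; apply: Hr; apply: le_lt_trans vr.
    by rewrite normrZ ger0_norm // -[leRHS]mul1r ler_wpM2r.
  have dl (a : R) : is_derive t 1 (fun s : R => s * a) a.
    have -> : (fun s : R => s * a) = a *: id.
      by apply/funext => s; rewrite mulrC.
    by apply: is_derive_eq; rewrite [_ *: 1]mulr1.
  have dq (a : R) : is_derive t 1 (fun s : R => s ^+ 2 * (2^-1 * a)) (t * a).
    have -> : (fun s : R => s ^+ 2 * (2^-1 * a)) = (2^-1 * a) *: (id ^+ 2 : R -> R).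
      by apply/funext => s; rewrite mulrC.
    by apply: is_derive_eq; rewrite /GRing.scale /= expr1; field.
  by apply: is_deriveB.
have [c /andP[c0 c1]] := mvt01 D.
rewrite /h scale1r scale0r addr0 !mul0r expr1n expr0n mul0r !mul1r !subr0.
move=> E.
have -> : f (x + v) - f x - dot v (grad f x) - 2^-1 * D2 f x v v = dh c.
  by rewrite -E /Q; ring.
have -> : dh c = \sum_(k < 4) v 0 k *
  (pd k f (x + c *: v) - pd k f x - dot (c *: v) (grad (pd k f) x)).
  rewrite /dh /Q /D2 -dotBr mulr_sumr {1}/dot -!sumrB; apply: eq_bigr => k _.
  by rewrite dotZl !mxE !mulrBr mulrCA.
apply: le_trans (ler_norm_sum _ _ _) _.
have -> : e * `|v| ^+ 2 = \sum_(k < 4) (`|v| * (e / 4 * `|v|)).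
  by rewrite sumr_const card_ord -mulr_natl; field.
apply: ler_sum => k _; rewrite normrM ler_pM ?coord_le_norm //.
have cv : `|c *: v| <= `|v|.
  by rewrite normrZ gtr0_norm // -[leRHS]mul1r ler_wpM2r // ltW.
have [_ /(_ _ (le_lt_trans cv (vd k)))] := Hd k.
by move=> H; apply: le_trans H _; rewrite ler_wpM2l // ltW.
Qed.
End TaylorExpansions.

(** * Local bounds and Lipschitz estimates *)

Section Lipschitz.
Context {R : realType}.
Implicit Types (f g : pt R -> R) (x y u v w : pt R) (i j k : 'I_4).

Lemma smooth_near_diff U f s x : smooth_on U f -> U x -> near_diff (pds s f) x.
Proof.
move=> [oU H] Ux; have : nbhs x U by exact: open_nbhs_nbhs.
by apply: filterS => y; exact: H.
Qed.

Lemma smooth_diff2 U f s x : smooth_on U f -> U x -> diff2 (pds s f) x.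
Proof.
by move=> H Ux; split=> [|k]; [exact: smooth_near_diff Ux|exact: (H.2 (k :: s))].
Qed.

Lemma near_bounded f x : differentiable f x ->
  \forall y \near x, `|f y| <= `|f x| + 1.
Proof.
move=> /differentiable_continuous/cvgrPdist_le/(_ 1 ltr01); apply: filterS => y.
rewrite distrC => H; rewrite -[f y](subrK (f x)) addrC.
by apply: le_trans (ler_normD _ _) _; rewrite lerD2l.
Qed.

Lemma ball_segment x y z (r t : R) : `|y - x| < r -> `|z - x| < r ->
  0 <= t <= 1 -> `|z + t *: (y - z) - x| < r.
Proof.
move=> yr zr /andP[t0 t1].
have -> : z + t *: (y - z) - x = (1 - t) *: (z - x) + t *: (y - x).
  by apply/rowP => k; rewrite !mxE; ring.
apply: le_lt_trans (ler_normD _ _) _.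
rewrite !normrZ (ger0_norm t0) ger0_norm ?subr_ge0 //.
move: yr zr; move: (`|y - x|) (`|z - x|) => a b ar br.
have [->|tn0] := eqVneq t 0; first by rewrite subr0 mul0r addr0 mul1r.
have tp : 0 < t by rewrite lt_def tn0.
have -> : r = (1 - t) * r + t * r by ring.
rewrite ler_ltD // ?ltr_pM2l //.
by rewrite ler_wpM2l ?subr_ge0 // ltW.
Qed.

Lemma near_lipschitz f x : near_diff f x -> (forall k, differentiable (pd k f) x) ->
  exists2 C : R, 0 < C & exists2 r : R, 0 < r &
    forall y z, `|y - x| < r -> `|z - x| < r -> `|f y - f z| <= C * `|y - z|.
Proof.
move=> nf df; pose C := 4 * (1 + \sum_(k < 4) `|pd k f x|).
have C0 : 0 < C by rewrite mulr_gt0 // ltr_pwDl // sumr_ge0.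
exists C => //.
have : \forall y \near x, differentiable f y /\ (forall k, `|pd k f y| <= C / 4).
  near=> y; split; first by near: y.
  near: y; apply: filter_forall => k.
  have := near_bounded (df k); apply: filterS => y /le_trans; apply.
  rewrite /C mulrAC divff // mul1r addrC lerD2l (bigD1 k) //=.
  by rewrite lerDl sumr_ge0.
move=> /near_radius[r r0 Hr]; exists r => // y z yr zr.
have seg (t : R) : 0 <= t <= 1 -> `|z + t *: (y - z) - x| < r.
  by move=> t01; exact: ball_segment.
have df01 (t : R) : 0 <= t <= 1 -> differentiable f (z + t *: (y - z)).
  by move=> t01; have [+ _] := Hr _ (seg t t01); rewrite addrC subrK.
have [c /andP[c0 c1]] := mvt_line df01.
rewrite [z + (y - z)]addrC subrK => ->.
have c01 : 0 <= c <= 1 by rewrite !ltW.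
have [_] := Hr _ (seg c c01); rewrite addrC subrK => H.
apply: le_trans (dot_le_norm _ _) _.
have {}H : `|grad f (z + c *: (y - z))| <= C / 4.
  by apply: norm_le_coord => [|k]; rewrite ?mxE ?divr_ge0 // ltW.
have -> : C * `|y - z| = 4 * `|y - z| * (C / 4) by field.
by rewrite ler_wpM2l // mulr_ge0.
Unshelve. all: by end_near. Qed.

Lemma min_radius (d : 'I_4 -> R) :
  (forall k, 0 < d k) -> exists2 r : R, 0 < r & forall k, r <= d k.
Proof.
move=> d0; exists (\big[Num.min/1]_(k < 4) d k).
  by elim/big_ind: _ => // [a b a0 b0]; rewrite lt_min a0.
by move=> k; exact: bigmin_le.
Qed.

Lemma near_lipschitz_grad f x : diff2 f x -> (forall k, diff2 (pd k f) x) ->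
  exists2 C : R, 0 < C & exists2 r : R, 0 < r &
    forall y z, `|y - x| < r -> `|z - x| < r ->
      `|grad f y - grad f z| <= C * `|y - z|.
Proof.
move=> d2 d3.
have /choice[C HC] : forall k, exists C : R, 0 < C /\ exists2 r : R, 0 < r &
    forall y z, `|y - x| < r -> `|z - x| < r ->
      `|pd k f y - pd k f z| <= C * `|y - z|.
  move=> k; have [nk dk] := d3 k.
  by have [C C0 H] := near_lipschitz nk dk; exists C.
have /choice[d Hd] : forall k, exists r : R, 0 < r /\
    forall y z, `|y - x| < r -> `|z - x| < r ->
      `|pd k f y - pd k f z| <= C k * `|y - z|.
  by move=> k; have [_ [r r0 H]] := HC k; exists r.
have [r r0 rd] := @min_radius d (fun k => (Hd k).1).
exists (\sum_(k < 4) C k).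
  by rewrite big_ord_recl ltr_pwDl ?(HC _).1 // sumr_ge0 // => k _; rewrite ltW ?(HC _).1.
exists r => // y z yr zr; apply: norm_le_coord => [|k].
  by rewrite mulr_ge0 // sumr_ge0 // => k _; rewrite ltW ?(HC _).1.
rewrite !mxE; have [_ H] := Hd k.
apply: le_trans (H y z (lt_le_trans yr (rd k)) (lt_le_trans zr (rd k))) _.
rewrite ler_wpM2r // (bigD1 k) //= lerDl sumr_ge0 // => j _.
by rewrite ltW ?(HC _).1.
Qed.
End Lipschitz.

(** * Matrix estimates and products with a vanishing factor *)

Section MatrixEstimates.
Context {R : realType}.
Implicit Types (f g : pt R -> R) (x y z u v w : pt R) (i j k : 'I_4).

Definition hessmx f x : 'M[R]_4 := \matrix_(k, j) pd k (pd j f) x.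

Lemma norm_mulmx m (A : 'M[R]_(m.+1, 4)) (B : 'M[R]_4) :
  `|A *m B| <= 4 * `|A| * `|B|.
Proof.
have co m' n' (M : 'M[R]_(m'.+1, n'.+1)) (a : 'I_m'.+1) (b : 'I_n'.+1) :
    `|M a b| <= `|M|.
  rewrite [leRHS]/Num.Def.normr /= mx_normrE.
  exact: (le_bigmax _ (fun ij => `|M ij.1 ij.2|) (a, b)).
rewrite [leLHS]/Num.Def.normr /= mx_normrE; apply/bigmax_le => [|[i j] _ /=].
  by rewrite !mulr_ge0.
rewrite mxE; apply: le_trans (ler_norm_sum _ _ _) _.
have -> : 4 * `|A| * `|B| = \sum_(k < 4) `|A| * `|B|.
  by rewrite sumr_const card_ord -mulrA mulr_natl.
by apply: ler_sum => k _; rewrite normrM ler_pM ?co.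
Qed.

Lemma dot_ge_norm v : `|v| ^+ 2 <= dot v v.
Proof.
have dv0 : 0 <= dot v v by apply: sumr_ge0 => k _; rewrite -expr2 sqr_ge0.
rewrite -(sqr_sqrtr dv0) lerXn2r ?nnegrE ?sqrtr_ge0 //.
apply: norm_le_coord => [|k]; first exact: sqrtr_ge0.
rewrite -sqrtr_sqr ler_wsqrtr // /dot (bigD1 k) //= -expr2 lerDl.
by apply: sumr_ge0 => j _; rewrite -expr2 sqr_ge0.
Qed.

Lemma sum2_ge (F : 'I_4 -> 'I_4 -> R) k j : (forall a b, 0 <= F a b) ->
  F k j <= \sum_(a < 4) \sum_(b < 4) F a b.
Proof.
move=> F0; rewrite (bigD1 k) //= (bigD1 j) //= -addrA lerDl addr_ge0 ?sumr_ge0 //.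
by move=> a _; apply: sumr_ge0.
Qed.

Lemma unit_norm v : dot v v = 1 -> `|v| <= 1.
Proof.
move=> v1; rewrite -(@expr_le1 _ 2) //.
by rewrite -v1 dot_ge_norm.
Qed.

Lemma addKl (V : zmodType) (x v : V) : x + v - x = v.
Proof. by rewrite addrAC subrr add0r. Qed.

(** A kernel vector [v] satisfies [v = - c v H], and [4 |c| |H| < 1] forces it to
vanish. *)
Lemma unit_addmx (H : 'M[R]_4) (c : R) : 8 * `|c| * `|H| <= 1 ->
  1%:M + c *: H \in unitmx.
Proof.
move=> cH; rewrite -row_free_unit; apply: inj_row_free => v.
rewrite mulmxDr mulmx1 => /(canRL (addrK _)); rewrite sub0r => vE.
have : `|v| <= 4 * `|v| * (`|c| * `|H|).
  by rewrite -normrZ {1}vE normrN norm_mulmx.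
move=> h; apply/eqP; rewrite -normr_le0.
have := ler_wpM2l (normr_ge0 v) cH.
by move: h; move: `|v| `|c| `|H| => a b d; lra.
Qed.

(** [a] and [b] stand for the increments of the nearest point and of the normal:
the first equation comes from [x = proj x + t n], and [b] is [a H] up to a small
error. Multiplying by [H] eliminates [a] from the main terms and leaves a linear
system for [b]. *)
Lemma linear_solve (a b v E : pt R) (P H : 'M[R]_4) (c : R) :
  a = v *m P - c *: b + E ->
  b *m (1%:M + c *: H) = v *m (P *m H) + ((b - a *m H) + E *m H).
Proof.
move=> ->; rewrite mulmxDr mulmx1 -scalemxAr !mulmxDl mulNmx -scalemxAl mulmxA.
move: (v *m P *m H) (c *: (b *m H)) (E *m H) => A1 A2 A3.
by apply/rowP => k; rewrite !mxE; ring.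
Qed.

Lemma differentiable_rV (F : pt R -> pt R) x :
  (forall k, differentiable (fun y => F y 0 k) x) -> differentiable F x.
Proof.
move=> dF; pose G k : pt R -> pt R := fun y => F y 0 k *: (delta_mx 0 k : pt R).
have -> : F = \sum_(k < 4) G k.
  apply/funext => y; rewrite fct_sumE {1}[F y]row_sum_delta.
  by apply: eq_bigr => k _.
apply: differentiable_sum => k.
exact: (@differentiableZl _ _ _ (fun y => F y 0 k) (delta_mx 0 k : pt R)).
Qed.

(** A factor that vanishes at [x] absorbs the lack of differentiability of the
other factor, of which only the limit is used. This yields one more derivative of
the distance at boundary points than the implicit equation gives elsewhere. *)
Lemma is_grad_mul_vanishing (a b : pt R -> R) x (l : R) :
  differentiable a x -> a x = 0 -> b y @[y --> x] --> l ->
  is_grad (fun y => a y * b y) x (l *: grad a x).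
Proof.
move=> da a0 bl e e0.
pose B := 4 * `|grad a x| + 1.
have B0 : 0 < B by rewrite ltr_wpDl // mulr_ge0.
pose e1 := Num.min 1 (e / (2 * (B + `|l| + 1))).
have Bl : 0 < 2 * (B + `|l| + 1) by rewrite mulr_gt0 // ltr_wpDl // addr_ge0 // ltW.
have e10 : 0 < e1 by rewrite lt_min ltr01 divr_gt0.
have [d d0 Hd] := diff_radius da e10.
have /near_radius[d' d'0 Hd'] : \forall y \near x, `|l - b y| <= e1.
  by move/cvgrPdist_le : bl; apply.
apply/nbhs_norm0P; exists (Num.min d d') => /=; first by rewrite lt_min d0.
move=> v /=; rewrite lt_min => /andP[vd vd'].
have := Hd v vd; rewrite a0 subr0 mul0r subr0 dotZr => h1.
have := Hd' v vd'; rewrite distrC => h2.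
have h3 : `|a (x + v)| <= B * `|v|.
  rewrite -[a (x + v)](subrK (dot v (grad a x))).
  apply: le_trans (ler_normD _ _) _; rewrite /B mulrDl mul1r addrC.
  apply: lerD; first by rewrite mulrAC; exact: dot_le_norm.
  apply: le_trans h1 _; rewrite -[leRHS]mul1r ler_wpM2r //.
  by rewrite /e1 ge_min lexx.
have -> : a (x + v) * b (x + v) - l * dot v (grad a x) =
  a (x + v) * (b (x + v) - l) + l * (a (x + v) - dot v (grad a x)) by ring.
apply: le_trans (ler_normD _ _) _; rewrite !normrM.
have h4 := ler_pM (normr_ge0 _) (normr_ge0 _) h3 h2.
have h5 := ler_wpM2l (normr_ge0 l) h1.
apply: le_trans (lerD h4 h5) _.
have -> : B * `|v| * e1 + `|l| * (e1 * `|v|) = e1 * (B + `|l|) * `|v| by ring.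
rewrite ler_wpM2r //.
apply: (@le_trans _ _ (e1 * (2 * (B + `|l| + 1)))).
  rewrite ler_wpM2l ?(ltW e10) //.
  by have := normr_ge0 l; move: `|l| B B0 {h1 h3 h4 h5 Bl e1 e10 Hd Hd' h2} => L B' B'0; lra.
by rewrite -ler_pdivlMr // /e1 ge_min lexx orbT.
Qed.

Lemma bounded_mul_cvg0 (a b : pt R -> R) x (C : R) :
  differentiable a x -> a x = 0 -> (\forall y \near x, `|b y| <= C) ->
  a y * b y @[y --> x] --> (0 : R).
Proof.
move=> da a0 bC; apply/(cvgrPdist_le (FF := nbhs_filter x)) => e e0.
have C1 : 0 < `|C| + 1 by rewrite ltr_wpDl.
have : \forall y \near x, `|a x - a y| <= e / (`|C| + 1).
  by move/differentiable_continuous/cvgrPdist_le : da; apply; exact: divr_gt0.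
apply: filterS2 bC => y bC; rewrite a0 !sub0r !normrN normrM => ay.
have -> : e = e / (`|C| + 1) * (`|C| + 1) by rewrite divfK // gt_eqF.
rewrite ler_pM //; apply: le_trans bC _.
by apply: le_trans (ler_norm C) _; rewrite lerDl.
Qed.

Lemma differentiable_sum4 (F : 'I_4 -> pt R -> R) x :
  (forall m, differentiable (F m) x) ->
  differentiable (fun y => \sum_(m < 4) F m y) x.
Proof.
move=> dF; have -> : (fun y => \sum_(m < 4) F m y) = \sum_(m < 4) F m.
  by apply/funext => y; rewrite fct_sumE.
exact: differentiable_sum.
Qed.

End MatrixEstimates.

(** * Regularity of the distance along normals *)

Section DistanceRegularity.
Context {R : realType}.
Implicit Types (f g : pt R -> R) (x y z u v w : pt R) (i j k : 'I_4).

(** Here [S] is the hypersurface and [s] a defining function with unit gradient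
on it, [proj] a nearest-point map and [t] the signed distance. The last three
conditions are what nearest points of a hypersurface satisfy; the factor 2 compares
the sup norm with the Euclidean norm. *)
Context (S U : set (pt R)) (s : pt R -> R) (x0 : pt R)
  (proj : pt R -> pt R) (t : pt R -> R).
Hypothesis sU : smooth_on U s.
Hypothesis Ux0 : U x0.
Hypothesis Sx0 : S x0.
Hypothesis sS : forall y, S y -> U y -> s y = 0 /\ dot (grad s y) (grad s y) = 1.
Hypothesis projS : forall x, S (proj x).
Hypothesis projE : forall x, x = proj x + t x *: grad s (proj x).
Hypothesis proj_near : forall x, `|x - proj x| <= 2 * `|x - x0|.

Let nu := grad s.
Let p x := grad s (proj x).

Lemma tube_bounds : exists2 C : R, 0 < C & exists2 r : R, 0 < r &
  [/\ forall y, `|y - x0| < r -> U y,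
      forall y z, `|y - x0| < r -> `|z - x0| < r ->
        `|nu y - nu z| <= C * `|y - z| &
      forall y, `|y - x0| < r -> `|hessmx s y| <= C].
Proof.
have [C1 C10 [r1 r10 H1]] : exists2 C : R, 0 < C & exists2 r : R, 0 < r &
    forall y z, `|y - x0| < r -> `|z - x0| < r ->
      `|nu y - nu z| <= C * `|y - z|.
  apply: near_lipschitz_grad; first exact: (smooth_diff2 [::] sU Ux0).
  by move=> k; exact: (smooth_diff2 [:: k] sU Ux0).
pose D := \sum_(k < 4) \sum_(j < 4) (`|pd k (pd j s) x0| + 1).
have D0 : 0 <= D by do 2![apply: sumr_ge0 => ? _]; exact: addr_ge0.
have HD k j : `|pd k (pd j s) x0| + 1 <= D.
  by apply: (@sum2_ge R (fun k j => `|pd k (pd j s) x0| + 1)) => a b; exact: addr_ge0.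
clearbody D.
have /near_radius[r2 r20 H2] : \forall y \near x0, U y /\
    forall k j, `|pd k (pd j s) y| <= `|pd k (pd j s) x0| + 1.
  near=> y; split.
    near: y; apply: open_nbhs_nbhs; split=> //; exact: sU.1.
  near: y; apply: filter_forall => k; apply: filter_forall => j.
  apply: near_bounded; exact: (sU.2 [:: k; j]).
exists (C1 + D); first by rewrite ltr_pwDl.
exists (Num.min r1 r2); first by rewrite lt_min r10.
split=> [y|y z|y].
- rewrite lt_min => /andP[_ yr].
  by have [] := H2 _ yr; rewrite addrC subrK.
- rewrite !lt_min => /andP[yr _] /andP[zr _].
  by apply: le_trans (H1 _ _ yr zr) _; rewrite ler_wpM2r // lerDl.
rewrite lt_min => /andP[_ yr].
have [_] := H2 _ yr; rewrite addrC subrK => H.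
rewrite [leLHS]/Num.Def.normr /= mx_normrE; apply/bigmax_le => [|[k j] _ /=].
  by rewrite addr_ge0 // ltW.
rewrite mxE; apply: le_trans (H k j) _; apply: le_trans (HD k j) _.
by rewrite lerDr ltW.
Unshelve. all: by end_near. Qed.

(** Increments of [x], [proj x] and [t x] are related by [x = proj x + t p], where
[p] is the normal at [proj x]. Pairing with the increment of [proj] makes the
normal components small of second order, because a chord of [S] is tangential up to
second order; this bounds the increment of [proj] by that of [x]. Pairing with
[p x] instead gives the expansion of [t]. *)
Lemma tube_lipschitz : exists2 C : R, 0 < C & exists2 r : R, 0 < r &
  exists2 K : R, 0 < K &
  [/\ forall x, `|x - x0| < r -> [/\ U (proj x), `|hessmx s (proj x)| <= C,
        dot (p x) (p x) = 1, `|t x| <= 8 * `|x - x0| & 32 * C * `|t x| <= 2^-1],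
      forall x z, `|x - x0| < r -> `|z - x0| < r ->
        `|proj z - proj x| <= 8 * `|z - x|,
      forall x z, `|x - x0| < r -> `|z - x0| < r ->
        `|p z - p x| <= 8 * C * `|z - x| &
      forall x z, `|x - x0| < r -> `|z - x0| < r ->
        `|t z - t x - dot (z - x) (p x)| <= K * `|z - x| ^+ 2].
Proof.
have [C C0 [r0 r00 [HU HL HH]]] := tube_bounds.
(* with [|t x| <= 8 |x - x0|] this radius makes [32 C |t x| <= 1/2], so the
   curvature terms are absorbed *)
pose r := Num.min (r0 / 3) (16 * (32 * C))^-1.
have c0 : 0 < 16 * (32 * C) by rewrite mulr_gt0 // mulr_gt0.
have r_gt0 : 0 < r by rewrite lt_min invr_gt0 c0 divr_gt0.
have rr0 : r <= r0 / 3 by rewrite ge_min lexx.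
have rC : r <= (16 * (32 * C))^-1 by rewrite ge_min lexx orbT.
clearbody r.
exists C => //; exists r => //; exists (16 * (17 * C)).
  by rewrite mulr_gt0 // mulr_gt0.
have projB x : `|x - x0| < r -> `|proj x - x0| < r0.
  move=> xr; have xr0 : `|x - x0| < r0 / 3 by exact: lt_le_trans xr rr0.
  have -> : proj x - x0 = (x - x0) - (x - proj x).
    by rewrite opprB [RHS]addrC subrKA.
  apply: le_lt_trans (ler_normB _ _) _.
  apply: le_lt_trans (lerD (lexx _) (proj_near x)) _.
  by move: xr0; move: `|x - x0| => a; lra.
have A x : `|x - x0| < r -> [/\ U (proj x), `|hessmx s (proj x)| <= C,
    dot (p x) (p x) = 1, `|t x| <= 8 * `|x - x0| & 32 * C * `|t x| <= 2^-1].
  move=> xr; have Up := HU _ (projB x xr).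
  have [_ p1] := sS (projS x) Up.
  have pn : `|p x| <= 1 by exact: unit_norm.
  have tb : `|t x| <= 8 * `|x - x0|.
    have -> : t x = dot (x - proj x) (p x).
      by rewrite {2}(projE x) [proj x + _]addrC addrK dotZl p1 mulr1.
    apply: le_trans (dot_le_norm _ _) _.
    have -> : 8 * `|x - x0| = 4 * (2 * `|x - x0|) * 1 by ring.
    by rewrite ler_pM // ?mulr_ge0 // ler_wpM2l.
  split=> //; first exact: HH (projB x xr).
  have xC : 16 * (32 * C) * `|x - x0| <= 1.
    by rewrite -ler_pdivlMl // mulr1; exact: le_trans (ltW xr) rC.
  have := ler_wpM2l (mulr_ge0 (ler0n R 32) (ltW C0)) tb.
  move: xC; move: `|x - x0| `|t x| => a b H1 H2.
  by lra.
(* both ends of the chord are zeros of s, and its gradient turns at most at rate C *)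
have E2 x z : `|x - x0| < r -> `|z - x0| < r ->
    `|dot (proj z - proj x) (p x)| <= 4 * C * `|proj z - proj x| ^+ 2.
  move=> xr zr; have [xB zB] := (projB x xr, projB z zr).
  have sx0 := (sS (projS x) (HU _ xB)).1; have sz0 := (sS (projS z) (HU _ zB)).1.
  have dfs (c : R) : 0 <= c <= 1 ->
      differentiable s (proj x + c *: (proj z - proj x)).
    move=> c01; apply: (sU.2 [::]); apply: HU; exact: ball_segment.
  have [c /andP[c0' c1] E] := mvt_line dfs.
  have c01 : 0 <= c <= 1 by rewrite !ltW.
  move: E; rewrite [proj x + (_ - _)]addrC subrK sx0 sz0 subrr => E.
  have -> : dot (proj z - proj x) (p x) = dot (proj z - proj x)
      (nu (proj x) - nu (proj x + c *: (proj z - proj x))).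
    by rewrite dotBr -E subr0.
  apply: le_trans (dot_le_norm _ _) _.
  have H := HL _ _ xB (ball_segment zB xB c01).
  have -> : 4 * C * `|proj z - proj x| ^+ 2 =
     4 * `|proj z - proj x| * (C * `|proj z - proj x|) by ring.
  rewrite ler_wpM2l ?mulr_ge0 //; apply: le_trans H _.
  rewrite ler_wpM2l //; first exact: ltW.
  rewrite opprD addNKr normrN normrZ gtr0_norm //.
  by rewrite -[leRHS]mul1r ler_wpM2r // ltW.
have B x z : `|x - x0| < r -> `|z - x0| < r ->
    `|proj z - proj x| <= 8 * `|z - x|.
  move=> xr zr.
  have [_ _ _ _ tx] := A x xr; have [_ _ _ _ tz] := A z zr.
  have Ex := E2 x z xr zr; have := E2 z x zr xr.
  rewrite distrC -[proj x - proj z]opprB dotNl normrN => Ez.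
  have E : z - x = (proj z - proj x) + (t z *: p z - t x *: p x).
    by rewrite {1}(projE z) {1}(projE x) opprD addrACA.
  have D : dot (z - x) (proj z - proj x) = dot (proj z - proj x) (proj z - proj x)
      + (t z * dot (proj z - proj x) (p z) - t x * dot (proj z - proj x) (p x)).
    rewrite E; move: (proj z - proj x) => a.
    by rewrite dotDl dotBl !dotZl !(dotC _ a).
  have := dot_ge_norm (proj z - proj x).
  have := dot_le_norm (z - x) (proj z - proj x).
  rewrite D; move: Ex Ez tx tz.
  have := normr_ge0 (proj z - proj x); have := normr_ge0 (z - x).
  move: `|proj z - proj x| `|z - x| (dot (proj z - proj x) (proj z - proj x)).
  move: (dot _ (p x)) (dot _ (p z)) (t x) (t z) => e1 e2 t1 t2 a b q b0 a0.
  move=> h1 h2 k1 k2 h3 h4.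
  have P (e t' : R) : `|e| <= 4 * C * a ^+ 2 -> 32 * C * `|t'| <= 2^-1 ->
      `|t' * e| <= 16^-1 * a ^+ 2.
    move=> he ht; rewrite normrM.
    apply: le_trans (ler_wpM2l (normr_ge0 _) he) _.
    rewrite mulrA ler_wpM2r ?sqr_ge0 //; lra.
  have {h1 k1} := P _ _ h1 k1; have {h2 k2 P} := P _ _ h2 k2.
  move: (t2 * e2) (t1 * e1) h3 h4 => m2 m1.
  rewrite !ler_norml => /andP[_ h3] h4 /andP[m2l _] /andP[_ m1u].
  have H : a ^+ 2 <= 8 * b * a.
    have := mulr_ge0 b0 a0; have := sqr_ge0 a; lra.
  have [->|an0] := eqVneq a 0; first by rewrite mulr_ge0.
  by rewrite -(ler_pM2r (_ : 0 < a)) -?expr2 // lt_def an0.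
have D x z : `|x - x0| < r -> `|z - x0| < r ->
    `|p z - p x| <= C * `|proj z - proj x|.
  by move=> xr zr; exact: HL (projB z zr) (projB x xr).
split=> // x z xr zr.
  apply: le_trans (D x z xr zr) _.
  have -> : 8 * C * `|z - x| = C * (8 * `|z - x|) by ring.
  by rewrite ler_wpM2l ?B // ltW.
have [_ _ p1x _ _] := A x xr; have [_ _ p1z _ tz] := A z zr.
have Ex := E2 x z xr zr.
have Dx := D x z xr zr; have Bx := B x z xr zr.
have E : z - x = (proj z - proj x) + (t z *: p z - t x *: p x).
  by rewrite {1}(projE z) {1}(projE x) opprD addrACA.
have -> : t z - t x - dot (z - x) (p x) = - dot (proj z - proj x) (p x)
    + t z * (2^-1 * dot (p z - p x) (p z - p x)).
  rewrite E; move: (proj z - proj x) => a.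
  rewrite dotDl !dotBl !dotBr !dotZl p1x p1z (dotC (p x) (p z)).
  by move: (dot (p z) (p x)) (dot a (p x)) => b c; field.
apply: le_trans (ler_normD _ _) _; rewrite normrN normrM.
have dd : `|2^-1 * dot (p z - p x) (p z - p x)| <= 2 * C ^+ 2 * `|proj z - proj x| ^+ 2.
  rewrite normrM ger0_norm ?invr_ge0 //.
  have := dot_le_norm (p z - p x) (p z - p x).
  have := ler_pM (normr_ge0 _) (normr_ge0 _) Dx Dx.
  by move: `|p z - p x| `|dot _ _| `|proj z - proj x| => a b c; lra.
have := ler_wpM2l (normr_ge0 (t z)) dd.
have BB : `|proj z - proj x| ^+ 2 <= 8 * 8 * `|z - x| ^+ 2.
  have := ler_pM (normr_ge0 _) (normr_ge0 _) Bx Bx.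
  by rewrite -expr2 mulrACA -[`|z - x| * _]expr2.
have := sqr_ge0 `|proj z - proj x|.
move: Ex tz BB.
move: (`|dot (proj z - proj x) (p x)|) (`|2^-1 * _|) `|t z|.
move: (`|proj z - proj x| ^+ 2) (`|z - x| ^+ 2) => A2 B2 e d T h1 h2 h3 h4 h5.
have A20 : 0 <= 16^-1 * C * A2 by rewrite !mulr_ge0 // ltW.
have : T * (2 * C ^+ 2 * A2) = 32 * C * T * (16^-1 * C * A2) by field.
have := ler_wpM2r A20 h2.
have := ler_wpM2l (ltW C0) h3.
lra.
Qed.

Definition tproj x : 'M[R]_4 := 1%:M - (p x)^T *m p x.

Lemma mul_tproj v x : v *m tproj x = v - dot v (p x) *: p x.
Proof.
rewrite mulmxBr mulmx1 mulmxA; congr (_ - _).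
apply/rowP => k; rewrite !mxE big_ord1 mxE; congr (_ * _).
  by apply: eq_bigr => j _; rewrite mxE.
by rewrite /p /nu mxE.
Qed.

Lemma tube_grad : exists2 r : R, 0 < r & forall x, `|x - x0| < r ->
  is_grad t x (p x) /\ dot (p x) (p x) = 1.
Proof.
have [C C0 [r r0 [K K0 [HA HB HD HT]]]] :=
  tube_lipschitz.
exists r => // x xr; split; last by have [] := HA x xr.
move=> e e0; apply/nbhs_norm0P.
pose d := Num.min (r - `|x - x0|) (e / K).
have rx : 0 < r - `|x - x0| by rewrite subr_gt0.
exists d => /=; first by rewrite lt_min rx divr_gt0.
move=> v /=; rewrite lt_min => /andP[vr vK].
have xvr : `|x + v - x0| < r.
  by rewrite addrAC; apply: le_lt_trans (ler_normD _ _) _; rewrite -ltrBrDl.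
have := HT x (x + v) xr xvr; rewrite addKl => /le_trans; apply.
rewrite expr2 mulrA ler_wpM2r //.
by move: vK; rewrite ltr_pdivlMr // mulrC => /ltW.
Qed.

(** With [H] the Hessian of [s] at [proj x] and [P] the tangential projection, the
normal has derivative [P H (1 + t H)^-1]. It is recorded through the equation that
characterises it, since this equation shows the derivative as a differentiable
matrix plus a multiple of [t], which vanishes at [x0]. *)
Lemma tube_hess : exists2 C : R, 0 < C & exists2 r : R, 0 < r &
  forall x, `|x - x0| < r -> exists2 M : 'M[R]_4,
   M = tproj x *m hessmx s (proj x) - t x *: (M *m hessmx s (proj x)) /\ `|M| <= C &
   forall j, is_grad (fun y => p y 0 j) x (\row_k M k j).
Proof.
have [C C0 [r r0 [K K0 [HA HB HD HT]]]] :=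
  tube_lipschitz.
exists (16 * C); first by rewrite mulr_gt0.
exists r => // x xr.
have [Ux HC p1 _ tx] := HA x xr.
set H := hessmx s (proj x) in HC *.
have pn : `|p x| <= 1 by exact: unit_norm.
have M1u : 1%:M + t x *: H \in unitmx.
  apply: unit_addmx; have := ler_wpM2l (normr_ge0 (t x)) HC.
  by move: tx; move: `|t x| `|H| => a b h1 h2; lra.
set M1 := 1%:M + t x *: H in M1u.
pose M := tproj x *m H *m invmx M1.
have ME : M = tproj x *m H - t x *: (M *m H).
  have : M *m M1 = tproj x *m H by rewrite /M mulmxKV.
  by rewrite mulmxDr mulmx1 -scalemxAr => <-; rewrite addrK.
exists M.
  split=> //.
  have nP : `|tproj x| <= 2.
    rewrite /tproj; apply: le_trans (ler_normB _ _) _.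
    rewrite -(natr1 1) lerD //.
      rewrite [leLHS]/Num.Def.normr /= mx_normrE; apply/bigmax_le => // -[i j] _ /=.
      by rewrite mxE; case: (_ == _); rewrite ?normr1 ?normr0.
    rewrite [leLHS]/Num.Def.normr /= mx_normrE; apply/bigmax_le => // -[i j] _ /=.
    rewrite mxE big_ord1 mxE normrM -[leRHS]mulr1 ler_pM //.
      exact: le_trans (coord_le_norm _ _) pn.
    exact: le_trans (coord_le_norm _ _) pn.
  have h1 : `|tproj x *m H| <= 8 * C.
    apply: le_trans (norm_mulmx _ _) _.
    have -> : 8 * C = 4 * 2 * C by ring.
    by rewrite ler_pM ?mulr_ge0 // ler_wpM2l.
  have h2 : `|t x *: (M *m H)| <= 2^-1 * `|M|.
    rewrite normrZ; apply: le_trans (ler_wpM2l (normr_ge0 _) (norm_mulmx _ _)) _.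
    have := ler_wpM2l (normr_ge0 (t x)) HC.
    move=> /(ler_wpM2l (normr_ge0 M)); have := ler_wpM2r (normr_ge0 M) tx.
    have := normr_ge0 M.
    by move: `|M| `|t x| `|H| => a b c; lra.
  have := le_trans (ler_normB _ _) (lerD h1 h2); rewrite -ME.
  by move: `|M| => a; lra.
move=> j e e0; pose Mi := `|invmx M1| + 1.
have Mi0 : 0 < Mi by rewrite ltr_wpDl.
have e1_0 : 0 < e / (64 * Mi) by rewrite divr_gt0 // mulr_gt0.
have /choice[d1 Hd1] : forall i, exists d : R, 0 < d /\ forall w, `|w| < d ->
    `|pd i s (proj x + w) - pd i s (proj x) - dot w (grad (pd i s) (proj x))|
      <= e / (64 * Mi) * `|w|.
  move=> i; have [d d0 Hd] := diff_radius (sU.2 [:: i] _ Ux) e1_0.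
  by exists d.
have [d d0 dd1] := min_radius (fun i => (Hd1 i).1).
pose K2 := K + 8 * C * (K + 4).
have K20 : 0 < K2 by rewrite addr_gt0 // !mulr_gt0 // addr_gt0.
have KC0 : 0 < 64 * K2 * C * Mi by rewrite !mulr_gt0.
have rx : 0 < r - `|x - x0| by rewrite subr_gt0.
apply/nbhs_norm0P.
exists (Num.min (Num.min (r - `|x - x0|) (d / 8)) (Num.min 1 (e / (64 * K2 * C * Mi)))).
  by rewrite /= !lt_min rx ltr01 !divr_gt0.
move=> v /=; rewrite !lt_min => /andP[/andP[vr vd] /andP[v1 ve]].
have xvr : `|x + v - x0| < r.
  by rewrite addrAC; apply: le_lt_trans (ler_normD _ _) _; rewrite -ltrBrDl.
set a := proj (x + v) - proj x; set b := p (x + v) - p x.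
have av : `|a| <= 8 * `|v|.
  by have := HB x (x + v) xr xvr; rewrite addKl.
have bv : `|b| <= 8 * C * `|v|.
  by have := HD x (x + v) xr xvr; rewrite addKl.
have tv : `|t (x + v) - t x - dot v (p x)| <= K * `|v| ^+ 2.
  by have := HT x (x + v) xr xvr; rewrite addKl.
set q := t (x + v) - t x - dot v (p x) in tv.
have i1 : `|b - a *m H| <= e / (8 * Mi) * `|v|.
  apply: norm_le_coord => [|i]; first by rewrite mulr_ge0 // divr_ge0 // ?mulr_ge0 // ltW.
  have ad : `|a| < d1 i.
    apply: le_lt_trans av _; apply: lt_le_trans (dd1 i).
    by move: vd; rewrite ltr_pdivlMr // mulrC.
  have := (Hd1 i).2 a ad; rewrite /a [proj x + (_ - _)]addrC subrK -/a.
  have -> : (b - a *m H) 0 i = pd i s (proj (x + v)) - pd i s (proj x)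
      - dot a (grad (pd i s) (proj x)).
    rewrite !mxE; congr (_ - _); apply: eq_bigr => k _.
    by rewrite !mxE.
  move=> h; apply: le_trans h _.
  have := ler_wpM2l (ltW e1_0) av.
  have -> : e / (64 * Mi) * (8 * `|v|) = e / (8 * Mi) * `|v|.
    by field; rewrite gt_eqF.
  by [].
pose E2 := - (q *: p x) - (q + dot v (p x)) *: b.
have i2 : a = v *m tproj x - t x *: b + E2.
  rewrite mul_tproj /E2 /a.
  have h1 := projE (x + v); have h2 := projE x.
  have h3 : proj (x + v) = x + v - t (x + v) *: p (x + v).
    by rewrite {2}h1 addrK.
  have h4 : proj x = x - t x *: p x by rewrite {2}h2 addrK.
  rewrite h3 h4 /b /q.
  move: (t (x + v)) (t x) (dot v (p x)) (p (x + v)) (p x) => A1 A2 A3 A4 A5.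
  by apply/rowP => k; rewrite !mxE; ring.
have E2n : `|E2| <= K2 * `|v| ^+ 2.
  rewrite /E2; apply: le_trans (ler_normB _ _) _; rewrite normrN !normrZ.
  have h1 := dot_le_norm v (p x).
  have h2 : `|dot v (p x)| <= 4 * `|v|.
    by apply: le_trans h1 _; rewrite -[leRHS]mulr1 ler_wpM2l ?mulr_ge0.
  have h3 : `|q + dot v (p x)| <= (K + 4) * `|v|.
    apply: le_trans (ler_normD _ _) _; rewrite mulrDl; apply: lerD => //.
    apply: le_trans tv _; rewrite ler_wpM2l ?(ltW K0) //.
    by rewrite expr2 -[leRHS]mulr1 ler_wpM2l // ltW.
  rewrite /K2 mulrDl; apply: lerD.
    by rewrite -[leRHS]mulr1 ler_pM.
  have -> : 8 * C * (K + 4) * `|v| ^+ 2 = (K + 4) * `|v| * (8 * C * `|v|) by ring.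
  by rewrite ler_pM.
have i3 : b *m M1 = v *m (tproj x *m H) + ((b - a *m H) + E2 *m H).
  exact: linear_solve.
have i4 : b - v *m M = ((b - a *m H) + E2 *m H) *m invmx M1.
  have h : b = b *m M1 *m invmx M1 by rewrite mulmxK.
  by rewrite {1}h i3 mulmxDl /M !mulmxA addrAC subrr add0r.
have -> : p (x + v) 0 j - p x 0 j - dot v (\row_k M k j) = (b - v *m M) 0 j.
  rewrite !mxE; congr (_ - _); apply: eq_bigr => k _.
  by rewrite !mxE.
apply: le_trans (coord_le_norm _ _) _; rewrite i4.
apply: le_trans (norm_mulmx _ _) _.
have i5 : `|b - a *m H + E2 *m H| <= e / (8 * Mi) * `|v| + e / (16 * Mi) * `|v|.
  apply: le_trans (ler_normD _ _) _; apply: lerD => //.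
  apply: le_trans (norm_mulmx _ _) _.
  apply: (@le_trans _ _ (4 * (K2 * `|v| ^+ 2) * C)).
    by rewrite ler_pM ?mulr_ge0 // ler_wpM2l.
  have -> : 4 * (K2 * `|v| ^+ 2) * C = 4 * K2 * C * `|v| * `|v| by ring.
  rewrite ler_wpM2r // -(ler_pM2l (_ : 0 < 16 * Mi)) ?mulr_gt0 //.
  have -> : 16 * Mi * (e / (16 * Mi)) = e by field; rewrite gt_eqF.
  have -> : 16 * Mi * (4 * K2 * C * `|v|) = `|v| * (64 * K2 * C * Mi) by ring.
  by move: ve; rewrite ltr_pdivlMr // => /ltW.
have i6 : `|invmx M1| <= Mi by rewrite lerDl.
have -> : e * `|v| = 4 * (e / (8 * Mi) * `|v| + e / (8 * Mi) * `|v|) * Mi.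
  by field; rewrite gt_eqF.
rewrite ler_pM ?mulr_ge0 // ler_wpM2l // (le_trans i5) // lerD2l ler_wpM2r //.
rewrite ler_wpM2l ?(ltW e0) // lef_pV2 ?posrE ?mulr_gt0 // ler_wpM2r ?(ltW Mi0) //.
by rewrite ler_nat.
Qed.

Let n := grad s x0.
Let H x := hessmx s (proj x).

Lemma proj_base : proj x0 = x0.
Proof.
apply/esym/eqP; rewrite -subr_eq0 -normr_le0.
by apply: le_trans (proj_near x0) _; rewrite subrr normr0 mulr0.
Qed.

(** Pair [x0 = proj x0 + t n] with [n]. *)
Lemma tube_base : t x0 = 0.
Proof.
have n1 := (sS Sx0 Ux0).2.
have /(congr1 (dot n)) := projE x0.
rewrite proj_base dotDr dotZr -/n n1 mulr1 => /eqP.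
by rewrite -subr_eq0 opprD addrA subrr sub0r oppr_eq0 => /eqP.
Qed.

Lemma radius_near (P : pt R -> Prop) (r : R) : 0 < r ->
  (forall x, `|x - x0| < r -> P x) -> forall x, `|x - x0| < r -> \forall y \near x, P y.
Proof.
move=> r0 HP x xr; apply/nbhs_normP; exists (r - `|x - x0|).
  by rewrite /= subr_gt0.
move=> y /= yx; apply: HP.
rewrite -(subrK x y) -addrA; apply: le_lt_trans (ler_normD _ _) _.
by rewrite -ltrBrDr distrC.
Qed.

Lemma tube_diff : exists2 r : R, 0 < r & forall x, `|x - x0| < r ->
  [/\ differentiable t x, grad t x = p x, dot (grad t x) (grad t x) = 1,
      forall j, differentiable (pd j t) x &
      hessmx t x = tproj x *m H x - t x *: (hessmx t x *m H x)].
Proof.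
have [r1 r10 H1] := tube_grad.
have [C C0 [r2 r20 H2]] := tube_hess.
exists (Num.min r1 r2); first by rewrite lt_min r10.
move=> x; rewrite lt_min => /andP[xr1 xr2].
have [/is_gradP[dt gt] p1] := H1 x xr1.
have [M [ME _] HM] := H2 x xr2.
have E j : {near x, (fun y => p y 0 j) =1 pd j t}.
  have G : forall y, `|y - x0| < r1 -> p y 0 j = pd j t y.
    move=> y yr1; have [/is_gradP[_ gy] _] := H1 y yr1.
    by rewrite -gy mxE.
  exact: (radius_near r10 G).
have D j : differentiable (fun y => p y 0 j) x /\
    grad (fun y => p y 0 j) x = \row_k M k j.
  by apply/is_gradP; exact: HM.
split=> //; first by rewrite gt.
  by move=> j; apply: (near_differentiable (E j)); have [] := D j.
suff -> : hessmx t x = M by [].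
apply/matrixP => k j; rewrite mxE -(near_pd k (E j)).
by have [_ /rowP/(_ k)] := D j; rewrite !mxE.
Qed.

Lemma tube_hess_bounded : exists C : R,
  \forall x \near x0, `|hessmx t x *m H x| <= C.
Proof.
have [C' C'0 [r' r'0 [_ _ [HA _ _ _]]]] :=
  tube_lipschitz.
have [r1 r10 H1] := tube_grad.
have [C C0 [r2 r20 H2]] := tube_hess.
exists (4 * C * C').
have r0 : 0 < Num.min r' (Num.min r1 r2) by rewrite !lt_min r10 r'0.
apply: (radius_near r0); last by rewrite subrr normr0.
move=> x; rewrite !lt_min => /andP[xr' /andP[xr1 xr2]].
have [M [ME MC] HM] := H2 x xr2.
suff -> : hessmx t x = M.
  apply: le_trans (norm_mulmx _ _) _.
  by have [_ HC' _ _ _] := HA x xr'; rewrite ler_pM // ?mulr_ge0 // ler_wpM2l.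
have E j : {near x, (fun y => p y 0 j) =1 pd j t}.
  have G : forall y, `|y - x0| < r1 -> p y 0 j = pd j t y.
    move=> y yr1; have [/is_gradP[_ gy] _] := H1 y yr1.
    by rewrite -gy mxE.
  exact: (radius_near r10 G).
apply/matrixP => k j; rewrite mxE -(near_pd k (E j)).
by have /is_gradP[_ /rowP/(_ k)] := HM j; rewrite !mxE.
Qed.

Lemma near_tube : \forall x \near x0, 
  [/\ differentiable t x, grad t x = p x, dot (grad t x) (grad t x) = 1,
      forall j, differentiable (pd j t) x &
      hessmx t x = tproj x *m H x - t x *: (hessmx t x *m H x)].
Proof.
have [r r0 Hr] := tube_diff.
by apply: (radius_near r0 Hr); rewrite subrr normr0.
Qed.

Lemma tube_p_diff j : differentiable (fun y => p y 0 j) x0.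
Proof.
have [_ _ _ d _] := nbhs_singleton near_tube.
apply: near_differentiable (d j); move: near_tube; apply: filterS => y [_ g _ _ _].
by rewrite -g mxE.
Qed.

Lemma tube_proj_diff : differentiable proj x0.
Proof.
apply: differentiable_rV => k.
have -> : (fun y => proj y 0 k) = (fun y : pt R => y 0 k) - (fun y => t y * p y 0 k).
  apply/funext => y; rewrite [RHS]/(y 0 k - t y * p y 0 k).
  move: (projE y); rewrite -/(p y); move: (p y) => q.
  move=> /(congr1 (fun v : pt R => v 0 k)); rewrite !mxE => E.
  by apply: (canRL (addrK _)); rewrite E.
apply: differentiableB; first exact: differentiable_coord.
apply: differentiableM; last exact: tube_p_diff.
by have [] := nbhs_singleton near_tube.
Qed.

Lemma tube_H_diff k j : differentiable (fun y => H y k j) x0.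
Proof.
have -> : (fun y => H y k j) = (pd k (pd j s)) \o proj.
  by apply/funext => y; rewrite mxE.
apply: differentiable_comp; first exact: tube_proj_diff.
by rewrite proj_base; exact: (sU.2 [:: k; j]).
Qed.

Lemma tube_P_diff k j : differentiable (fun y => tproj y k j) x0.
Proof.
have -> : (fun y => tproj y k j) = (fun y => (k == j)%:R - p y 0 k * p y 0 j).
  apply/funext => y; rewrite /tproj -/(p y); move: (p y) => q.
  by rewrite !mxE big_ord1 mxE.
apply: differentiableB; first exact: differentiable_cst.
by apply: differentiableM; exact: tube_p_diff.
Qed.

Lemma tube_PH_diff k j :
  differentiable (fun y => (tproj y *m H y) k j) x0.
Proof.
have -> : (fun y => (tproj y *m H y) k j) =
     (fun y => \sum_(m < 4) tproj y k m * H y m j).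
  by apply/funext => y; rewrite mxE.
apply: differentiable_sum4 => m.
by apply: differentiableM; [exact: tube_P_diff|exact: tube_H_diff].
Qed.

Lemma tube_hess_cvg0 k j : hessmx t y k j @[y --> x0] -->
  (tproj x0 *m H x0) k j.
Proof.
rewrite -[X in _ --> X]subr0.
have E : {near x0, (fun y => (tproj y *m H y) k j - t y * (hessmx t y *m H y) k j)
   =1 (fun y => hessmx t y k j)}.
  move: near_tube; apply: filterS => y [_ _ _ _ /matrixP/(_ k j)] ->.
  by rewrite !mxE.
apply: cvg_trans; first exact: (near_eq_cvg E).
apply: cvgB; first exact: (differentiable_continuous (tube_PH_diff k j)).
have [C HC] := tube_hess_bounded.
have dt : differentiable t x0 by have [] := nbhs_singleton near_tube.
apply: (bounded_mul_cvg0 dt tube_base (C := C)); move: HC; apply: filterS => y.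
apply: le_trans; rewrite [leRHS]/Num.Def.normr /= mx_normrE.
exact: (le_bigmax _ (fun ij => `|(hessmx t y *m H y) ij.1 ij.2|) (k, j)).
Qed.

Lemma tube_hess_cvg k j :
  (hessmx t y *m H y) k j @[y --> x0] --> (tproj x0 *m H x0 *m H x0) k j.
Proof.
have -> : (fun y => (hessmx t y *m H y) k j) =
     (fun y => \sum_(m < 4) hessmx t y k m * H y m j).
  by apply/funext => y; rewrite mxE.
have -> : (tproj x0 *m H x0 *m H x0) k j =
    \sum_(m < 4) (tproj x0 *m H x0) k m * H x0 m j by rewrite mxE.
apply: (@cvg_big _ _ _ _ xpredT (@add_continuous R) _ _ _ _ _ (nbhs_filter x0)) => m _.
apply: cvgM; first exact: tube_hess_cvg0.
exact: (differentiable_continuous (tube_H_diff m j)).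
Qed.

(** The Hessian of [t] is [P H - t * (Hess t * H)]: the first term is
differentiable at [x0], and in the second one [t] vanishes at [x0] while
[Hess t * H] has a limit. *)
Lemma tube_third k j : differentiable (pd k (pd j t)) x0.
Proof.
have E : {near x0, (fun y => (tproj y *m H y) k j - t y * (hessmx t y *m H y) k j)
   =1 pd k (pd j t)}.
  move: near_tube; apply: filterS => y [_ _ _ _ /matrixP/(_ k j)].
  by rewrite [LHS]mxE => ->; rewrite !mxE.
apply: (near_differentiable E).
apply: differentiableB; first exact: tube_PH_diff.
have dt : differentiable t x0 by have [] := nbhs_singleton near_tube.
have /is_gradP[] := is_grad_mul_vanishing dt tube_base (@tube_hess_cvg k j).
by [].
Qed.

Lemma tube_hess_base k j : pd k (pd j t) x0 =
  pd k (pd j s) x0 - n 0 k * \sum_(m < 4) n 0 m * pd m (pd j s) x0.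
Proof.
have [_ _ _ _ /matrixP/(_ k j)] := nbhs_singleton near_tube.
rewrite tube_base scale0r subr0 mxE => ->.
rewrite /tproj /H /p proj_base -/n mulmxBl mul1mx -mulmxA !mxE big_ord1 !mxE.
by congr (_ - _ * _); rewrite /n ?mxE //; apply: eq_bigr => m _; rewrite !mxE.
Qed.

Lemma tube_grad_base : grad t x0 = n.
Proof.
by have [_ -> _ _ _] := nbhs_singleton near_tube; rewrite /p proj_base.
Qed.

(** No curves in [S] are at hand, but the nearest points of [x0 + h v] lie in [S]
and differ from [x0 + h v] by [O (h^2)] when [v] is tangential. *)
Lemma tangential_vanish f v : differentiable f x0 ->
  (\forall x \near x0, S x -> f x = 0) -> dot v n = 0 -> dot v (grad f x0) = 0.
Proof.
move=> df Hf vn; apply/eqP; rewrite -normr_le0; apply/ler_addgt0Pl => e e0.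
rewrite addr0.
have [C C0 [r r0 [K K0 [HA HB HD HT]]]] :=
  tube_lipschitz.
(* A collects the factors with which e / A enters the final bound on the derivative *)
pose A := 8 * `|v| + 4 * K * `|v| ^+ 2 * `|grad f x0| + 1.
have A0 : 0 < A.
  by rewrite ltr_wpDl // addr_ge0 // !mulr_ge0 // ?sqr_ge0 // ltW.
have eA0 : 0 < e / A by rewrite divr_gt0.
have [d d0 Hd] := diff_radius df eA0.
have [d' d'0 Hd'] := near_radius Hf.
pose V := 8 * (`|v| + 1).
have V0 : 0 < V by rewrite mulr_gt0 // ltr_wpDl.
pose h := Num.min (e / A) (Num.min (r / V) (Num.min (d / V) (d' / V))) / 2.
have m0 : 0 < Num.min (e / A) (Num.min (r / V) (Num.min (d / V) (d' / V))).
  by rewrite !lt_min eA0 !divr_gt0.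
have h0 : 0 < h by rewrite divr_gt0.
have : h < Num.min (e / A) (Num.min (r / V) (Num.min (d / V) (d' / V))).
  by rewrite /h ltr_pdivrMr // ltr_pMr // ltr1n.
rewrite !lt_min !ltr_pdivlMr // -ltr_pdivlMr // => /and4P[he hr hd hd'].
have hv : `|h *: v| * 8 <= h * V.
  rewrite normrZ gtr0_norm // -mulrA ler_wpM2l ?(ltW h0) // /V mulrC ler_wpM2l //.
  by rewrite lerDl.
have hv1 : `|h *: v| <= h * V.
  by apply: le_trans hv; rewrite ler_peMr // ler1n.
have xr : `|x0 + h *: v - x0| < r by rewrite addKl; exact: le_lt_trans hr.
have x0r : `|x0 - x0| < r by rewrite subrr normr0.
have := HB x0 (x0 + h *: v) x0r xr; rewrite proj_base addKl => h1.
have := HT x0 (x0 + h *: v) x0r xr.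
rewrite addKl /p proj_base tube_base subr0 dotZl vn mulr0 subr0 => h2.
set w := proj (x0 + h *: v) - x0 in h1.
have w8 : `|w| <= h * V by apply: le_trans h1 _; rewrite mulrC.
have fw : f (x0 + w) = 0.
  apply: Hd'; first exact: le_lt_trans w8 hd'.
  by rewrite /w addrC subrK; exact: projS.
have f0 : f x0 = 0 by apply: (nbhs_singleton Hf).
have := Hd w (le_lt_trans w8 hd); rewrite fw f0 subrr sub0r normrN => h3.
have wE : w = h *: v - t (x0 + h *: v) *: p (x0 + h *: v).
  rewrite /w; have := projE (x0 + h *: v); rewrite -/(p (x0 + h *: v)).
  move: (t _ *: p _) (proj _) => b a E.
  by apply: (canRL (addrK _)); rewrite addrAC -E addKl.
have [_ _ p1 _ _] := HA _ xr.
have pn : `|p (x0 + h *: v)| <= 1 := unit_norm p1.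
have h4 : `|t (x0 + h *: v) * dot (p (x0 + h *: v)) (grad f x0)| <=
   K * `|h *: v| ^+ 2 * (4 * `|grad f x0|).
  rewrite normrM ler_pM //; apply: le_trans (dot_le_norm _ _) _.
  by rewrite ler_wpM2r // -[leRHS]mulr1 ler_wpM2l.
have h5 : h * `|dot v (grad f x0)| <= e / A * (8 * `|h *: v|) +
   K * `|h *: v| ^+ 2 * (4 * `|grad f x0|).
  rewrite -{1}(gtr0_norm h0) -normrM -dotZl.
  have -> : dot (h *: v) (grad f x0) = dot w (grad f x0) +
      t (x0 + h *: v) * dot (p (x0 + h *: v)) (grad f x0).
    by rewrite wE dotBl !dotZl subrK.
  apply: le_trans (ler_normD _ _) _; apply: lerD => //.
  by apply: le_trans h3 _; rewrite ler_wpM2l // ltW.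
rewrite -(ler_pM2l h0); apply: le_trans h5 _.
rewrite normrZ (gtr0_norm h0).
have -> : e / A * (8 * (h * `|v|)) + K * (h * `|v|) ^+ 2 * (4 * `|grad f x0|) =
  h * (e / A * (8 * `|v|) + h * (4 * K * `|v| ^+ 2 * `|grad f x0|)) by ring.
rewrite ler_wpM2l ?(ltW h0) //.
have h6 : 0 <= 4 * K * `|v| ^+ 2 * `|grad f x0|.
  by rewrite !mulr_ge0 // ?sqr_ge0 // ltW.
apply: (@le_trans _ _ (e / A * A)); last by rewrite divfK // gt_eqF.
have AE : A = 8 * `|v| + 4 * K * `|v| ^+ 2 * `|grad f x0| + 1 by [].
rewrite [X in _ <= _ * X]AE !mulrDr -addrA lerD2l.
apply: le_trans (ler_wpM2r h6 (ltW he)) _.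
by rewrite lerDl mulr1 ltW.
Qed.

End DistanceRegularity.

(** * Nearest boundary points *)

Section NearestPoints.
Context {R : realType}.
Implicit Types (f g : pt R -> R) (x y z u v w : pt R) (i j k : 'I_4).
Implicit Types (Om : set (pt R)).

Lemma dot_ge0 v : 0 <= dot v v.
Proof. by apply: sumr_ge0 => k _; rewrite -expr2 sqr_ge0. Qed.

Lemma enormE v : enorm v = Num.sqrt (dot v v).
Proof. by congr Num.sqrt; apply: eq_bigr => k _; rewrite expr2. Qed.

Lemma enorm_ge0 v : 0 <= enorm v.
Proof. by rewrite sqrtr_ge0. Qed.

Lemma enorm_sqr v : enorm v ^+ 2 = dot v v.
Proof. by rewrite enormE sqr_sqrtr ?dot_ge0. Qed.

Lemma norm_le_enorm v : `|v| <= enorm v.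
Proof. by rewrite -ler_sqr ?nnegrE ?enorm_ge0 // enorm_sqr dot_ge_norm. Qed.

Lemma enorm_le_norm v : enorm v <= 2 * `|v|.
Proof.
rewrite -ler_sqr ?nnegrE ?enorm_ge0 ?mulr_ge0 // enorm_sqr.
apply: le_trans (ler_norm _) _; apply: le_trans (dot_le_norm _ _) _.
by rewrite exprMn -mulrA -expr2 -natrX.
Qed.

Lemma dot_eq0 v : dot v v <= 0 -> v = 0.
Proof.
move=> v0; apply/eqP; rewrite -normr_eq0 -sqrf_eq0.
by rewrite eq_le sqr_ge0 andbT (le_trans (dot_ge_norm v)).
Qed.

Lemma enorm_continuous : continuous (@enorm R : pt R -> R).
Proof.
move=> v; have -> : (@enorm R : pt R -> R) = fun v => Num.sqrt (\sum_(k < 4) v 0 k ^+ 2).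
  by [].
apply: (@continuous_comp _ _ _ (fun v : pt R => \sum_(k < 4) v 0 k ^+ 2) Num.sqrt);
  last exact: sqrt_continuous.
apply: (@cvg_big _ _ _ _ xpredT (@add_continuous R) _ _ _ _ _ (nbhs_filter v)) => k _.
by rewrite expr2; apply: cvgM; exact: coord_continuous.
Qed.

Lemma line_continuous x v : continuous (fun t : R => x + t *: v).
Proof.
move=> t; apply: cvgD; first exact: cvg_cst.
by apply: cvgZl; exact: cvg_id.
Qed.

(** Otherwise the part of the segment in [Om] would be open and closed in the
segment. *)
Lemma segment_meets_bdry Om x v : open Om -> Om x -> ~ Om (x + v) ->
  exists2 t : R, 0 <= t <= 1 & bdry Om (x + t *: v).
Proof.
move=> oOm Ox Oxv; apply: contrapT => noB.
pose B := `[0, 1]%classic `&` (fun t : R => x + t *: v) @^-1` Om.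
have BE : B = `[0, 1]%classic `&` (fun t : R => x + t *: v) @^-1` closure Om.
  apply/seteqP; split=> t [t01 Ht]; split=> //; first exact: subset_closure.
  apply: contrapT => nOm; apply: noB; exists t.
    by move: t01; rewrite /= in_itv.
  by split=> //; rewrite (interior_id Om).1.
have : B = `[0, 1]%classic.
  apply: (@segment_connected R 0 1).
  - by exists 0; split; rewrite /= ?in_itv /= ?lexx ?ler01 // scale0r addr0.
  - exists ((fun t : R => x + t *: v) @^-1` Om) => //.
    by apply: open_comp => // t _; exact: line_continuous.
  - exists ((fun t : R => x + t *: v) @^-1` closure Om); last exact: BE.
    by apply: closed_comp => [t _|]; [exact: line_continuous|exact: closed_closure].
move=> /seteqP[_ /(_ 1)] H1; have [|_] := H1.
  by rewrite /= in_itv /= ler01 lexx.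
by rewrite /= scale1r => /Oxv.
Qed.

Lemma bdry_closed Om : closed (bdry Om).
Proof.
rewrite /bdry setDE; apply: closedI; first exact: closed_closure.
by rewrite closedC; exact: open_interior.
Qed.

Lemma bdry_compact Om : bounded_set Om -> compact (bdry Om).
Proof.
move=> [M [Mr HM]]; apply: bounded_closed_compact; last exact: bdry_closed.
exists M; split=> // c Mc x [+ _]; move: x.
have cl : closed [set x : pt R | `|x| <= c].
  by apply: (@closed_comp _ _ (fun x : pt R => `|x|) [set r | r <= c]) => [x _|];
    [exact: norm_continuous|exact: closed_le].
move/closure_id : cl => ->; apply: closure_subset => x Ox; exact: HM.
Qed.

Lemma nearest_point (S : set (pt R)) : S !=set0 -> compact S ->
  exists proj : pt R -> pt R, forall x,
    [/\ S (proj x), dist x S = enorm (x - proj x) &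
        forall y, S y -> enorm (x - proj x) <= enorm (x - y)].
Proof.
move=> S0 cS.
suff /choice[proj H] : forall x, exists z, [/\ S z, dist x S = enorm (x - z) &
    forall y, S y -> enorm (x - z) <= enorm (x - y)] by exists proj.
move=> x; have [|z zS Hz] := @EVT_min_rV R 4 (fun y => enorm (x - y)) S S0 cS.
  apply: continuous_subspaceT => y.
  apply: (@continuous_comp _ _ _ (fun y : pt R => x - y) (@enorm R));
    last exact: enorm_continuous.
  apply: (cvgB (FF := nbhs_filter y)); [exact: cst_continuous|exact: cvg_id].
have {}zS : S z by rewrite inE in zS.
have {}Hz y : S y -> enorm (x - z) <= enorm (x - y).
  by move=> Sy; apply: Hz; rewrite inE.
exists z; split=> //; apply/eqP; rewrite eq_le; apply/andP; split.
  have lb : has_lbound [set enorm (x - y) | y in S].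
    by exists 0 => _ [y _ <-]; exact: enorm_ge0.
  by apply: (ge_inf lb); exists z.
by apply: lb_le_inf; [exists (enorm (x - z)), z|move=> _ [y Sy <-]; exact: Hz].
Qed.

Lemma sign_grad (e : R) g y v : differentiable g y -> g y = 0 ->
  (exists2 d : R, 0 < d & forall h : R, 0 < h < d -> 0 <= e * g (y + h *: v)) ->
  0 <= e * dot v (grad g y).
Proof.
move=> dg gy [d d0 Hd]; rewrite leNgt; apply/negP => neg.
pose c := - (e * dot v (grad g y)); have c0 : 0 < c by rewrite oppr_gt0.
pose A := (`|e| + 1) * (`|v| + 1).
have A0 : 0 < A by rewrite mulr_gt0 // ltr_wpDl.
have cA : 0 < c / (2 * A) by rewrite divr_gt0 // mulr_gt0.
have [r r0 Hr] := diff_radius dg cA.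
have v1 : 0 < `|v| + 1 by rewrite ltr_wpDl.
pose h := Num.min d (r / (`|v| + 1)) / 2.
have m0 : 0 < Num.min d (r / (`|v| + 1)) by rewrite lt_min d0 divr_gt0.
have h0 : 0 < h by rewrite divr_gt0.
have : h < Num.min d (r / (`|v| + 1)) by rewrite /h ltr_pdivrMr // ltr_pMr // ltr1n.
rewrite lt_min ltr_pdivlMr // => /andP[hd hr].
have := Hd h; rewrite h0 hd => /(_ isT).
have hv : `|h *: v| < r.
  rewrite normrZ gtr0_norm //; apply: le_lt_trans hr.
  by rewrite ler_wpM2l ?(ltW h0) // lerDl.
have := Hr _ hv; rewrite gy subr0 dotZl normrZ (gtr0_norm h0) => h1 h2.
have h3 : `|e * (g (y + h *: v) - h * dot v (grad g y))| <= h * (c / 2).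
  rewrite normrM.
  apply: (@le_trans _ _ ((`|e| + 1) * (c / (2 * A) * (h * (`|v| + 1))))).
    apply: ler_pM => //; first by rewrite lerDl.
    apply: le_trans h1 _; rewrite ler_wpM2l ?(ltW cA) // ler_wpM2l ?(ltW h0) //.
    by rewrite lerDl.
  have -> : (`|e| + 1) * (c / (2 * A) * (h * (`|v| + 1))) =
    c / (2 * A) * h * ((`|e| + 1) * (`|v| + 1)) by ring.
  rewrite -/A (_ : c / (2 * A) * h * A = h * (c / 2)) //.
  by clearbody A; field; rewrite gt_eqF.
move: h3; rewrite ler_norml => /andP[_].
rewrite mulrBr mulrCA => h3.
have : 0 < h * c by rewrite mulr_gt0.
by rewrite /c in h3 *; lra.
Qed.

(** If one open half-space lies in another closed one, their normals are parallel.
The vector [a - e d g] would otherwise lie in the first and not in the second. *)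
Lemma halfspace_unit (e d : R) (a g : pt R) : e ^+ 2 = 1 -> 0 <= d ->
  dot a a = d ^+ 2 -> dot g g = 1 ->
  (forall v, 0 < dot v a -> 0 <= e * dot v g) -> a = (e * d) *: g.
Proof.
move=> e1 d0 aa g1 H; apply/subr0_eq/dot_eq0.
have ecd : d <= e * dot a g.
  rewrite leNgt; apply/negP => lt.
  have dp : 0 < d.
    rewrite lt_def d0 andbT; apply/eqP => dE; move: lt.
    have -> : a = 0 by apply: dot_eq0; rewrite aa dE expr0n.
    by rewrite dot0l mulr0 dE ltxx.
  have := H (a - (e * d) *: g).
  rewrite !dotBl !dotZl aa g1 (dotC g a) !mulr1.
  have -> : d ^+ 2 - e * d * dot a g = d * (d - e * dot a g) by ring.
  rewrite mulr_gt0 ?subr_gt0 // => /(_ isT).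
  by rewrite mulrBr mulrA -expr2 e1 mul1r leNgt subr_lt0 lt.
rewrite !dotBl !dotBr !dotZl !dotZr aa g1 (dotC g a).
have -> : d ^+ 2 - e * d * dot a g - (e * d * dot a g - e * d * (e * d * 1)) =
  d ^+ 2 + e ^+ 2 * d ^+ 2 - 2 * d * (e * dot a g) by ring.
rewrite e1 mul1r.
have := ler_wpM2l d0 ecd; move: (e * dot a g) => b.
rewrite -expr2; lra.
Qed.

(** The open ball around [x] through [y] contains no boundary point, so it stays on
one side of the boundary. Directions that enter the ball at [y] therefore do not
change the sign of [g], and the normal of the ball is that of the boundary. *)
Lemma nearest_normal Om (U : set (pt R)) g x y : open Om -> smooth_on U g ->
  U y -> bdry Om y -> g y = 0 -> dot (grad g y) (grad g y) = 1 ->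
  (forall z, U z -> Om z <-> g z < 0) ->
  dist x (bdry Om) = enorm (x - y) ->
  (forall z, bdry Om z -> enorm (x - y) <= enorm (x - z)) ->
  x = y + sdist Om x *: grad g y.
Proof.
move=> oOm sU Uy By gy g1 OmE dE near.
suff E : x - y = sdist Om x *: grad g y by rewrite -E addrC subrK.
pose e : R := if x \in Om then -1 else 1.
have -> : sdist Om x = e * enorm (x - y).
  by rewrite /sdist dE /e; case: ifP => _; rewrite ?mulN1r ?mul1r.
apply: halfspace_unit => //.
- by rewrite /e; case: ifP; rewrite ?sqrrN expr1n.
- exact: enorm_ge0.
- by rewrite enorm_sqr.
move=> v va; set a := x - y in va *.
have dg := sU.2 [::] y Uy; apply: sign_grad => //.
have [rU rU0 HU] := near_radius (open_nbhs_nbhs (conj sU.1 Uy) : \forall z \near y, U z).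
pose V := dot v v + 1; have V0 : 0 < V by rewrite ltr_wpDl ?dot_ge0.
have v1 : 0 < `|v| + 1 by rewrite ltr_wpDl.
exists (Num.min (rU / (`|v| + 1)) (dot v a / V)); first by rewrite lt_min !divr_gt0.
move=> h /andP[h0]; rewrite lt_min !ltr_pdivlMr // => /andP[hU hV].
have Uz : U (y + h *: v).
  apply: HU; rewrite normrZ gtr0_norm //; apply: le_lt_trans hU.
  by rewrite ler_wpM2l ?(ltW h0) // lerDl.
(* the segment from x to y + h v stays in the open ball touching bdry Om at y *)
have ball (t : R) : 0 <= t <= 1 -> ~ bdry Om (x + t *: (y + h *: v - x)).
  move=> /andP[t0 t1] /near.
  have -> : x - (x + t *: (y + h *: v - x)) = t *: (a - h *: v).
    by rewrite opprD addNKr -scalerN opprB opprD addrA.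
  rewrite leNgt => /negP; apply.
  have aa : 0 < dot a a.
    rewrite lt_def dot_ge0 andbT; apply/eqP => aE; move: va.
    by rewrite (_ : a = 0) ?dot0r ?ltxx //; apply: dot_eq0; rewrite aE.
  have lt : enorm (a - h *: v) < enorm a.
    rewrite -ltr_sqr ?nnegrE ?enorm_ge0 // !enorm_sqr.
    clearbody a; rewrite !dotBl !dotBr !dotZl !dotZr (dotC a v).
    have : h * (h * V) < h * dot v a by rewrite ltr_pM2l.
    rewrite /V; have := mulr_gt0 h0 h0; move: va; move: (dot a a) (dot v a) (dot v v).
    by move=> A B C; nra.
  apply: le_lt_trans lt.
  rewrite enormE dotZl dotZr mulrA -expr2 sqrtrM ?sqr_ge0 // sqrtr_sqr ger0_norm //.
  by rewrite -enormE -[leRHS]mul1r ler_wpM2r ?enorm_ge0.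
rewrite /e; case: ifPn => [|/negP]; rewrite inE => Ox.
  rewrite mulN1r oppr_ge0 ltW //; apply/(OmE _ Uz); apply: contrapT => nO.
  have [] := @segment_meets_bdry Om x (y + h *: v - x) oOm Ox.
    by rewrite addrC subrK.
  by move=> t /ball.
rewrite mul1r leNgt; apply/negP => /(OmE _ Uz) Oz.
have [] := @segment_meets_bdry Om (y + h *: v) (x - (y + h *: v)) oOm Oz.
  by rewrite addrC subrK.
move=> t /andP[t0 t1]; have := @ball (1 - t); rewrite subr_ge0 t1 lerBlDr lerDl t0.
move=> /(_ isT) nB; suff -> : y + h *: v + t *: (x - (y + h *: v)) =
  x + (1 - t) *: (y + h *: v - x) by [].
by apply/rowP => k; rewrite !mxE; ring.
Qed.

End NearestPoints.

(** * Defining functions with unit gradient on the boundary *)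

Section UnitDefining.
Context {R : realType}.
Implicit Types (f g rho sg psi : pt R -> R) (x y z u v w : pt R) (i j k : 'I_4).
Implicit Types (Om U : set (pt R)).

(** The gradient has unit length on the boundary only: this is what multiplication
by a smooth positive function can reach, and one equation on the boundary suffices
to compare with the signed distance. *)
Definition unit_defining Om U sg :=
  [/\ bdry Om `<=` U, smooth_on U sg, forall z, U z -> Om z <-> sg z < 0 &
      forall y, bdry Om y -> sg y = 0 /\ dot (grad sg y) (grad sg y) = 1].

Lemma open_pos U f : open U -> (forall x, U x -> differentiable f x) ->
  open (U `&` [set x | 0 < f x]).
Proof.
move=> oU df; rewrite openE => x [Ux fx].
have nU : \forall y \near x, U y by exact: open_nbhs_nbhs.
have nf : \forall y \near x, 0 < f y.
  have /cvgrPdist_lt/(_ _ fx) := differentiable_continuous (df x Ux).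
  apply: filterS => y; rewrite ltr_norml => /andP[_].
  by rewrite ltrBlDr ltrDl.
by apply: filterS2 nU nf.
Qed.

(** On the boundary the gradient of [rho * exp (- psi)] is [exp (- psi)] times that
of [rho], so [psi] has to be the logarithm of [|grad rho|]. *)
Lemma unit_defining_exists Om rho : smooth_defining Om rho ->
  exists U sg psi, [/\ unit_defining Om U sg, smooth_on U psi &
    forall x, U x -> rho x = sg x * expR (psi x)].
Proof.
move=> [U0 [clU sU OmE H]].
pose Q x := \sum_(k < 4) pd k rho x * pd k rho x.
have sQ : smooth_on U0 Q.
  by apply: smooth_sum => k; apply: smooth_M; exact: smooth_pd.
pose U := U0 `&` [set x | 0 < Q x].
have oU : open U by apply: open_pos; [exact: sU.1|exact: (sQ.2 [::])].
have UU0 : U `<=` U0 by move=> x [].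
pose psi x := 2^-1 * ln (Q x).
have spsi : smooth_on U psi.
  apply: smooth_M; first exact: smooth_cst.
  by apply: smooth_ln; [move=> x []|exact: smooth_on_sub sQ].
pose sg x := rho x * expR (- psi x).
have ssg : smooth_on U sg.
  apply: smooth_M; first exact: smooth_on_sub sU.
  by apply: smooth_exp; exact: smooth_N.
have BU : bdry Om `<=` U.
  move=> x Bx; have [_ gx] := H x Bx; split; first by apply: clU; exact: Bx.1.
  rewrite /= /Q lt_def; apply/andP; split; last first.
    by apply: sumr_ge0 => k _; rewrite -expr2 sqr_ge0.
  apply: contra gx => /eqP Q0; apply/eqP/rowP => k; rewrite !mxE.
  suff -> : pd k rho x = 0 by [].
  apply/eqP; rewrite -[_ == 0]orbb -mulf_eq0 -expr2; apply/eqP.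
  move: Q0 => /psumr_eq0P; rewrite expr2; apply => //.
  by move=> j _; rewrite -expr2 sqr_ge0.
exists U, sg, psi; split=> //; last first.
  by move=> x Ux; rewrite /sg -mulrA -expRD addNr expR0 mulr1.
split=> //.
  move=> z Uz; rewrite OmE /= /sg; split=> [[_ rz]|].
    by rewrite nmulr_rlt0 ?expR_gt0.
  by rewrite pmulr_llt0 ?expR_gt0 // => rz; split=> //; exact: UU0.
move=> y By; have [ry _] := H y By; have Uy := BU y By.
split; first by rewrite /sg ry mul0r.
have dr := sU.2 [::] y (UU0 y Uy).
have de : differentiable (fun x => expR (- psi x)) y.
  by apply: (@smooth_on_diff _ U _ [::]) => //; apply: smooth_exp; exact: smooth_N.
have g k : pd k sg y = expR (- psi y) * pd k rho y.
  by rewrite /sg pdM // ry mul0r addr0 mulrC.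
have -> : dot (grad sg y) (grad sg y) = expR (- psi y) ^+ 2 * Q y.
  rewrite /dot /Q mulr_sumr; apply: eq_bigr => k _.
  by rewrite !mxE g; move: (expR _) (pd k rho y) => a b; ring.
have Qy : 0 < Q y := Uy.2.
have -> : expR (- psi y) ^+ 2 = (Q y)^-1.
  rewrite expr2 -expRD (_ : - psi y + - psi y = - ln (Q y)).
    by rewrite expRN lnK // posrE.
  by rewrite /psi; move: (ln _) => a; field.
by rewrite mulVf // gt_eqF.
Qed.

(** The signed distance solves [x = proj x + t p] with [proj] a nearest-point map,
so the results on the distance along normals apply. The last clause is the
principle by which identities on the boundary are differentiated. *)
Lemma sdist_regular Om U sg x0 : open Om -> bounded_set Om ->
  unit_defining Om U sg -> bdry Om x0 ->
  [/\ \forall x \near x0, [/\ differentiable (sdist Om) x,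
        dot (grad (sdist Om) x) (grad (sdist Om) x) = 1 &
        forall j, differentiable (pd j (sdist Om)) x],
      forall k j, differentiable (pd k (pd j (sdist Om))) x0,
      grad (sdist Om) x0 = grad sg x0,
      forall k j, pd k (pd j (sdist Om)) x0 = pd k (pd j sg) x0 -
        grad sg x0 0 k * \sum_(m < 4) grad sg x0 0 m * pd m (pd j sg) x0 &
      forall f v, differentiable f x0 ->
        (\forall x \near x0, bdry Om x -> f x = 0) -> dot v (grad sg x0) = 0 ->
        dot v (grad f x0) = 0].
Proof.
move=> oOm bOm [BU ssg OmE Hb] Bx0.
have [proj Hp] := @nearest_point R (bdry Om) (ex_intro _ x0 Bx0) (bdry_compact bOm).
have sS y : bdry Om y -> U y -> sg y = 0 /\ dot (grad sg y) (grad sg y) = 1.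
  by move=> By _; exact: Hb.
have Ux0 := BU x0 Bx0.
have pS x : bdry Om (proj x) by have [] := Hp x.
have pE x : x = proj x + sdist Om x *: grad sg (proj x).
  have [Bp dE near] := Hp x; have [s0 s1] := Hb _ Bp.
  exact: (nearest_normal oOm ssg (BU _ Bp) Bp s0 s1 OmE dE near).
have pn x : `|x - proj x| <= 2 * `|x - x0|.
  have [_ _ near] := Hp x; apply: le_trans (norm_le_enorm _) _.
  by apply: le_trans (near _ Bx0) _; exact: enorm_le_norm.
split.
- have := near_tube ssg Ux0 sS pS pE pn; apply: filterS => x [? _ ? ? _].
  by split.
- exact: (tube_third ssg Ux0 Bx0 sS pS pE pn).
- exact: (tube_grad_base ssg Ux0 sS pS pE pn).
- exact: (tube_hess_base ssg Ux0 Bx0 sS pS pE pn).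
- by move=> f v; apply: (tangential_vanish ssg Ux0 Bx0 sS pS pE pn).
Qed.

(** The Hessian as a linear map. *)
Definition hmul f x v : pt R := \row_k dot v (grad (pd k f) x).

Lemma D2_hmul f x u v : D2 f x u v = dot u (hmul f x v).
Proof. by apply: eq_bigr => k _; rewrite mxE. Qed.

Lemma grad_D2 f x u v w : (forall k l, differentiable (pd l (pd k f)) x) ->
  dot w (grad (fun y => D2 f y u v) x) = D3 f x u v w.
Proof.
move=> d; have E l : pd l (fun y => D2 f y u v) x =
    \sum_(k < 4) u 0 k * \sum_(m < 4) v 0 m * pd l (pd m (pd k f)) x.
  have -> : (fun y => D2 f y u v) =
      (fun y => \sum_(k < 4) u 0 k * \sum_(m < 4) v 0 m * pd m (pd k f) y).
    apply/funext => y; apply: eq_bigr => k _; congr (_ * _).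
    by apply: eq_bigr => m _; rewrite mxE.
  have d1 k : differentiable (fun y => \sum_(m < 4) v 0 m * pd m (pd k f) y) x.
    by apply: differentiable_sum4 => m; apply: differentiableM.
  rewrite pd_sum => [|k]; last exact: differentiableM.
  apply: eq_bigr => k _; rewrite pdZ // pd_sum => [|m].
    by congr (_ * _); apply: eq_bigr => m _; rewrite pdZ.
  exact: differentiableM.
rewrite /D3 /dot; under eq_bigr => l _ do rewrite mxE E mulr_sumr.
rewrite exchange_big; apply: eq_bigr => k _.
under eq_bigr => l _ do rewrite mulr_sumr mulr_sumr.
rewrite D2E mulr_sumr exchange_big; apply: eq_bigr => m _.
rewrite mulr_sumr; apply: eq_bigr => l _.
by move: (pd l _ _) => A; ring.
Qed.

End UnitDefining.

(** * Second and third derivatives along the boundary *)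

Section BoundaryJets.
Context {R : realType}.
Implicit Types (f g rho sg psi : pt R -> R) (x y z u v w : pt R) (i j k : 'I_4).
Implicit Types (Om U : set (pt R)).

Lemma hmulD f x u v : hmul f x (u + v) = hmul f x u + hmul f x v.
Proof. by apply/rowP => k; rewrite !mxE dotDl. Qed.

Lemma hmulZ f x (c : R) v : hmul f x (c *: v) = c *: hmul f x v.
Proof. by apply/rowP => k; rewrite !mxE dotZl. Qed.

(** Differentiate [|grad sg|^2 = 1] along the boundary. *)
Lemma unit_defining_normal Om U sg x0 v : open Om -> bounded_set Om ->
  unit_defining Om U sg -> bdry Om x0 -> dot v (grad sg x0) = 0 ->
  D2 sg x0 (grad sg x0) v = 0.
Proof.
move=> oOm bOm ud Bx0 vn; have [BU ssg _ Hb] := ud.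
have [_ _ _ _ tv] := sdist_regular oOm bOm ud Bx0.
have Ux0 := BU _ Bx0.
pose q y := \sum_(k < 4) pd k sg y * pd k sg y + (fun=> -1) y.
have dk k : differentiable (pd k sg) x0 := ssg.2 [:: k] _ Ux0.
have dkk k : differentiable (fun y => pd k sg y * pd k sg y) x0.
  exact: differentiableM.
have dq : differentiable q x0.
  by apply: differentiableD; [exact: differentiable_sum4|exact: differentiable_cst].
have := tv q v dq _ vn.
have -> : dot v (grad q x0) = 2 * D2 sg x0 (grad sg x0) v.
  have E l : pd l q x0 = \sum_(k < 4) 2 * (pd k sg x0 * pd l (pd k sg) x0).
    rewrite /q pdD; [|exact: differentiable_sum4|exact: differentiable_cst].
    rewrite pd_cst addr0 pd_sum //; apply: eq_bigr => k _; rewrite pdM //.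
    by move: (pd k sg x0) (pd l _ _) => a b; ring.
  rewrite /dot D2E mulr_sumr.
  under eq_bigr => l _ do rewrite mxE E mulr_sumr.
  rewrite exchange_big; apply: eq_bigr => k _; rewrite mulr_sumr.
  apply: eq_bigr => l _; rewrite mxE.
  by move: (pd k sg x0) (pd l _ _) => a b; ring.
move=> H; have /eqP : 2 * D2 sg x0 (grad sg x0) v = 0.
  apply: H; near=> y => By; have [_] := Hb y By; rewrite /q /dot => <-.
  by rewrite -sumrB big1 // => k _; rewrite !mxE subrr.
by rewrite mulf_eq0 pnatr_eq0 /= => /eqP.
Unshelve. all: by end_near. Qed.

Lemma D2_sum_squares U sg x0 v : smooth_on U sg -> U x0 ->
  D2 (fun y => \sum_(k < 4) pd k sg y * pd k sg y) x0 v v =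
  2 * (dot (hmul sg x0 v) (hmul sg x0 v) + D3 sg x0 (grad sg x0) v v).
Proof.
move=> ssg Ux0; set q := fun y => _.
have dk y k : U y -> differentiable (pd k sg) y by move=> Uy; exact: (ssg.2 [:: k]).
have dlk y k l : U y -> differentiable (pd l (pd k sg)) y.
  by move=> Uy; exact: (ssg.2 [:: l; k]).
have E l : {near x0, (fun y => \sum_(k < 4) 2 * (pd k sg y * pd l (pd k sg) y)) =1 pd l q}.
  have : \forall y \near x0, U y by apply: open_nbhs_nbhs; split=> //; exact: ssg.1.
  apply: filterS => y Uy; rewrite /q pd_sum => [|k]; last by apply: differentiableM; exact: dk.
  apply: eq_bigr => k _; rewrite pdM; try exact: dk.
  by move: (pd k sg y) (pd l _ _) => a b; ring.
have F m l : pd m (pd l q) x0 = \sum_(k < 4)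
    2 * (pd m (pd k sg) x0 * pd l (pd k sg) x0 + pd k sg x0 * pd m (pd l (pd k sg)) x0).
  rewrite -(near_pd m (E l)) pd_sum => [|k].
    apply: eq_bigr => k _; rewrite pdZ; last first.
      by apply: differentiableM; [exact: dk|exact: dlk].
    by rewrite pdM //; [exact: dk|exact: dlk].
  apply: differentiableM; first exact: differentiable_cst.
  by apply: differentiableM; [exact: dk|exact: dlk].
rewrite D2E.
under eq_bigr => l _ do under eq_bigr => m _ do rewrite F mulr_sumr.
under eq_bigr => l _ do rewrite exchange_big.
rewrite exchange_big /= [X in _ = 2 * (X + _)]/dot /D3 -big_split mulr_sumr.
apply: eq_bigr => k _ /=; rewrite D2E !mxE [X in X * X]/dot mulr_suml mulr_sumr.
rewrite -big_split mulr_sumr.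
apply: eq_bigr => l _ /=; rewrite !mulr_sumr -big_split mulr_sumr.
apply: eq_bigr => m _ /=; rewrite !mxE.
move: (pd k sg x0) (pd m (pd k sg) x0) (pd l (pd k sg) x0) (pd m (pd l _) x0) => a b c d.
ring.
Qed.

(** Let [q = |grad sg|^2]. Since [q] is constant on the boundary, [grad q] is a
multiple [c * grad sg] there. Differentiating [grad q - c * grad sg = 0] once more
along the boundary relates the second derivatives of [q], which contain third
derivatives of [sg], to those of [sg]. The coefficient [c] does not depend on [v],
so it drops out of the sum over a basis of a complex tangent line on which the
Levi form vanishes. *)
Lemma unit_defining_third Om U sg x0 : open Om -> bounded_set Om ->
  unit_defining Om U sg -> bdry Om x0 ->
  exists c : R, forall v, dot v (grad sg x0) = 0 ->
    D3 sg x0 (grad sg x0) v v + dot (hmul sg x0 v) (hmul sg x0 v) =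
    c * D2 sg x0 v v.
Proof.
move=> oOm bOm ud Bx0; have [BU ssg _ Hb] := ud.
have Ux0 := BU _ Bx0.
pose q y := \sum_(k < 4) pd k sg y * pd k sg y.
have sq : smooth_on U q by apply: smooth_sum => k; apply: smooth_M; exact: smooth_pd.
pose c y := \sum_(k < 4) pd k q y * pd k sg y.
have sc : smooth_on U c by apply: smooth_sum => k; apply: smooth_M; exact: smooth_pd.
pose f l y := pd l q y + - (c y * pd l sg y).
have fB l y : bdry Om y -> f l y = 0.
  move=> By; have Uy := BU _ By; have [_ _ _ _ tv] := sdist_regular oOm bOm ud By.
  have [_ n1] := Hb y By.
  have qB (w : pt R) : dot w (grad sg y) = 0 -> dot w (grad q y) = 0.
    pose q1 z := q z + (fun=> -1) z.
    have dq := sq.2 [::] y Uy.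
    have -> : grad q y = grad q1 y.
      apply/rowP => k; rewrite !mxE /q1 pdD; [|exact: dq|exact: differentiable_cst].
      by rewrite pd_cst addr0.
    apply: tv; first by apply: differentiableD => //; exact: differentiable_cst.
    near=> z => Bz; have [_] := Hb z Bz; rewrite /q1 /q /dot => <-.
    by rewrite -sumrB big1 // => k _; rewrite !mxE subrr.
  have cE : c y = dot (grad q y) (grad sg y).
    by rewrite /c /dot; apply: eq_bigr => k _; rewrite !mxE.
  have vn : dot (grad q y - c y *: grad sg y) (grad sg y) = 0.
    by rewrite dotBl dotZl n1 mulr1 cE subrr.
  have : grad q y - c y *: grad sg y = 0.
    by apply: dot_eq0; rewrite dotBr dotZr vn qB // mulr0 subr0.
  by move/rowP => /(_ l); rewrite !mxE.
exists (2^-1 * c x0) => v vn.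
have [_ _ _ _ tv] := sdist_regular oOm bOm ud Bx0.
have df l : differentiable (f l) x0.
  apply: differentiableD; first exact: (sq.2 [:: l]).
  by apply: differentiableN; apply: differentiableM; [exact: (sc.2 [::])|exact: (ssg.2 [:: l])].
have H l : dot v (grad (f l) x0) = 0.
  by apply: tv => //; near=> y => By; exact: fB.
have dc := sc.2 [::] _ Ux0; have dl l := ssg.2 [:: l] _ Ux0.
have E l : dot v (grad (f l) x0) = dot v (grad (pd l q) x0)
    - (dot v (grad c x0) * pd l sg x0 + c x0 * dot v (grad (pd l sg) x0)).
  rewrite -dotZr [X in - (X + _)]mulrC -dotZr -dotDr -dotBr; congr dot.
  apply/rowP => m; rewrite !mxE /f pdD; [|exact: (sq.2 [:: l])|].
    rewrite pdN; last by apply: differentiableM; [exact: dc|exact: dl].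
    rewrite pdM; [|exact: dc|exact: dl].
    by rewrite [X in _ - (X + _)]mulrC.
  by apply: differentiableN; apply: differentiableM; [exact: dc|exact: dl].
have : \sum_(l < 4) v 0 l * dot v (grad (f l) x0) =
    D2 q x0 v v - (dot v (grad c x0) * dot v (grad sg x0) + c x0 * D2 sg x0 v v).
  have alg (r a b d e h : R) : r * (a - (b * d + h * e)) =
    r * a - (b * (r * d) + h * (r * e)) by ring.
  rewrite /D2 [dot v (grad sg x0)]/dot !mulr_sumr -big_split -sumrB.
  apply: eq_bigr => l _ /=; rewrite E [grad sg x0 0 l]mxE.
  exact: alg.
rewrite big1 => [|l _]; last by rewrite H mulr0.
rewrite vn mulr0 add0r (D2_sum_squares v ssg Ux0).
by move: (D3 _ _ _ _ _) (dot _ _) (D2 _ _ _ _) (c x0) => A B C D; lra.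
Unshelve. all: by end_near. Qed.

End BoundaryJets.

(** * Plurisubharmonicity and traces of Hessians *)

Section PlurisubharmonicTrace.
Context {R : realType}.
Implicit Types (f g u : pt R -> R) (x y z v w b : pt R) (i j k : 'I_4).
Implicit Types (Om U : set (pt R)).

(** Multiplication by the imaginary unit. *)
Definition Jmap b : pt R :=
  \row_k [:: - b 0 1; b 0 0; - b 0 3%:R; b 0 2%:R]`_k.

Lemma cmulE (s t : R) b : cmul s t b = s *: b + t *: Jmap b.
Proof. by []. Qed.

Lemma JmapZ (c : R) b : Jmap (c *: b) = c *: Jmap b.
Proof.
apply/rowP => k; rewrite !mxE.
by case: k => -[|[|[|[|//]]]] kP /=; rewrite ?mulrN.
Qed.

Lemma trig_continuous (k0 k1 k2 k3 k4 k5 : R) : continuous (fun t : R =>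
  k0 + k1 * cos t + k2 * sin t + k3 * (cos t * cos t) + k4 * (cos t * sin t)
    + k5 * (sin t * sin t)).
Proof.
move=> t; have c := @continuous_cos R t; have s := @continuous_sin R t.
have m (k : R) (f g : R -> R) : {for t, continuous f} -> {for t, continuous g} ->
    {for t, continuous (fun t : R => k * (f t * g t))}.
  by move=> cf cg; apply: cvgM; [exact: cvg_cst|exact: cvgM].
have m1 (k : R) (f : R -> R) : {for t, continuous f} ->
    {for t, continuous (fun t : R => k * f t)}.
  by move=> cf; apply: cvgM; [exact: cvg_cst|exact: cf].
apply: cvgD; last exact: (m k5 _ _ s s).
apply: cvgD; last exact: (m k4 _ _ c s).
apply: cvgD; last exact: (m k3 _ _ c c).
apply: cvgD; last exact: (m1 k2 _ s).
by apply: cvgD; [exact: cvg_cst|exact: (m1 k1 _ c)].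
Qed.

(** An explicit antiderivative; the coefficients [k1], [k2], [k4] integrate to 0
over a full period. *)
Lemma trig_integral (k0 k1 k2 k3 k4 k5 : R) :
  (\int[lebesgue_measure]_(t in `[0%R, (2 * pi)%R])
    (k0 + k1 * cos t + k2 * sin t + k3 * (cos t * cos t) + k4 * (cos t * sin t)
      + k5 * (sin t * sin t))%:E = (2 * pi * k0 + pi * (k3 + k5))%:E)%E.
Proof.
pose F (t : R) := k0 * t + k1 * sin t + k2 * (- cos t)
  + k3 * (2^-1 * (t + cos t * sin t)) + k4 * (2^-1 * (sin t * sin t))
  + k5 * (2^-1 * (t - cos t * sin t)).
pose f (t : R) := k0 + k1 * cos t + k2 * sin t + k3 * (cos t * cos t)
  + k4 * (cos t * sin t) + k5 * (sin t * sin t).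
have dF (t : R) : is_derive t 1 F (f t).
  have dc := is_derive_cos t; have ds := is_derive_sin t.
  have di : is_derive t 1 (id : R -> R) 1 by exact: is_derive_id.
  have dcs := is_deriveM dc ds; have dss := is_deriveM ds ds.
  have d0 := is_deriveD (is_deriveZ k0 di) (is_deriveZ k1 ds).
  have d1 := is_deriveD d0 (is_deriveZ k2 (is_deriveN dc)).
  have d2 := is_deriveD d1 (is_deriveZ k3 (is_deriveZ 2^-1 (is_deriveD di dcs))).
  have d3 := is_deriveD d2 (is_deriveZ k4 (is_deriveZ 2^-1 dss)).
  have d4 := is_deriveD d3 (is_deriveZ k5 (is_deriveZ 2^-1 (is_deriveB di dcs))).
  apply: (is_derive_eq d4); rewrite /f /GRing.scale /=.
  have := cos2Dsin2 t; move: (cos t) (sin t) => c s cs.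
  have -> : k0 + k1 * c + k2 * s + k3 * (c * c) + k4 * (c * s) + k5 * (s * s) =
    k0 + k1 * c + k2 * s + k3 * (2^-1 * (1 + (c ^+ 2 - s ^+ 2)))
      + k4 * (c * s) + k5 * (2^-1 * (1 - (c ^+ 2 - s ^+ 2))).
    have -> : c * c = 2^-1 * (1 + (c ^+ 2 - s ^+ 2)) by lra.
    by have -> : s * s = 2^-1 * (1 - (c ^+ 2 - s ^+ 2)) by lra.
  by field.
have cf : continuous f by exact: trig_continuous.
have pi2 : 0 < 2 * pi :> R by rewrite mulr_gt0 // pi_gt0.
rewrite (@continuous_FTC2 R f F 0 (2 * pi) pi2).
- rewrite -EFinB /F; congr EFin.
  have -> : 2 * pi = pi *+ 2 :> R by rewrite mulr_natl.
  by rewrite cos2pi sin2pi sin0 cos0; field.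
- exact: continuous_subspaceT.
- have cF t : {for t, continuous F}.
    by apply: differentiable_continuous; apply/derivable1_diffP; have [] := dF t.
  split=> [t _||]; first by have [] := dF t.
    apply: cvg_at_right_filter; exact: cF.
  apply: cvg_at_left_filter; exact: cF.
- by move=> t _; rewrite derive1E; have [] := dF t.
Qed.

Lemma circle_norm (s t : R) b : s ^+ 2 + t ^+ 2 <= 1 ->
  `|cmul s t b| <= `|b| + `|Jmap b|.
Proof.
move=> st; have h (a c : R) : a ^+ 2 + c ^+ 2 <= 1 -> `|a| <= 1.
  move=> h; rewrite -(@expr_le1 _ 2) // real_normK ?num_real //.
  by apply: le_trans h; rewrite lerDl sqr_ge0.
rewrite cmulE; apply: le_trans (ler_normD _ _) _; rewrite !normrZ.
by apply: lerD; rewrite -[leRHS]mul1r ler_wpM2r // ?(h s t) // (h t s) // addrC.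
Qed.

(** If the trace [T] were negative, the Taylor expansion would make [u] on a small
circle of radius [a] smaller than [u x] on average, by [- T a^2 / 4] up to an error
at most half of that. *)
Lemma psh_trace Om u x b : open Om -> psh Om u ->
  (forall y, Om y -> differentiable u y) -> Om x -> diff2 u x ->
  0 <= D2 u x b b + D2 u x (Jmap b) (Jmap b).
Proof.
move=> oOm [_ H] du Ox d2; rewrite leNgt; apply/negP => neg.
set T := D2 u x b b + _ in neg.
pose M := `|b| + `|Jmap b| + 1.
have M0 : 0 < M by rewrite ltr_wpDl // addr_ge0.
(* M bounds the circle of radius 1, so that the Taylor error e (a M)^2 is - T a^2 / 8 *)
pose e := - T / (8 * M ^+ 2).
have e0 : 0 < e by rewrite divr_gt0 ?oppr_gt0 // mulr_gt0 // exprn_gt0.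
have [d d0 Hd] := taylor2 d2 e0.
have [r r0 Hr] := near_radius (open_nbhs_nbhs (conj oOm Ox) : \forall z \near x, Om z).
pose a := Num.min d r / (2 * M).
have m0 : 0 < Num.min d r by rewrite lt_min d0.
have a0 : 0 < a by rewrite divr_gt0 // mulr_gt0.
have : a * M < Num.min d r.
  rewrite /a (_ : _ / _ * M = Num.min d r / 2); last by field; rewrite gt_eqF.
  by rewrite ltr_pdivrMr // ltr_pMr // ltr1n.
clearbody a; rewrite lt_min => /andP[ad ar].
have nC (s t : R) : s ^+ 2 + t ^+ 2 <= 1 -> `|cmul s t (a *: b)| <= a * M.
  move=> st; apply: le_trans (circle_norm _ st) _.
  rewrite JmapZ !normrZ (gtr0_norm a0) -mulrDr ler_wpM2l ?(ltW a0) //.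
  by rewrite lerDl.
have OC (s t : R) : s ^+ 2 + t ^+ 2 <= 1 -> Om (x + cmul s t (a *: b)).
  by move=> st; apply: Hr; exact: le_lt_trans (nC _ _ st) ar.
have cs1 (t : R) : cos t ^+ 2 + sin t ^+ 2 <= 1 by rewrite cos2Dsin2.
have := H x (a *: b) OC.
pose g := grad u x.
pose G (t : R) := (u x + e * (a * M) ^+ 2) + a * dot b g * cos t + a * dot (Jmap b) g * sin t
  + 2^-1 * a ^+ 2 * D2 u x b b * (cos t * cos t)
  + 2^-1 * a ^+ 2 * (D2 u x b (Jmap b) + D2 u x (Jmap b) b) * (cos t * sin t)
  + 2^-1 * a ^+ 2 * D2 u x (Jmap b) (Jmap b) * (sin t * sin t).
have uG (t : R) : u (x + cmul (cos t) (sin t) (a *: b)) <= G t.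
  have n1 := nC _ _ (cs1 t).
  have := Hd _ (le_lt_trans n1 ad); set v := cmul _ _ _ in n1 *.
  have -> : dot v (grad u x) = a * dot b g * cos t + a * dot (Jmap b) g * sin t.
    by rewrite /v cmulE JmapZ dotDl !dotZl -/g; ring.
  have -> : D2 u x v v = a ^+ 2 * (D2 u x b b * (cos t * cos t)
     + (D2 u x b (Jmap b) + D2 u x (Jmap b) b) * (cos t * sin t)
     + D2 u x (Jmap b) (Jmap b) * (sin t * sin t)).
    rewrite !D2_hmul /v cmulE JmapZ !hmulD !hmulZ !dotDl !dotDr !dotZl !dotZr.
    move: (dot b (hmul u x b)) (dot b (hmul u x (Jmap b))) => A1 A2.
    move: (dot (Jmap b) (hmul u x b)) (dot (Jmap b) (hmul u x (Jmap b))) => A3 A4.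
    by move: (cos t) (sin t) => c s; ring.
  have n2 : e * `|v| ^+ 2 <= e * (a * M) ^+ 2.
    by rewrite ler_wpM2l ?(ltW e0) // lerXn2r ?nnegrE ?mulr_ge0 ?(ltW a0) ?(ltW M0).
  rewrite ler_norml => /andP[_]; rewrite /G; move: n2; clear.
  move: (e * `|v| ^+ 2) (e * (a * M) ^+ 2) (u (x + v)) (u x) (dot b g) (dot (Jmap b) g) => A1 A2 A3 A4 A5 A6.
  move: (D2 u x b b) (D2 u x b (Jmap b) + D2 u x (Jmap b) b) (D2 u x (Jmap b) (Jmap b)).
  by move=> A7 A8 A9; lra.
have cu (t : R) : {for t, continuous (fun t : R => u (x + cmul (cos t) (sin t) (a *: b)))}.
  apply: (@continuous_comp _ _ _ (fun t => x + cmul (cos t) (sin t) (a *: b)) u); last first.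
    by apply: differentiable_continuous; apply: du; exact: OC.
  apply: cvgD; first exact: cvg_cst.
  have -> : (fun t => cmul (cos t) (sin t) (a *: b)) =
      (fun t => cos t *: (a *: b) + sin t *: Jmap (a *: b)).
    by apply/funext => s; rewrite cmulE.
  apply: cvgD; apply: cvgZl; [exact: continuous_cos|exact: continuous_sin].
have cG : continuous G by exact: trig_continuous.
have I1 : (\int[lebesgue_measure]_(t in `[0%R, (2 * pi)%R])
    (u (x + cmul (cos t) (sin t) (a *: b)))%:E <=
  \int[lebesgue_measure]_(t in `[0%R, (2 * pi)%R]) (G t)%:E)%E.
  apply: le_integral.
  - exact: measurable_itv.
  - apply: continuous_compact_integrable; first exact: segment_compact.
    exact: continuous_subspaceT.
  - apply: continuous_compact_integrable; first exact: segment_compact.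
    exact: continuous_subspaceT.
  - by move=> t _; rewrite lee_fin.
move=> /le_trans/(_ I1); rewrite trig_integral lee_fin.
have -> : e * (a * M) ^+ 2 = - T * a ^+ 2 / 8.
  by rewrite /e; field; rewrite gt_eqF.
have -> : 2^-1 * a ^+ 2 * D2 u x b b + 2^-1 * a ^+ 2 * D2 u x (Jmap b) (Jmap b) =
   2^-1 * a ^+ 2 * T by rewrite -mulrDr.
have pTa : 0 < pi * (- T * a ^+ 2) by rewrite mulr_gt0 ?pi_gt0 // mulr_gt0 ?oppr_gt0 ?exprn_gt0.
by clear -pTa; clearbody T; move: pTa; move: (u x) (a ^+ 2) => A D; lra.
Qed.

End PlurisubharmonicTrace.

(** * The exponent inequality inside the domain *)

Section ExponentInequality.
Context {R : realType}.
Implicit Types (f g u rho sg psi : pt R -> R) (x y z v w a b : pt R) (i j k : 'I_4).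
Implicit Types (Om U V : set (pt R)).

Lemma near_D2 f g x a b : {near x, f =1 g} -> D2 f x a b = D2 g x a b.
Proof.
move=> fg; rewrite !D2E; apply: eq_bigr => k _; apply: eq_bigr => l _.
have -> : pd l (pd k f) x = pd l (pd k g) x; last by [].
by apply: near_pd; move/near_join : fg; apply: filterS => y; exact: near_pd.
Qed.

Lemma near_grad f g x : {near x, f =1 g} -> grad f x = grad g x.
Proof. by move=> fg; apply/rowP => k; rewrite !mxE; exact: near_pd. Qed.

Lemma grad_add f g x a : differentiable f x -> differentiable g x ->
  dot a (grad (fun y => f y + g y) x) = dot a (grad f x) + dot a (grad g x).
Proof. by move=> df dg; rewrite -dotDr; congr dot; apply/rowP => k; rewrite !mxE pdD. Qed.

Lemma D2_add V f g x a b : smooth_on V f -> smooth_on V g -> V x ->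
  D2 (fun y => f y + g y) x a b = D2 f x a b + D2 g x a b.
Proof.
move=> sf sg Vx; rewrite !D2E -big_split; apply: eq_bigr => k _.
rewrite -big_split; apply: eq_bigr => l _ /=; rewrite -mulrDr.
rewrite -(pdD l (sf.2 [:: k] _ Vx) (sg.2 [:: k] _ Vx)).
have -> : pd l (pd k (fun y => f y + g y)) x = pd l (fun y => pd k f y + pd k g y) x;
  last by [].
apply: near_pd.
have : \forall y \near x, V y by apply: open_nbhs_nbhs; split=> //; exact: sf.1.
by apply: filterS => y Vy; rewrite pdD //; [exact: (sf.2 [::])|exact: (sg.2 [::])].
Qed.

Lemma grad_scomp (h : R -> R) (h1 : R) f x a : differentiable f x ->
  is_derive (f x) 1 h h1 ->
  dot a (grad (fun y => h (f y)) x) = h1 * dot a (grad f x).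
Proof.
move=> df dh; rewrite -dotZr; congr dot; apply/rowP => k.
by rewrite !mxE (pd_scomp k df dh).
Qed.

Lemma D2_scomp V (h h1 : R -> R) (h2 : R) f x a : smooth_on V f -> V x ->
  (forall y, V y -> is_derive (f y) 1 h (h1 (f y))) -> is_derive (f x) 1 h1 h2 ->
  D2 (fun y => h (f y)) x a a =
    h2 * (dot a (grad f x) * dot a (grad f x)) + h1 (f x) * D2 f x a a.
Proof.
move=> sf Vx dh dh1.
have nV : \forall y \near x, V y by apply: open_nbhs_nbhs; split=> //; exact: sf.1.
have dfx := sf.2 [::] x Vx.
have E k l : pd l (pd k (fun y => h (f y))) x =
    h2 * (pd l f x * pd k f x) + h1 (f x) * pd l (pd k f) x.
  rewrite -(@near_pd _ (fun y => h1 (f y) * pd k f y)); last first.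
    by move: nV; apply: filterS => y Vy; rewrite (pd_scomp k (sf.2 [::] y Vy) (dh y Vy)).
  rewrite pdM; last exact: (sf.2 [:: k]).
    by rewrite (pd_scomp l dfx dh1) mulrA.
  by apply: differentiable_scomp => //; have [] := dh1.
rewrite !D2E /dot mulr_suml !mulr_sumr -big_split /=; apply: eq_bigr => k _.
rewrite !mulr_sumr -big_split /=; apply: eq_bigr => l _; rewrite !mxE.
have -> := E k l; move: (pd l (pd k f) x) (pd k f x) (pd l f x) (h1 _) => A B C D.
by ring.
Qed.

Lemma is_derive_exp_scale (t s : R) :
  is_derive s 1 (fun s : R => expR (t * s)) (t * expR (t * s)).
Proof.
have E := is_deriveZ t (is_derive_id s (1 : R)).
rewrite [_ *: _]mulr1 in E.
have := @is_derive1_comp R (@expR R) (t *: id) s _ _ (is_derive_expR _) E.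
by rewrite /GRing.scale /= mulrC.
Qed.

(** Write [- (- rho)^t = - exp (t G)] with [G = ln (- sg) + psi]. The chain rule
expresses its Hessian by the derivatives of [sg] and [psi]; it remains to divide
by [t exp (t G)] and to multiply by [sg^2]. *)
Lemma exponent_trace Om U rho sg psi (t : R) x a : open Om ->
  smooth_defining Om rho -> unit_defining Om U sg -> smooth_on U psi ->
  (forall y, U y -> rho y = sg y * expR (psi y)) ->
  psh Om (fun y => - ((- rho y) `^ t)) -> 0 < t -> Om x -> U x ->
  sg x * (D2 sg x a a + D2 sg x (Jmap a) (Jmap a))
  - (dot a (grad sg x) ^+ 2 + dot (Jmap a) (grad sg x) ^+ 2)
  + sg x ^+ 2 * (D2 psi x a a + D2 psi x (Jmap a) (Jmap a))
  + t * ((dot a (grad sg x) + sg x * dot a (grad psi x)) ^+ 2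
       + (dot (Jmap a) (grad sg x) + sg x * dot (Jmap a) (grad psi x)) ^+ 2) <= 0.
Proof.
move=> oOm [W [clW srho OmE _]] [BU ssg OmsE _] spsi rhoE P t0 Ox Ux.
set u := fun y => _ in P.
have du y : Om y -> differentiable u y.
  move=> Oy; have rp z : Om z -> 0 < - rho z.
    by move=> Oz; rewrite oppr_gt0; move: Oz; rewrite OmE => -[].
  have E : {near y, (fun z => - expR (t * ln (- rho z))) =1 u}.
    have : \forall z \near y, Om z by exact: open_nbhs_nbhs.
    by apply: filterS => z Oz; rewrite /u /powR gt_eqF ?rp.
  apply: (near_differentiable E).
  apply: (@smooth_on_diff _ Om _ [::]) => //.
  apply: smooth_N; apply: smooth_exp; apply: smooth_M; first exact: smooth_cst.
  apply: smooth_ln => //; apply: smooth_N; apply: smooth_on_sub srho => //.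
  by apply: subset_trans clW; exact: subset_closure.
pose V := Om `&` U.
have oV : open V by apply: openI => //; exact: ssg.1.
have sV y : V y -> sg y < 0 by move=> [Oy Uy]; apply/OmsE.
have ssV : smooth_on V sg by apply: smooth_on_sub ssg => // y [].
have spV : smooth_on V psi by apply: smooth_on_sub spsi => // y [].
have sl : smooth_on V (fun y => ln (- sg y)).
  by apply: smooth_ln; [move=> y /sV; rewrite oppr_gt0|exact: smooth_N].
pose G y := ln (- sg y) + psi y.
have sG : smooth_on V G by exact: smooth_D.
pose h (s : R) := - expR (t * s).
have E : {near x, u =1 (fun y => h (G y))}.
  have : \forall z \near x, V z by apply: open_nbhs_nbhs.
  apply: filterS => z Vz; have sz := sV z Vz; have [Oz Uz] := Vz.
  rewrite /u /h /G rhoE // -mulNr /powR gt_eqF ?mulr_gt0 ?oppr_gt0 ?expR_gt0 //.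
  by rewrite lnM ?posrE ?oppr_gt0 ?expR_gt0 // expRK.
have Vx : V x by [].
have shG : smooth_on V (fun y => h (G y)).
  by apply: smooth_N; apply: smooth_exp; apply: smooth_M => //; exact: smooth_cst.
have d2u : diff2 u x.
  have [n0 d0] := smooth_diff2 [::] shG Vx.
  have E' : {near x, (fun y => h (G y)) =1 u} by move: E; apply: filterS => y ->.
  split.
    have : \forall y \near x, {near y, (fun y => h (G y)) =1 u} by exact: near_join.
    by move=> n1; apply: filterS2 n1 n0 => y; exact: near_differentiable.
  move=> k; apply: (@near_differentiable _ (pd k (fun y => h (G y)))); last exact: d0.
  by move/near_join : E'; apply: filterS => y; exact: near_pd.
have := psh_trace a oOm P du Ox d2u.
have D (b : pt R) : D2 u x b b = - (t * expR (t * G x)) *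
   (D2 G x b b + t * dot b (grad G x) ^+ 2).
  rewrite (near_D2 _ _ E).
  have hd y : V y -> is_derive (G y) 1 h (- (t * expR (t * G y))).
    by move=> _; apply: is_deriveN; exact: is_derive_exp_scale.
  have h1d : is_derive (G x) 1 (fun s => - (t * expR (t * s)))
      (- (t * (t * expR (t * G x)))).
    by apply: is_deriveN; exact: (is_deriveZ t (is_derive_exp_scale t (G x))).
  rewrite (@D2_scomp V h (fun s => - (t * expR (t * s))) _ G x b sG Vx hd h1d).
  by move: (expR _) (dot b _) (D2 _ _ _ _) => A B C; ring.
have sx := sV x Vx; have sx0 : sg x != 0 by rewrite lt_eqF.
have dln (y : pt R) : V y -> is_derive (sg y) 1 (fun s => ln (- s)) (sg y)^-1.
  move=> Vy; have ny : 0 < - sg y by rewrite oppr_gt0 sV.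
  have E1 := is_deriveN (is_derive_id (sg y) (1 : R)).
  have := is_derive1_comp (is_derive1_ln ny) E1.
  by rewrite invrN mulrN mulr1 opprK.
have D' (b : pt R) : D2 G x b b = - (sg x ^- 2 * dot b (grad sg x) ^+ 2)
    + (sg x)^-1 * D2 sg x b b + D2 psi x b b.
  rewrite (D2_add _ _ sl spV Vx); congr (_ + _).
  have iV : is_derive (sg x) 1 (@GRing.inv R) (- (sg x ^- 2)).
    have dV : derivable (@GRing.inv R) (sg x) 1.
      by apply: derivableV => //; exact: derivable_id.
    apply: DeriveDef => //.
    by rewrite (deriveV (f := id)) // derive_id /GRing.scale /= mulr1.
  rewrite (@D2_scomp V (fun s => ln (- s)) (@GRing.inv R) _ sg x b ssV Vx dln iV).
  by rewrite -expr2 mulNr.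
have D'' (b : pt R) : dot b (grad G x) = (sg x)^-1 * dot b (grad sg x) + dot b (grad psi x).
  rewrite grad_add; [|exact: (sl.2 [::])|exact: (spV.2 [::])]; congr (_ + _).
  by rewrite (grad_scomp _ (ssV.2 [::] x Vx) (dln x Vx)).
rewrite !D !D' !D''.
move: (dot a (grad sg x)) (dot (Jmap a) (grad sg x)) (dot a (grad psi x)).
move: (dot (Jmap a) (grad psi x)) => q4 q1 q2 q3.
move: (D2 sg x a a) (D2 sg x (Jmap a) (Jmap a)) (D2 psi x a a) (D2 psi x (Jmap a) (Jmap a)).
move=> p1 p2 p3 p4; rewrite -mulrDr mulNr oppr_ge0 pmulr_rle0; last first.
  by rewrite mulr_gt0 // expR_gt0.
have s2 : 0 < sg x ^+ 2 by rewrite exprn_even_gt0 // sx0 orbT.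
rewrite -(ler_pM2l s2) mulr0; apply: le_trans; rewrite le_eqVlt; apply/orP; left.
by apply/eqP; field.
Qed.

End ExponentInequality.

(** * The exponent inequality in the boundary limit *)

Section BoundaryAsymptotics.
Context {R : realType}.
Implicit Types (f g u rho sg psi : pt R -> R) (x y z v w a b X : pt R) (i j k : 'I_4).
Implicit Types (Om U V : set (pt R)).

Lemma D3C12 V f x a b w : smooth_on V f -> V x -> D3 f x a b w = D3 f x b a w.
Proof.
move=> sf Vx; have nV : \forall y \near x, V y.
  by apply: open_nbhs_nbhs; split=> //; exact: sf.1.
rewrite /D3 /D2; under eq_bigr => k _ do rewrite mulr_sumr.
under [RHS]eq_bigr => k _ do rewrite mulr_sumr.
rewrite exchange_big; apply: eq_bigr => k _; apply: eq_bigr => l _.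
have E : grad (pd k (pd l f)) x = grad (pd l (pd k f)) x.
  apply: near_grad; move: nV; apply: filterS => y Vy; apply: schwarz.
  exact: (smooth_diff2 [::] sf Vy).
rewrite mulrCA.
exact: (congr1 (fun v : pt R => b 0 k * (a 0 l * dot w v)) E).
Qed.

Lemma D3C23 V f x a b w : smooth_on V f -> V x -> D3 f x a b w = D3 f x a w b.
Proof.
move=> sf Vx; apply: eq_bigr => k _; rewrite D2C //.
exact: (smooth_diff2 [:: k] sf Vx).
Qed.

Lemma line_cvg f x v : {for x, continuous f} ->
  f (x + t *: v) @[t --> (0 : R)^'+] --> f x.
Proof.
move=> cf; apply: cvg_at_right_filter.
have E : x + (0 : R) *: v = x by rewrite scale0r addr0.
rewrite -{2}E; apply: (@continuous_comp _ _ _ (fun t : R => x + t *: v) f).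
  exact: line_continuous.
by rewrite E.
Qed.

Lemma line_quotient_cvg f x v : differentiable f x -> f x = 0 ->
  t^-1 * f (x + t *: v) @[t --> (0 : R)^'+] --> dot v (grad f x).
Proof.
move=> df f0; apply/cvgrPdist_le => e e0.
have v1 : 0 < `|v| + 1 by rewrite ltr_wpDl.
have ev : 0 < e / (`|v| + 1) by rewrite divr_gt0.
have [d d0 Hd] := diff_radius df ev.
near=> t.
have t0 : 0 < t by near: t; exact: nbhs_right_gt.
have td : t < d / (`|v| + 1) by near: t; apply: nbhs_right_lt; rewrite divr_gt0.
have tv : `|t *: v| < d.
  rewrite normrZ (gtr0_norm t0); move: td; rewrite ltr_pdivlMr //.
  by apply: le_lt_trans; rewrite ler_wpM2l ?(ltW t0) // lerDl.
have := Hd _ tv; rewrite f0 subr0 dotZl normrZ (gtr0_norm t0) => h.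
have -> : dot v (grad f x) - t^-1 * f (x + t *: v) =
   - (t^-1 * (f (x + t *: v) - t * dot v (grad f x))).
  by move: (f _) (dot _ _) => A B; field; rewrite gt_eqF.
rewrite normrN normrM gtr0_norm ?invr_gt0 // ler_pdivrMl //.
apply: le_trans h _; rewrite mulrCA ler_wpM2l ?(ltW t0) //.
rewrite mulrAC ler_pdivrMr // ler_wpM2l ?(ltW e0) // lerDl //.
Unshelve. all: by end_near. Qed.

Lemma right_cvgD (f g : R -> R) (l m : R) : f t @[t --> (0 : R)^'+] --> l ->
  g t @[t --> (0 : R)^'+] --> m -> f t + g t @[t --> (0 : R)^'+] --> l + m.
Proof. by move=> fl gm; exact: cvgD. Qed.

Lemma right_cvgB (f g : R -> R) (l m : R) : f t @[t --> (0 : R)^'+] --> l ->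
  g t @[t --> (0 : R)^'+] --> m -> f t - g t @[t --> (0 : R)^'+] --> l - m.
Proof. by move=> fl gm; exact: cvgB. Qed.

Lemma right_cvgM (f g : R -> R) (l m : R) : f t @[t --> (0 : R)^'+] --> l ->
  g t @[t --> (0 : R)^'+] --> m -> f t * g t @[t --> (0 : R)^'+] --> l * m.
Proof. by move=> fl gm; exact: cvgM. Qed.

Lemma cvg_tmul (f : R -> R) (l : R) : f t @[t --> (0 : R)^'+] --> l ->
  t * f t @[t --> (0 : R)^'+] --> (0 : R).
Proof.
move=> fl; rewrite -[X in _ --> X](mul0r l); apply: cvgM => //.
exact/cvg_at_right_filter/cvg_id.
Qed.

Lemma dot_grad_diff V f x v : smooth_on V f -> V x ->
  differentiable (fun y => dot v (grad f y)) x /\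
  forall w, dot w (grad (fun y => dot v (grad f y)) x) = D2 f x v w.
Proof.
move=> sf Vx.
have -> : (fun y => dot v (grad f y)) = (fun y => \sum_(k < 4) v 0 k * pd k f y).
  by apply/funext => y; apply: eq_bigr => k _; rewrite mxE.
have d k : differentiable (fun y => v 0 k * pd k f y) x.
  by apply: differentiableM => //; exact: (sf.2 [:: k]).
split; first exact: differentiable_sum4.
move=> w; rewrite D2E exchange_big; apply: eq_bigr => l _; rewrite mxE pd_sum //.
rewrite mulr_sumr; apply: eq_bigr => k _; rewrite pdZ; last exact: (sf.2 [:: k]).
by rewrite mulrCA mulrA.
Qed.

Lemma D2_diff V f x v w : smooth_on V f -> V x -> differentiable (fun y => D2 f y v w) x.
Proof.
move=> sf Vx; have -> : (fun y => D2 f y v w) =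
    (fun y => \sum_(k < 4) v 0 k * \sum_(l < 4) w 0 l * pd l (pd k f) y).
  apply/funext => y; apply: eq_bigr => k _; congr (_ * _).
  by apply: eq_bigr => l _; rewrite mxE.
apply: differentiable_sum4 => k; apply: differentiableM => //.
apply: differentiable_sum4 => l; apply: differentiableM => //.
exact: (sf.2 [:: l; k]).
Qed.

(** [X] is tangential, so the pairing vanishes for [t = 0] and its quotient by [t]
has a limit. *)
Lemma moving_grad_cvg V f x v X w : smooth_on V f -> V x -> dot X (grad f x) = 0 ->
  t^-1 * dot (X + t *: w) (grad f (x + t *: v)) @[t --> (0 : R)^'+] -->
  D2 f x X v + dot w (grad f x).
Proof.
move=> sf Vx X0; have [d1 g1] := dot_grad_diff X sf Vx.
have [d2 _] := dot_grad_diff w sf Vx.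
have c1 := @line_quotient_cvg _ _ v d1 X0; rewrite g1 in c1.
have c2 := @line_cvg _ x v (differentiable_continuous d2).
apply: cvg_trans (right_cvgD c1 c2); apply: near_eq_cvg; near=> t.
have t0 : t != 0 by rewrite gt_eqF //; near: t; exact: nbhs_right_gt.
rewrite /= dotDl dotZl mulrDr; congr (_ + _).
by rewrite mulrA mulVf // mul1r.
Unshelve. all: by end_near. Qed.

Lemma Jmap_add a b : Jmap (a + b) = Jmap a + Jmap b.
Proof.
apply/rowP => k; rewrite !mxE.
by case: k => -[|[|[|[|//]]]] kP /=; rewrite ?opprD.
Qed.

Lemma D2_line f y X w (t : R) : D2 f y (X + t *: w) (X + t *: w) =
  D2 f y X X + t * (D2 f y X w + D2 f y w X + t * D2 f y w w).
Proof.
rewrite !D2_hmul !hmulD !hmulZ !dotDl !dotDr !dotZl !dotZr.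
move: (dot X (hmul f y X)) (dot X (hmul f y w)) (dot w (hmul f y X)) (dot w (hmul f y w)).
by move=> A B C D; ring.
Qed.

(** [exponent_trace] at [x - s n] along [X + s w], divided by [s^2]. As [s -> 0+],
[sg / s -> -1], the derivative of [sg] along [X + s w] divided by [s] tends to
[dot w n], since [D2 sg x X n = 0], and the complex Hessian of [sg] on [X + s w]
divided by [s] tends to its derivative along [- n] plus twice the mixed terms with
[w]. *)
Lemma boundary_inequality Om U rho sg psi (t : R) x X w : open Om -> bounded_set Om ->
  smooth_defining Om rho -> unit_defining Om U sg -> smooth_on U psi ->
  (forall y, U y -> rho y = sg y * expR (psi y)) ->
  psh Om (fun y => - ((- rho y) `^ t)) -> 0 < t -> bdry Om x ->
  dot X (grad sg x) = 0 -> dot (Jmap X) (grad sg x) = 0 ->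
  D2 sg x X X + D2 sg x (Jmap X) (Jmap X) = 0 ->
  D3 sg x (grad sg x) X X + D3 sg x (grad sg x) (Jmap X) (Jmap X)
  - 2 * (D2 sg x X w + D2 sg x (Jmap X) (Jmap w))
  - (dot w (grad sg x) ^+ 2 + dot (Jmap w) (grad sg x) ^+ 2)
  + (D2 psi x X X + D2 psi x (Jmap X) (Jmap X))
  + t * ((dot w (grad sg x) - dot X (grad psi x)) ^+ 2
       + (dot (Jmap w) (grad sg x) - dot (Jmap X) (grad psi x)) ^+ 2) <= 0.
Proof.
move=> oOm bOm drho ud spsi rhoE P t0 Bx X0 Y0 LX.
have [BU ssg OmsE Hb] := ud; have Ux := BU x Bx.
have [s0 n1] := Hb x Bx.
set n := grad sg x in X0 Y0 n1 *; set Y := Jmap X in Y0 LX *.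
have hX v : dot v n = 0 -> D2 sg x v (- n) = 0.
  move=> vn; rewrite D2_hmul -scaleN1r hmulZ dotZr -D2_hmul D2C; last first.
    exact: (smooth_diff2 [::] ssg Ux).
  by rewrite (unit_defining_normal oOm bOm ud Bx vn) mulr0.
have ds : differentiable sg x := ssg.2 [::] x Ux.
(* the limits of the quotients by s of sg, of its derivatives along X + s w and
   J (X + s w), and (cT below) of its complex Hessian *)
have c0 := @line_quotient_cvg _ _ (- n) ds s0; rewrite dotNl n1 in c0.
have c1 := @moving_grad_cvg _ _ _ (- n) _ w ssg Ux X0; rewrite (hX X X0) add0r in c1.
have c2 := @moving_grad_cvg _ _ _ (- n) _ (Jmap w) ssg Ux Y0; rewrite (hX Y Y0) add0r in c2.
have cp (v : pt R) (W : pt R) : dot (v + s *: W) (grad psi (x + s *: - n)) @[s --> (0 : R)^'+] -->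
    dot v (grad psi x).
  have [d1 _] := dot_grad_diff v spsi Ux; have [d2 _] := dot_grad_diff W spsi Ux.
  have e1 := @line_cvg _ x (- n) (differentiable_continuous d1).
  have e2 := cvg_tmul (@line_cvg _ x (- n) (differentiable_continuous d2)).
  have -> : dot v (grad psi x) = dot v (grad psi x) + 0 by rewrite addr0.
  apply: cvg_trans (right_cvgD e1 e2); apply: near_eq_cvg; near=> s.
  by rewrite /= dotDl dotZl.
have cD2 V f v W : smooth_on V f -> V x ->
    D2 f (x + s *: - n) v W @[s --> (0 : R)^'+] --> D2 f x v W.
  move=> sf Vx; apply: (@line_cvg (fun y => D2 f y v W)).
  exact: (differentiable_continuous (D2_diff v W sf Vx)).
have cpp (v : pt R) (W : pt R) : D2 psi (x + s *: - n) (v + s *: W) (v + s *: W)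
    @[s --> (0 : R)^'+] --> D2 psi x v v.
  have e0 := cvg_tmul (cD2 _ _ W W spsi Ux).
  have e1 := cvg_tmul (right_cvgD (right_cvgD (cD2 _ _ v W spsi Ux) (cD2 _ _ W v spsi Ux)) e0).
  have -> : D2 psi x v v = D2 psi x v v + 0 by rewrite addr0.
  apply: cvg_trans (right_cvgD (cD2 _ _ v v spsi Ux) e1); apply: near_eq_cvg; near=> s.
  by rewrite /= D2_line.
have cT : s^-1 * (D2 sg (x + s *: - n) (X + s *: w) (X + s *: w)
    + D2 sg (x + s *: - n) (Y + s *: Jmap w) (Y + s *: Jmap w)) @[s --> (0 : R)^'+] -->
  - (D3 sg x n X X + D3 sg x n Y Y) + 2 * (D2 sg x X w + D2 sg x Y (Jmap w)).
  have dT : differentiable (fun y => D2 sg y X X + D2 sg y Y Y) x.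
    by apply: differentiableD; exact: (D2_diff _ _ ssg Ux).
  have e0 := @line_quotient_cvg _ _ (- n) dT LX.
  have E3 v : dot (- n) (grad (fun y => D2 sg y v v) x) = - D3 sg x n v v.
    rewrite grad_D2; last by move=> k l; exact: (ssg.2 [:: l; k]).
    rewrite (D3C23 _ _ _ ssg Ux) (D3C12 _ _ _ ssg Ux).
    by rewrite /D3 -sumrN; apply: eq_bigr => k _; rewrite mxE mulNr.
  rewrite grad_add ?E3 in e0; try exact: (D2_diff _ _ ssg Ux).
  have q v W := right_cvgD (right_cvgD (cD2 _ _ v W ssg Ux) (cD2 _ _ W v ssg Ux)) (cvg_tmul (cD2 _ _ W W ssg Ux)).
  have sym v W : D2 sg x v W + D2 sg x W v + 0 = 2 * D2 sg x v W.
    rewrite addr0 (D2C W v); first by rewrite mulr_natl.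
    exact: (smooth_diff2 [::] ssg Ux).
  have -> : - (D3 sg x n X X + D3 sg x n Y Y) + 2 * (D2 sg x X w + D2 sg x Y (Jmap w)) =
    (- D3 sg x n X X + - D3 sg x n Y Y) + ((D2 sg x X w + D2 sg x w X + 0) +
      (D2 sg x Y (Jmap w) + D2 sg x (Jmap w) Y + 0)).
    by rewrite !sym mulrDr opprD.
  apply: cvg_trans (right_cvgD e0 (right_cvgD (q X w) (q Y (Jmap w)))); apply: near_eq_cvg; near=> s.
  have s0' : s != 0 by rewrite gt_eqF //; near: s; exact: nbhs_right_gt.
  rewrite /= !D2_line.
  move: (D2 _ _ X X) (D2 _ _ X w + D2 _ _ w X) (D2 _ _ w w) (D2 _ _ Y Y) => A1 A2 A3 A4.
  move: (D2 _ _ Y _ + D2 _ _ _ Y) (D2 _ _ (Jmap w) (Jmap w)) => A5 A6.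
  by field.
have ct : (fun=> t) s @[s --> (0 : R)^'+] --> t by exact: cvg_cst.
(* the limit of the left-hand side of the inequality at x - s n, divided by s^2 and
   arranged as products of the quotients above *)
have F := right_cvgD (right_cvgD (right_cvgB (right_cvgM c0 cT) (right_cvgD (right_cvgM c1 c1) (right_cvgM c2 c2)))
   (right_cvgM (right_cvgM c0 c0) (right_cvgD (cpp X w) (cpp Y (Jmap w)))))
   (right_cvgM ct (right_cvgD (right_cvgM (right_cvgD c1 (right_cvgM c0 (cp X w))) (right_cvgD c1 (right_cvgM c0 (cp X w))))
    (right_cvgM (right_cvgD c2 (right_cvgM c0 (cp Y (Jmap w)))) (right_cvgD c2 (right_cvgM c0 (cp Y (Jmap w))))))).
have [r r0 HU] := near_radius (open_nbhs_nbhs (conj ssg.1 Ux) : \forall z \near x, U z).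
have nr : 0 < r / (`|n| + 1) by rewrite divr_gt0 // ltr_wpDl.
have N0 : \forall s \near (0 : R)^'+, s^-1 * sg (x + s *: - n) < 0.
  by move/cvgr_lt : c0; apply; rewrite oppr_lt0.
apply: le_trans; last first.
  apply: (cvgr_to_le F); near=> s.
  have sp : 0 < s by near: s; exact: nbhs_right_gt.
  have sr : s < r / (`|n| + 1) by near: s; exact: nbhs_right_lt.
  have Us : U (x + s *: - n).
    apply: HU; rewrite normrZ normrN (gtr0_norm sp); move: sr.
    rewrite ltr_pdivlMr ?ltr_wpDl //; apply: le_lt_trans.
    by rewrite ler_wpM2l ?(ltW sp) // lerDl.
  have sgs : s^-1 * sg (x + s *: - n) < 0.
    by near: s.
  have Os : Om (x + s *: - n).
    by apply/OmsE => //; move: sgs; rewrite pmulr_rlt0 ?invr_gt0.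
  have := exponent_trace (X + s *: w) oOm drho ud spsi rhoE P t0 Os Us.
  rewrite Jmap_add JmapZ -/Y => I.
  have i2 : 0 < s^-1 ^+ 2 by rewrite exprn_gt0 // invr_gt0.
  have := ler_wpM2l (ltW i2) I; rewrite mulr0; apply: le_trans.
  rewrite le_eqVlt; apply/orP; left; apply/eqP.
  move: (sg _) (dot _ (grad sg _)) (dot (Y + _) (grad sg _)) => B1 B2 B3.
  move: (dot _ (grad psi _)) (dot (Y + _) (grad psi _)) => B4 B5.
  move: (D2 sg _ _ _) (D2 sg _ (Y + _) _) (D2 psi _ _ _) (D2 psi _ (Y + _) _) => B6 B7 B8 B9.
  by ring.
rewrite le_eqVlt; apply/orP; left; apply/eqP.
move: (dot w _) (dot (Jmap w) _) (dot X _) (dot Y _) => A1 A2 A3 A4.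
move: (D3 _ _ _ X _) (D3 _ _ _ Y _) (D2 sg _ X _) (D2 sg _ Y _) => A5 A6 A7 A8.
move: (D2 psi _ X _) (D2 psi _ Y _) => A9 A10.
by ring.
Unshelve. all: by end_near. Qed.

End BoundaryAsymptotics.

(** * The tangential frame as a linear function of the normal *)

Section TangentFrame.
Context {R : realType}.
Implicit Types (f g rho sg psi : pt R -> R) (x y z v w a b X : pt R) (i j k : 'I_4).
Implicit Types (Om U V : set (pt R)) (B C : 'M[R]_4).

(** Conjugation followed by a rotation, which anticommutes with [Jmap]. It is
chosen so that [Amap n] spans, with [Jmap (Amap n)], the complex line orthogonal to
[n], and it is linear in [n]: the frame of the tangent lines can be differentiated
as a function of the gradient. *)
Definition Amap v : pt R := \row_k [:: v 0 2%:R; - v 0 3%:R; - v 0 0; v 0 1]`_k.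

Lemma row4P (v w : pt R) : v 0 0 = w 0 0 -> v 0 1 = w 0 1 ->
  v 0 2%:R = w 0 2%:R -> v 0 3%:R = w 0 3%:R -> v = w.
Proof.
move=> h0 h1 h2 h3; apply/rowP => k.
have : k \in [:: 0; 1; 2%:R; 3%:R].
  by rewrite !inE; case: k => -[|[|[|[|//]]]] kP.
by rewrite !inE => /or4P[] /eqP ->.
Qed.

Lemma JmapE v : (Jmap v 0 0 = - v 0 1) * (Jmap v 0 1 = v 0 0) *
  (Jmap v 0 2%:R = - v 0 3%:R) * (Jmap v 0 3%:R = v 0 2%:R).
Proof. by rewrite !mxE. Qed.

Lemma AmapE v : (Amap v 0 0 = v 0 2%:R) * (Amap v 0 1 = - v 0 3%:R) *
  (Amap v 0 2%:R = - v 0 0) * (Amap v 0 3%:R = v 0 1).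
Proof. by rewrite !mxE. Qed.

Lemma JJ v : Jmap (Jmap v) = - v.
Proof. by apply: row4P; rewrite !JmapE [RHS]mxE ?opprK. Qed.

Lemma dotJl v w : dot (Jmap v) w = - dot v (Jmap w).
Proof. by rewrite !dotE !JmapE; ring. Qed.

Lemma dotJ v : dot (Jmap v) v = 0.
Proof. by rewrite !dotE !JmapE; ring. Qed.

Lemma dotAl v w : dot (Amap v) w = - dot v (Amap w).
Proof. by rewrite !dotE !AmapE; ring. Qed.

Lemma dotA v : dot (Amap v) v = 0.
Proof. by rewrite !dotE !AmapE; ring. Qed.

Lemma dotJA v : dot (Jmap (Amap v)) v = 0.
Proof. by rewrite !dotE !JmapE !AmapE; ring. Qed.

Lemma dotJAl v w : dot (Jmap (Amap v)) w = - dot v (Jmap (Amap w)).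
Proof. by rewrite !dotE !JmapE !AmapE; ring. Qed.

(** [n], [Jmap n], [Amap n], [Jmap (Amap n)] are pairwise orthogonal and of the same
length. *)
Lemma frame n v w : dot n n = 1 -> dot v w =
  dot v n * dot w n + dot v (Jmap n) * dot w (Jmap n)
  + dot v (Amap n) * dot w (Amap n)
  + dot v (Jmap (Amap n)) * dot w (Jmap (Amap n)).
Proof.
move=> n1; rewrite -[LHS]mulr1 -n1 !dotE !JmapE !AmapE.
by ring.
Qed.

Definition Jmx : 'M[R]_4 := \matrix_(m, k) Jmap (delta_mx 0 m) 0 k.
Definition Amx : 'M[R]_4 := \matrix_(m, k) Amap (delta_mx 0 m) 0 k.

Lemma JmxE i k : Jmx i k = Jmap (delta_mx 0 i) 0 k.
Proof. by rewrite [LHS]mxE. Qed.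

Lemma AmxE i k : Amx i k = Amap (delta_mx 0 i) 0 k.
Proof. by rewrite [LHS]mxE. Qed.

Lemma sum4E (F : 'I_4 -> R) : \sum_(k < 4) F k = F 0 + F 1 + F 2%:R + F 3%:R.
Proof.
rewrite !big_ord_recl big_ord0 addr0 !addrA.
by congr (F _ + F _ + F _ + F _); apply: val_inj.
Qed.

Lemma mulJmx v : v *m Jmx = Jmap v.
Proof.
by apply: row4P; rewrite mxE sum4E !JmxE !JmapE !mxE /=; ring.
Qed.

Lemma mulAmx v : v *m Amx = Amap v.
Proof.
by apply: row4P; rewrite mxE sum4E !AmxE !AmapE !mxE /=; ring.
Qed.

(** The Hessian evaluated on two linear images of the gradient. The coefficients of
[Hess f] in the frame attached to [grad f], in particular [Hess_delta (N, L)], are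
combinations of such functions. *)
Definition gradform B C f y := D2 f y (grad f y *m B) (grad f y *m C).

Lemma linear_coord_diff B f x k : (forall j, differentiable (pd j f) x) ->
  differentiable (fun y => (grad f y *m B) 0 k) x /\
  forall v, dot v (grad (fun y => (grad f y *m B) 0 k) x) = (hmul f x v *m B) 0 k.
Proof.
move=> d; have -> : (fun y => (grad f y *m B) 0 k) =
    (fun y => \sum_(m < 4) B m k * pd m f y).
  by apply/funext => y; rewrite mxE; apply: eq_bigr => m _; rewrite mxE mulrC.
have dm m : differentiable (fun y => B m k * pd m f y) x.
  by apply: differentiableM => //; exact: differentiable_cst.
split; first exact: differentiable_sum4.
move=> v; rewrite mxE.
transitivity (\sum_(m < 4) B m k * dot v (grad (pd m f) x)).
  rewrite /dot; under eq_bigr => l _ do rewrite mxE pd_sum // mulr_sumr.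
  rewrite exchange_big; apply: eq_bigr => m _; rewrite mulr_sumr.
  by apply: eq_bigr => l _; rewrite pdZ // mulrCA mxE.
by apply: eq_bigr => m _; rewrite [hmul _ _ _ _ _]mxE mulrC.
Qed.

Lemma grad_mul f g x v : differentiable f x -> differentiable g x ->
  dot v (grad (fun y => f y * g y) x) =
  dot v (grad f x) * g x + f x * dot v (grad g x).
Proof.
move=> df dg; rewrite mulrC -!dotZr -dotDr; congr dot; apply/rowP => k.
by rewrite !mxE pdM // mulrC.
Qed.

Lemma grad_sum (F : 'I_4 -> pt R -> R) x v : (forall k, differentiable (F k) x) ->
  dot v (grad (fun y => \sum_(k < 4) F k y) x) = \sum_(k < 4) dot v (grad (F k) x).
Proof.
move=> dF; rewrite /dot exchange_big; apply: eq_bigr => l _.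
by rewrite mxE pd_sum // mulr_sumr; apply: eq_bigr => k _; rewrite mxE.
Qed.

(** Leibniz rule: the derivative falls on the Hessian or on one of the two
gradients. *)
Lemma gradform_diff B C f x : (forall j, differentiable (pd j f) x) ->
  (forall k l, differentiable (pd l (pd k f)) x) ->
  differentiable (gradform B C f) x /\
  forall v, dot v (grad (gradform B C f) x) =
    D3 f x (grad f x *m B) (grad f x *m C) v
    + D2 f x (hmul f x v *m B) (grad f x *m C)
    + D2 f x (grad f x *m B) (hmul f x v *m C).
Proof.
move=> d1 d2; pose b k y := (grad f y *m B) 0 k; pose c k y := (grad f y *m C) 0 k.
have db k := linear_coord_diff B k d1.
have dc k := linear_coord_diff C k d1.
pose I k y := \sum_(l < 4) c l y * pd l (pd k f) y.
have E : gradform B C f = (fun y => \sum_(k < 4) b k y * I k y).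
  apply/funext => y; apply: eq_bigr => k _; congr (_ * _).
  by apply: eq_bigr => l _; rewrite [grad (pd k f) y 0 l]mxE.
have dcl k l : differentiable (fun y => c l y * pd l (pd k f) y) x.
  by apply: differentiableM; [exact: (dc l).1|exact: d2].
have dI k : differentiable (I k) x by apply: differentiable_sum4.
have dbI k : differentiable (fun y => b k y * I k y) x.
  by apply: differentiableM; [exact: (db k).1|exact: dI].
rewrite E; split=> [|v]; first exact: differentiable_sum4.
rewrite grad_sum // /D3 /D2 -!big_split; apply: eq_bigr => k _ /=.
rewrite (grad_mul v (db k).1 (dI k)) (db k).2.
rewrite grad_sum // -addrA [RHS]addrCA; congr (_ + _).
  by congr (_ * _); apply: eq_bigr => l _; rewrite [grad (pd k f) x _ _]mxE.
rewrite -mulrDr; congr (_ * _); rewrite [dot (hmul _ _ _ *m _) _]/dot -big_split.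
apply: eq_bigr => l _ /=; rewrite (grad_mul v (dc l).1 (d2 k l)) (dc l).2 addrC.
by rewrite [grad (pd k f) x 0 l]mxE.
Qed.

End TangentFrame.

(** * Levi-flat boundary points in real terms *)

(** [b1], [b2] are the coordinates of [w] that are optimal for the final inequality.
The two sides of the conclusion then differ by [t] times the slack of the hypothesis
plus a sum of squares with positive coefficients. *)
Lemma flat_algebra {F : realFieldType} (t A B u v q1 q2 D : F)
    (b1 := - (v + t * q1) / (1 - t)) (b2 := (t * q2 - u) / (1 - t)) : 0 < t -> 0 < 1 - t ->
  - (2 * A ^+ 2 + 2 * B ^+ 2 + u ^+ 2 + v ^+ 2) - 2 * (b2 * u + b1 * v)
    - (b1 ^+ 2 + (- b2) ^+ 2) + D + t * ((b1 - q1) ^+ 2 + (- b2 - q2) ^+ 2) <= 0 ->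
  t / (1 - t) * ((v + t * q1) ^+ 2 + (t * q2 - u) ^+ 2) + t * D <=
  2 * (A ^+ 2 + B ^+ 2) + 2 * ((v + t * q1) * v - (t * q2 - u) * u).
Proof.
move=> t0 t1 H; have tn : 1 - t != 0 by rewrite gt_eqF.
have := ler_wpM2l (ltW t0) H; rewrite mulr0 -oppr_ge0 => {}H.
have sq a b : 0 <= a ^+ 2 + b ^+ 2 :> F by rewrite addr_ge0 // sqr_ge0.
have t1' := ltW t1; have c2 : 0 <= 2 * (1 - t) by rewrite mulr_ge0.
have E : 0 <= 2 * (1 - t) * (A ^+ 2 + B ^+ 2) + (1 - t) * (u ^+ 2 + v ^+ 2)
    + (1 - t) ^+ 2 * (b1 ^+ 2 + b2 ^+ 2).
  by apply: addr_ge0; [apply: addr_ge0|]; apply: mulr_ge0 => //; exact: sqr_ge0.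
rewrite -subr_ge0; apply: le_trans (addr_ge0 E H) _.
rewrite le_eqVlt; apply/orP; left; apply/eqP; rewrite /b1 /b2; field.
exact: tn.
Qed.

Section LeviFlatPoint.
Context {R : realType}.
Implicit Types (f g rho psi : pt R -> R) (x y z v w a b : pt R) (i j k : 'I_4).

(** With [him], the real and imaginary parts of [Hess f (N, L)], where [N] and [L]
are the frame attached to [grad f]. *)
Definition hre f y := 4^-1 * (gradform Amx 1%:M f y + gradform (Amx *m Jmx) Jmx f y).
Definition him f y := 4^-1 * (gradform (Amx *m Jmx) 1%:M f y - gradform Amx Jmx f y).

Lemma mulAJmx v : v *m (Amx *m Jmx) = Jmap (Amap v).
Proof. by rewrite mulmxA mulAmx mulJmx. Qed.

Lemma hreE f y (n := grad f y) : hre f y =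
  4^-1 * (D2 f y (Amap n) n + D2 f y (Jmap (Amap n)) (Jmap n)).
Proof. by rewrite /hre /gradform mulAJmx mulAmx mulJmx mulmx1. Qed.

Lemma himE f y (n := grad f y) : him f y =
  4^-1 * (D2 f y (Jmap (Amap n)) n - D2 f y (Amap n) (Jmap n)).
Proof. by rewrite /him /gradform mulAJmx mulAmx mulJmx mulmx1. Qed.

Lemma hre_him_diff f x : (forall j, differentiable (pd j f) x) ->
  (forall k l, differentiable (pd l (pd k f)) x) ->
  [/\ differentiable (hre f) x, differentiable (him f) x,
      forall v (n := grad f x) (h := hmul f x v), dot v (grad (hre f) x) = 4^-1 *
        ((D3 f x (Amap n) n v + D2 f x (Amap h) n + D2 f x (Amap n) h)
       + (D3 f x (Jmap (Amap n)) (Jmap n) v + D2 f x (Jmap (Amap h)) (Jmap n)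
          + D2 f x (Jmap (Amap n)) (Jmap h))) &
      forall v (n := grad f x) (h := hmul f x v), dot v (grad (him f) x) = 4^-1 *
        ((D3 f x (Jmap (Amap n)) n v + D2 f x (Jmap (Amap h)) n
          + D2 f x (Jmap (Amap n)) h)
       - (D3 f x (Amap n) (Jmap n) v + D2 f x (Amap h) (Jmap n)
          + D2 f x (Amap n) (Jmap h)))].
Proof.
move=> d1 d2.
have [e1 E1] := gradform_diff Amx 1%:M d1 d2.
have [e2 E2] := gradform_diff (Amx *m Jmx) Jmx d1 d2.
have [e3 E3] := gradform_diff (Amx *m Jmx) 1%:M d1 d2.
have [e4 E4] := gradform_diff Amx Jmx d1 d2.
have c4 : differentiable (fun=> 4^-1 : R) x by exact: differentiable_cst.
have N4 : differentiable (fun y => - gradform Amx Jmx f y) x by exact: differentiableN.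
have e12 : differentiable (fun y => gradform Amx 1%:M f y + gradform (Amx *m Jmx) Jmx f y) x.
  exact: differentiableD.
have e34 : differentiable (fun y => gradform (Amx *m Jmx) 1%:M f y - gradform Amx Jmx f y) x.
  exact: differentiableD.
have g0 v : dot v (grad (fun=> 4^-1 : R) x) = 0.
  by rewrite /dot big1 // => k _; rewrite mxE pd_cst mulr0.
split=> [||v n h|v n h].
- exact: (differentiableM c4 e12).
- exact: (differentiableM c4 e34).
- rewrite (grad_mul v c4 e12) g0 mul0r add0r; congr (_ * _).
  by rewrite (grad_add v e1 e2) E1 E2 !mulAJmx !mulAmx !mulJmx !mulmx1.
- rewrite (grad_mul v c4 e34) g0 mul0r add0r; congr (_ * _).
  rewrite (grad_add v e3 N4).
  have -> : dot v (grad (fun y => - gradform Amx Jmx f y) x) =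
      - dot v (grad (gradform Amx Jmx f) x).
    by rewrite -dotNr; congr dot; apply/rowP => k; rewrite !mxE pdN.
  by rewrite E3 E4 !mulAJmx !mulAmx !mulJmx !mulmx1.
Qed.

Lemma hmulN f x v : hmul f x (- v) = - hmul f x v.
Proof. by rewrite -scaleN1r hmulZ scaleN1r. Qed.

Context (Om U : set (pt R)) (sg : pt R -> R) (oOm : open Om) (bOm : bounded_set Om)
  (ud : unit_defining Om U sg).

Let dl := sdist Om.

(** The gradient of the distance is constant along normals, so only the tangential
part of the Hessian of [sg] remains. *)
Lemma sdist_hmul x v : bdry Om x ->
  hmul dl x v = hmul sg x v - dot v (grad sg x) *: hmul sg x (grad sg x).
Proof.
move=> Bx; have [_ _ _ E _] := sdist_regular oOm bOm ud Bx.
apply/rowP => j; rewrite !mxE.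
transitivity (\sum_(k < 4) (v 0 k * pd k (pd j sg) x - v 0 k * grad sg x 0 k *
     (\sum_(m < 4) grad sg x 0 m * pd m (pd j sg) x))).
  by apply: eq_bigr => k _; rewrite mxE E mulrBr mulrA.
rewrite sumrB -mulr_suml; congr (_ - _ * _).
  by apply: eq_bigr => k _; rewrite mxE.
by apply: eq_bigr => k _; rewrite [grad (pd j sg) x 0 k]mxE.
Qed.

Lemma sdist_D2 x a b : bdry Om x -> dot a (grad sg x) = 0 -> D2 dl x a b = D2 sg x a b.
Proof.
move=> Bx an; have [BU ssg _ _] := ud.
rewrite !D2_hmul sdist_hmul // dotBr dotZr -!D2_hmul.
rewrite (D2C a (grad sg x)); last exact: (smooth_diff2 [::] ssg (BU _ Bx)).
by rewrite (unit_defining_normal oOm bOm ud Bx an) mulr0 subr0.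
Qed.

Lemma sdist_hre x : bdry Om x -> hre dl x = hre sg x /\ him dl x = him sg x.
Proof.
move=> Bx; have [_ _ gE _ _] := sdist_regular oOm bOm ud Bx.
by rewrite !hreE !himE /dl gE !sdist_D2 ?dotA ?dotJA.
Qed.

Variable x : pt R.
Hypothesis Bx : bdry Om x.

Let n := grad sg x.
Let T := Jmap n.
Let X := Amap n.
Let Y := Jmap X.
Let W a b := D2 sg x a b.
Let h v := hmul sg x v.

Let Ux : U x. Proof. by have [BU _ _ _] := ud; exact: BU. Qed.
Let ssg : smooth_on U sg. Proof. by have [] := ud. Qed.
Let n1 : dot n n = 1. Proof. by have [_ _ _ Hb] := ud; have [] := Hb x Bx. Qed.
Let WC a b : W a b = W b a. Proof. exact: D2C (smooth_diff2 [::] ssg Ux). Qed.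

Lemma D2_tangent_normal v : dot v n = 0 -> W v n = 0.
Proof. by move=> vn; rewrite WC; exact: (unit_defining_normal oOm bOm ud Bx vn). Qed.

Let Xn : dot X n = 0. Proof. exact: dotA. Qed.
Let Yn : dot Y n = 0. Proof. exact: dotJA. Qed.

Lemma D2_normal v : W v n = dot v n * W n n.
Proof.
have : W (v - dot v n *: n) n = 0.
  by apply: D2_tangent_normal; rewrite dotBl dotZl n1 mulr1 subrr.
by rewrite /W !D2_hmul dotBl dotZl => /eqP; rewrite subr_eq0 => /eqP.
Qed.

Hypothesis LX : W X X + W Y Y = 0.

Let al := W X X.
Let be := W X Y.
Let u := W X T.
Let v := W Y T.

Lemma hX_coord : [/\ dot (h X) n = 0, dot (h X) T = u, dot (h X) X = al &
  dot (h X) Y = be].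
Proof.
rewrite !(dotC (h X)) -!D2_hmul; split; rewrite //; try exact: WC.
  exact: (unit_defining_normal oOm bOm ud Bx Xn).
Qed.

Lemma hY_coord : [/\ dot (h Y) n = 0, dot (h Y) T = v, dot (h Y) X = be &
  dot (h Y) Y = - al].
Proof.
have gam : W Y Y = - al by apply/eqP; rewrite -addr_eq0 addrC; exact/eqP.
rewrite !(dotC (h Y)) -!D2_hmul; split; rewrite //; try exact: WC.
  exact: (unit_defining_normal oOm bOm ud Bx Yn).
Qed.

Lemma h_norms : dot (h X) (h X) + dot (h Y) (h Y) =
  2 * al ^+ 2 + 2 * be ^+ 2 + u ^+ 2 + v ^+ 2.
Proof.
have [x1 x2 x3 x4] := hX_coord; have [y1 y2 y3 y4] := hY_coord.
rewrite (frame (h X) (h X) n1) (frame (h Y) (h Y) n1) -/X -/Y -/T.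
by rewrite x1 x2 x3 x4 y1 y2 y3 y4; ring.
Qed.

(** Pairing [h Y] with [J (h X)] isolates [al], [be], because the components of
[h X] and [h Y] along [T] are carried by [J] to the normal, where both vanish. *)
Lemma h_cross : dot (h Y) (Jmap (h X)) = - (al ^+ 2 + be ^+ 2).
Proof.
have [x1 x2 x3 x4] := hX_coord; have [y1 y2 y3 y4] := hY_coord.
rewrite (frame (h Y) (Jmap (h X)) n1) -/X -/Y -/T !dotJl.
rewrite y1 y2 y3 y4 -/Y {2}/Y /T !JJ !dotNr x1 x3 x4.
by ring.
Qed.

(** The sum over [X] and [Y] of the relation for third derivatives; its right-hand
side is a multiple of the Levi form, which vanishes. *)
Lemma D3_flat : D3 sg x n X X + D3 sg x n Y Y =
  - (2 * al ^+ 2 + 2 * be ^+ 2 + u ^+ 2 + v ^+ 2).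
Proof.
have [c H] := unit_defining_third oOm bOm ud Bx.
have H1 := H X Xn; have H2 := H Y Yn.
rewrite -h_norms.
have : c * W X X + c * W Y Y = 0 by rewrite -mulrDr LX mulr0.
move: H1 H2; rewrite -/n -/(h X) -/(h Y) -/(W X X) -/(W Y Y).
by move: (D3 _ _ _ X _) (D3 _ _ _ Y _) (dot _ _) (dot _ _) (c * _) (c * _) => *; lra.
Qed.

Lemma sdist_h_values : hre dl x = 4^-1 * v /\ him dl x = - (4^-1 * u).
Proof.
have [-> ->] := sdist_hre Bx; rewrite hreE himE -/n -/X -/Y -/T.
rewrite -[D2 _ _ X n]/(W X n) -[D2 _ _ Y n]/(W Y n).
by rewrite (D2_tangent_normal Xn) (D2_tangent_normal Yn) add0r sub0r mulrN.
Qed.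

Lemma sdist_diff : (forall j, differentiable (pd j dl) x) /\
  (forall k l, differentiable (pd l (pd k dl)) x).
Proof.
have [nd d2 _ _ _] := sdist_regular oOm bOm ud Bx.
have [_ _ d1] := nbhs_singleton nd.
by split=> [j|k l]; [exact: d1|exact: d2].
Qed.

(** This replaces the distance by [sg] under one tangential derivative. The difference
[f - g] vanishes on the boundary. *)
Lemma tangential_eq f g w : differentiable f x -> differentiable g x ->
  (forall y, bdry Om y -> f y = g y) -> dot w n = 0 ->
  dot w (grad f x) = dot w (grad g x).
Proof.
move=> df dg fg wn; have [_ _ _ _ tv] := sdist_regular oOm bOm ud Bx.
have dN : differentiable (fun y => - g y) x by exact: differentiableN.
have : dot w (grad (fun y => f y + - g y) x) = 0.
  apply: tv => //; first exact: differentiableD.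
  by near=> y => By; rewrite fg // subrr.
rewrite grad_add //.
have -> : dot w (grad (fun y => - g y) x) = - dot w (grad g x).
  by rewrite -dotNr; congr dot; apply/rowP => k; rewrite !mxE pdN.
by move/eqP; rewrite subr_eq0 => /eqP.
Unshelve. all: by end_near. Qed.

(** The left-hand side is the expression in the definition of the second constant,
in real terms. On the boundary [hre] and [him] are the same for the distance and
for [sg], so their tangential derivatives may be computed with [sg]. The third
derivatives that appear combine into those of [D3_flat]; all terms containing [u],
[v] or the normal second derivative then cancel. *)
Lemma c2_value (hd := hmul dl x)
    (cR := 4^-1 *: (Amap (hd X) + Jmap (Amap (hd Y))))
    (dI := 4^-1 *: (Amap (hd Y) - Jmap (Amap (hd X)))) :
  - (2^-1 * (dot X (grad (hre dl) x) + dot Y (grad (him dl) x)))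
  + 2^-1 * (D2 dl x cR n - D2 dl x dI T) = 4^-1 * (al ^+ 2 + be ^+ 2).
Proof.
have hdX : hd X = h X by rewrite /hd (sdist_hmul _ Bx) -/n Xn scale0r subr0.
have hdY : hd Y = h Y by rewrite /hd (sdist_hmul _ Bx) -/n Yn scale0r subr0.
have [d1 d2] := sdist_diff.
have [e1 e2 _ _] := hre_him_diff d1 d2.
have s1 j : differentiable (pd j sg) x := ssg.2 [:: j] _ Ux.
have s2 k l : differentiable (pd l (pd k sg)) x := ssg.2 [:: l; k] _ Ux.
have [f1 f2 F1 F2] := hre_him_diff s1 s2.
rewrite (tangential_eq e1 f1 (fun y By => (sdist_hre By).1) Xn).
rewrite (tangential_eq e2 f2 (fun y By => (sdist_hre By).2) Yn).
have D2n a : D2 dl x a n = 0.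
  by rewrite D2_hmul (sdist_hmul _ Bx) -/n n1 scale1r subrr dot0r.
have D2T a : D2 dl x a T = W a T.
  by rewrite D2_hmul (sdist_hmul _ Bx) -/n dotJ scale0r subr0 -D2_hmul.
rewrite D2n D2T /dI /cR hdX hdY.
rewrite F1 F2 -/n -/X -/Y -/T -/(h X) -/(h Y).
have c12 a b w := @D3C12 _ U sg x a b w ssg Ux.
have c23 a b w := @D3C23 _ U sg x a b w ssg Ux.
rewrite (c12 X n X) (c12 Y n Y) (c23 Y T X) (c12 Y X T) (c23 X Y T).
have D3E := D3_flat; have hh := h_norms.
have q1 : D2 sg x (Amap (h X)) n = - al * W n n.
  by rewrite -[LHS]/(W _ n) D2_normal dotAl -/X; have [_ _ -> _] := hX_coord.
have q2 : D2 sg x (Jmap (Amap (h Y))) n = al * W n n.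
  by rewrite -[LHS]/(W _ n) D2_normal dotJAl -/X -/Y; have [_ _ _ ->] := hY_coord; rewrite opprK.
have q3 : D2 sg x X (h X) = dot (h X) (h X) by rewrite -[LHS]/(W _ _) WC /W D2_hmul.
have q4 : D2 sg x Y (h Y) = dot (h Y) (h Y) by rewrite -[LHS]/(W _ _) WC /W D2_hmul.
have q5 : D2 sg x Y (Jmap (h X)) = - (al ^+ 2 + be ^+ 2).
  by rewrite -[LHS]/(W _ _) WC /W D2_hmul dotC h_cross.
have q6 : D2 sg x X (Jmap (h Y)) = al ^+ 2 + be ^+ 2.
  by rewrite -[LHS]/(W _ _) WC /W D2_hmul dotJl h_cross opprK.
have q7 : W (4^-1 *: (Amap (h Y) - Jmap (Amap (h X)))) T =
   4^-1 * (D2 sg x (Amap (h Y)) T - D2 sg x (Jmap (Amap (h X))) T).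
  by rewrite /W !D2_hmul dotZl dotBl.
rewrite q1 q2 q3 q4 q5 q6 q7; move: D3E hh.
move: (D3 _ _ n X X) (D3 _ _ n Y Y) (D3 _ _ X T Y) (dot (h X) (h X)) (dot (h Y) (h Y)).
move: (D2 sg x (Amap (h Y)) T) (D2 sg x (Jmap (Amap (h X))) T) (W n n) al be u v.
by move=> A1 A2 A3 A4 A5 A6 A7 B1 B2 B3 B4 B5 E1 E2; lra.
Qed.

(** [boundary_inequality] with [w = b1 n + b2 T]. The terms in [u^2 + v^2] come from
the third derivatives; completing squares in [b1], [b2] turns them into the product
terms on the right-hand side. *)
Lemma flat_inequality rho psi (t : R) (phX := t * dot X (grad psi x))
    (phY := t * dot Y (grad psi x)) :
  smooth_defining Om rho -> smooth_on U psi ->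
  (forall y, U y -> rho y = sg y * expR (psi y)) ->
  psh Om (fun y => - ((- rho y) `^ t)) -> 0 < t < 1 ->
  t / (1 - t) * ((v + phX) ^+ 2 + (phY - u) ^+ 2)
    + t * (D2 psi x X X + D2 psi x Y Y) <=
  2 * (al ^+ 2 + be ^+ 2) + 2 * ((v + phX) * v - (phY - u) * u).
Proof.
move=> drho spsi rhoE P /andP[t0 t1].
pose d1 := v + phX; pose d2 := phY - u.
have t10 : 0 < 1 - t by rewrite subr_gt0.
pose b1 := - d1 / (1 - t); pose b2 := d2 / (1 - t).
have := boundary_inequality (b1 *: n + b2 *: T) oOm bOm drho ud spsi rhoE P t0 Bx Xn Yn LX.
rewrite -/n -/Y D3_flat !Jmap_add !JmapZ -/T {3 4}/T JJ.
have -> : D2 sg x X (b1 *: n + b2 *: T) = b2 * u.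
  rewrite D2_hmul hmulD !hmulZ dotDr !dotZr -!D2_hmul.
  by rewrite [D2 _ _ X n](D2_tangent_normal Xn) mulr0 add0r.
have -> : D2 sg x Y (b1 *: T + b2 *: - n) = b1 * v.
  rewrite D2_hmul hmulD !hmulZ hmulN dotDr !dotZr dotNr -!D2_hmul.
  by rewrite [D2 _ _ Y n](D2_tangent_normal Yn) oppr0 mulr0 addr0.
have -> : dot (b1 *: n + b2 *: T) n = b1.
  by rewrite dotDl !dotZl n1 dotJ mulr1 mulr0 addr0.
have -> : dot (b1 *: T + b2 *: - n) n = - b2.
  by rewrite dotDl !dotZl dotNl n1 dotJ mulr0 add0r mulrN1.
exact: flat_algebra.
Qed.

End LeviFlatPoint.

(** * Complex fields through their real and imaginary parts *)

Section RealImaginaryParts.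
Context {R : realType}.
Implicit Types (f g rho psi : pt R -> R) (x y v w a b : pt R) (i j k : 'I_4).
Implicit Types (Z W : cvec R) (F : pt R -> R[i]) (c d : R[i]).

Lemma Re_add c d : complex.Re (c + d) = complex.Re c + complex.Re d.
Proof. by case: c; case: d. Qed.

Lemma Im_add c d : complex.Im (c + d) = complex.Im c + complex.Im d.
Proof. by case: c; case: d. Qed.

Lemma Re_opp c : complex.Re (- c) = - complex.Re c.
Proof. by case: c. Qed.

Lemma Re_mul c d : complex.Re (c * d) =
  complex.Re c * complex.Re d - complex.Im c * complex.Im d.
Proof. by case: c; case: d. Qed.

Lemma Im_mul c d : complex.Im (c * d) =
  complex.Re c * complex.Im d + complex.Im c * complex.Re d.
Proof. by case: c; case: d. Qed.

Lemma Re_conj c : complex.Re (conjc c) = complex.Re c.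
Proof. by case: c. Qed.

Lemma Im_conj c : complex.Im (conjc c) = - complex.Im c.
Proof. by case: c. Qed.

Lemma Re_sum (G : 'I_4 -> R[i]) :
  complex.Re (\sum_(k < 4) G k) = \sum_(k < 4) complex.Re (G k).
Proof. by apply: (big_morph _ Re_add). Qed.

Lemma Im_sum (G : 'I_4 -> R[i]) :
  complex.Im (\sum_(k < 4) G k) = \sum_(k < 4) complex.Im (G k).
Proof. by apply: (big_morph _ Im_add). Qed.

Lemma cmod_sqr c : cmod c ^+ 2 = complex.Re c ^+ 2 + complex.Im c ^+ 2.
Proof. by case: c => a b; rewrite /cmod /= sqr_sqrtr // addr_ge0 // sqr_ge0. Qed.

Lemma cmod_ge0 c : 0 <= cmod c.
Proof. by case: c => a b; rewrite /cmod /= sqrtr_ge0. Qed.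

(** A complexified tangent vector is handled through the two real vectors [reV Z]
and [imV Z], so that complex derivatives become pairings with real gradients. *)
Definition reV Z : pt R := \row_k complex.Re (Z 0 k).
Definition imV Z : pt R := \row_k complex.Im (Z 0 k).

Lemma reV_conj Z : reV (vconj Z) = reV Z.
Proof. by apply/rowP => k; rewrite !mxE Re_conj. Qed.

Lemma imV_conj Z : imV (vconj Z) = - imV Z.
Proof. by apply/rowP => k; rewrite !mxE Im_conj. Qed.

Lemma Re_vder Z F x : complex.Re (vder Z F x) =
  dot (reV Z) (grad (fun y => complex.Re (F y)) x)
  - dot (imV Z) (grad (fun y => complex.Im (F y)) x).
Proof.
rewrite /vder Re_sum /dot -sumrB; apply: eq_bigr => k _.
by rewrite Re_mul !mxE.
Qed.

Lemma Im_vder Z F x : complex.Im (vder Z F x) =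
  dot (reV Z) (grad (fun y => complex.Im (F y)) x)
  + dot (imV Z) (grad (fun y => complex.Re (F y)) x).
Proof.
rewrite /vder Im_sum /dot -big_split; apply: eq_bigr => k _.
by rewrite Im_mul !mxE.
Qed.

Lemma grad_cst0 (c : R) x : grad (fun=> c) x = 0.
Proof. by apply/rowP => k; rewrite !mxE pd_cst. Qed.

Lemma vder_real Z f x : vder Z (fun y => (f y)%:C%C) x =
  Complex (dot (reV Z) (grad f x)) (dot (imV Z) (grad f x)).
Proof.
apply/eqP; rewrite eq_complex Re_vder Im_vder /= !grad_cst0 !dot0r.
by rewrite subr0 add0r !eqxx.
Qed.

Lemma Re_gdot Z W : complex.Re (gdot Z W) = dot (reV Z) (reV W) + dot (imV Z) (imV W).
Proof.
rewrite /gdot Re_sum /dot -big_split; apply: eq_bigr => k _.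
by rewrite Re_mul Re_conj Im_conj mulrN opprK !mxE.
Qed.

Lemma Im_gdot Z W : complex.Im (gdot Z W) = dot (imV Z) (reV W) - dot (reV Z) (imV W).
Proof.
rewrite /gdot Im_sum /dot -sumrB; apply: eq_bigr => k _.
by rewrite Im_mul Re_conj Im_conj mulrN addrC !mxE.
Qed.

Lemma nabla_rgrad (Z : vfield R) f x :
  reV (nabla Z (rgrad f) x) = hmul f x (reV (Z x)) /\
  imV (nabla Z (rgrad f) x) = hmul f x (imV (Z x)).
Proof.
have E k : nabla Z (rgrad f) x 0 k = vder (Z x) (fun y => (pd k f y)%:C%C) x.
  have G : (fun y => rgrad f y 0 k) = (fun y => (pd k f y)%:C%C).
    by apply/funext => y; rewrite [LHS]mxE.
  by rewrite [LHS]mxE G.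
by split; apply/rowP => k; rewrite [LHS]mxE E vder_real [RHS]mxE.
Qed.

Lemma Re_Hess f (Z W : vfield R) x : complex.Re (Hess f Z W x) =
  D2 f x (reV (W x)) (reV (Z x)) + D2 f x (imV (W x)) (imV (Z x)).
Proof.
by rewrite /Hess Re_gdot; have [-> ->] := nabla_rgrad Z f x; rewrite !D2_hmul !(dotC (hmul _ _ _)).
Qed.

Lemma Im_Hess f (Z W : vfield R) x : complex.Im (Hess f Z W x) =
  D2 f x (reV (W x)) (imV (Z x)) - D2 f x (imV (W x)) (reV (Z x)).
Proof.
by rewrite /Hess Im_gdot; have [-> ->] := nabla_rgrad Z f x; rewrite !D2_hmul !(dotC (hmul _ _ _)).
Qed.

End RealImaginaryParts.

Section UnitFrame.
Context {R : realType}.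
Implicit Types (f g rho psi : pt R -> R) (x y v w a b : pt R) (i j k : 'I_4).
Variable Om : set (pt R).
Let dl := sdist Om.

Lemma cvec_parts (Z : cvec R) a b : Z 0 0 = Complex (a 0 0) (b 0 0) ->
  Z 0 1 = Complex (a 0 1) (b 0 1) -> Z 0 2%:R = Complex (a 0 2%:R) (b 0 2%:R) ->
  Z 0 3%:R = Complex (a 0 3%:R) (b 0 3%:R) -> reV Z = a /\ imV Z = b.
Proof. by move=> h0 h1 h2 h3; split; apply: row4P; rewrite mxE ?h0 ?h1 ?h2 ?h3. Qed.

Lemma half_complex : 2^-1 = Complex 2^-1 0 :> R[i].
Proof. by rewrite -[RHS]/((2^-1)%:C%C) fmorphV rmorph_nat. Qed.

Let wirtinger_entry i j k :
  (2^-1 *: (delta_mx 0 i - Complex 0 1 *: delta_mx 0 j) : cvec R) 0 k =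
  Complex (2^-1 * (k == i)%:R) (- (2^-1 * (k == j)%:R)).
Proof.
rewrite half_complex 2!mxE [delta_mx 0 i _ _]mxE 2!mxE [delta_mx 0 j _ _]mxE !eqxx /=.
case: (k == i); case: (k == j); apply/eqP; rewrite eq_complex /= -?[1%:R]/(Complex 1 0) -?[0%:R]/(Complex 0 0) /=.
all: by apply/andP; split; apply/eqP; ring.
Qed.

Lemma dzE : (dz R 0 0 = Complex 2^-1 0) * (dz R 0 1 = Complex 0 (- 2^-1)) *
  (dz R 0 2%:R = 0) * (dz R 0 3%:R = 0).
Proof. by rewrite /dz !wirtinger_entry /= !mulr0 !mulr1 oppr0. Qed.

Lemma dwE : (dw R 0 0 = 0) * (dw R 0 1 = 0) *
  (dw R 0 2%:R = Complex 2^-1 0) * (dw R 0 3%:R = Complex 0 (- 2^-1)).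
Proof. by rewrite /dw !wirtinger_entry /= !mulr0 !mulr1 oppr0. Qed.

(** [D] and [E] stand for [dz] and [dw]; the imaginary part is [- J] of the real
part, as for every vector of type (1,0). *)
Let combination_parts (D E : cvec R) (A B : R[i]) (q : pt R) :
  D 0 0 = Complex 2^-1 0 -> D 0 1 = Complex 0 (- 2^-1) -> D 0 2%:R = 0 -> D 0 3%:R = 0 ->
  E 0 0 = 0 -> E 0 1 = 0 -> E 0 2%:R = Complex 2^-1 0 -> E 0 3%:R = Complex 0 (- 2^-1) ->
  A = Complex (q 0 0) (q 0 1) -> B = Complex (q 0 2%:R) (q 0 3%:R) ->
  reV (2%:C%C *: (A *: D + B *: E)) = q /\ imV (2%:C%C *: (A *: D + B *: E)) = - Jmap q.
Proof.
move=> d0 d1 d2 d3 e0 e1 e2 e3 -> ->.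
have entry k : (2%:C%C *: (Complex (q 0 0) (q 0 1) *: D + Complex (q 0 2%:R) (q 0 3%:R) *: E)) 0 k =
    2%:C%C * (Complex (q 0 0) (q 0 1) * D 0 k + Complex (q 0 2%:R) (q 0 3%:R) * E 0 k).
  by do 4!rewrite mxE.
apply: cvec_parts; rewrite entry ?d0 ?d1 ?d2 ?d3 ?e0 ?e1 ?e2 ?e3 ?mulr0 ?addr0 ?add0r
  [(- Jmap q) _ _]mxE JmapE.
all: move: (q 0 0) (q 0 1) (q 0 2%:R) (q 0 3%:R) => a b c d.
all: by apply/eqP; rewrite eq_complex /=; apply/andP; split; apply/eqP; field.
Qed.

Let combination_partsN (D E : cvec R) (A B : R[i]) (q : pt R) :
  D 0 0 = Complex 2^-1 0 -> D 0 1 = Complex 0 (- 2^-1) -> D 0 2%:R = 0 -> D 0 3%:R = 0 ->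
  E 0 0 = 0 -> E 0 1 = 0 -> E 0 2%:R = Complex 2^-1 0 -> E 0 3%:R = Complex 0 (- 2^-1) ->
  A = Complex (q 0 0) (q 0 1) -> B = Complex (- q 0 2%:R) (- q 0 3%:R) ->
  reV (2%:C%C *: (A *: D - B *: E)) = q /\ imV (2%:C%C *: (A *: D - B *: E)) = - Jmap q.
Proof.
move=> d0 d1 d2 d3 e0 e1 e2 e3 hA hB; rewrite -scaleNr; apply: combination_parts => //.
by rewrite hB; apply/eqP; rewrite eq_complex /= !opprK !eqxx.
Qed.

Definition frame_combination A B (q : pt R) := @combination_parts (dz R) (dw R) A B q
  dzE.1.1.1 dzE.1.1.2 dzE.1.2 dzE.2 dwE.1.1.1 dwE.1.1.2 dwE.1.2 dwE.2.
Definition frame_combinationN A B (q : pt R) := @combination_partsN (dz R) (dw R) A B q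
  dzE.1.1.1 dzE.1.1.2 dzE.1.2 dzE.2 dwE.1.1.1 dwE.1.1.2 dwE.1.2 dwE.2.

Lemma dz_parts : reV (dz R) = 2^-1 *: delta_mx 0 0 /\ imV (dz R) = - (2^-1 *: delta_mx 0 1).
Proof. by apply: cvec_parts; rewrite dzE !mxE /= ?mulr0 ?mulr1 ?oppr0. Qed.

Lemma dw_parts : reV (dw R) = 2^-1 *: delta_mx 0 2%:R /\ imV (dw R) = - (2^-1 *: delta_mx 0 3%:R).
Proof. by apply: cvec_parts; rewrite dwE !mxE /= ?mulr0 ?mulr1 ?oppr0. Qed.

Section Unit.
Variable y : pt R.
Let p := grad dl y.

Lemma vder_dz : vder (dz R) (sdistC Om) y = Complex (2^-1 * p 0 0) (- (2^-1 * p 0 1)).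
Proof.
by rewrite vder_real; have [-> ->] := dz_parts; rewrite dotNl !dotZl !dot_delta.
Qed.

Lemma vder_dw : vder (dw R) (sdistC Om) y = Complex (2^-1 * p 0 2%:R) (- (2^-1 * p 0 3%:R)).
Proof.
by rewrite vder_real; have [-> ->] := dw_parts; rewrite dotNl !dotZl !dot_delta.
Qed.

Lemma vder_dzbar : vder (vconj (dz R)) (sdistC Om) y = Complex (2^-1 * p 0 0) (2^-1 * p 0 1).
Proof.
rewrite vder_real reV_conj imV_conj; have [-> ->] := dz_parts.
by rewrite opprK !dotZl !dot_delta.
Qed.

Lemma vder_dwbar : vder (vconj (dw R)) (sdistC Om) y = Complex (2^-1 * p 0 2%:R) (2^-1 * p 0 3%:R).
Proof.
rewrite vder_real reV_conj imV_conj; have [-> ->] := dw_parts.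
by rewrite opprK !dotZl !dot_delta.
Qed.

Hypothesis p1 : dot p p = 1.

Let half_sqr (A B : R[i]) : A = Complex (2^-1 * p 0 0) (- (2^-1 * p 0 1)) ->
  B = Complex (2^-1 * p 0 2%:R) (- (2^-1 * p 0 3%:R)) ->
  Num.sqrt (cmod A ^+ 2 + cmod B ^+ 2) = 2^-1.
Proof.
move=> -> ->; have := p1; rewrite dotE !cmod_sqr /=.
move: (p 0 0) (p 0 1) (p 0 2%:R) (p 0 3%:R) => a b c d E.
have -> : (2^-1 * a) ^+ 2 + (- (2^-1 * b)) ^+ 2 + ((2^-1 * c) ^+ 2 + (- (2^-1 * d)) ^+ 2) =
    (2^-1) ^+ 2 by rewrite -[RHS]mulr1 -E; ring.
by rewrite sqrtr_sqr ger0_norm.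
Qed.

Lemma dnorm_half : dnorm Om y = 2^-1.
Proof. exact: half_sqr vder_dz vder_dw. Qed.

Lemma Lf_parts : reV (Lf Om y) = 2^-1 *: Amap p /\ imV (Lf Om y) = - Jmap (2^-1 *: Amap p).
Proof.
rewrite /Lf dnorm_half invrK; apply: frame_combinationN.
  by rewrite ![(2^-1 *: _ : pt R) _ _]mxE !AmapE mulrN; exact: vder_dw.
by rewrite ![(2^-1 *: _ : pt R) _ _]mxE !AmapE mulrN opprK; exact: vder_dz.
Qed.

Lemma Nf_parts : reV (Nf Om y) = 2^-1 *: p /\ imV (Nf Om y) = - Jmap (2^-1 *: p).
Proof.
rewrite /Nf dnorm_half invrK; apply: frame_combination.
  by rewrite ![(2^-1 *: _ : pt R) _ _]mxE; exact: vder_dzbar.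
by rewrite ![(2^-1 *: _ : pt R) _ _]mxE; exact: vder_dwbar.
Qed.
End Unit.
End UnitFrame.

(** * The complex quantities at a boundary point *)

Section BoundaryQuantities.
Context {R : realType}.
Implicit Types (f g rho psi : pt R -> R) (x y v w a b : pt R) (i j k : 'I_4).

Lemma D2_half f y a b : D2 f y (2^-1 *: a) (2^-1 *: b) = 4^-1 * D2 f y a b.
Proof. by rewrite !D2_hmul hmulZ dotZl dotZr mulrA; congr (_ * _); field. Qed.

Lemma D2_opp f y a b : (D2 f y (- a) b = - D2 f y a b) * (D2 f y a (- b) = - D2 f y a b).
Proof. by rewrite !D2_hmul hmulN dotNl dotNr. Qed.

Context (Om U : set (pt R)) (sg : pt R -> R) (oOm : open Om) (bOm : bounded_set Om)
  (ud : unit_defining Om U sg).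

Let dl := sdist Om.

(** Valid wherever the distance has unit gradient, hence near the boundary, so that
it can be differentiated. *)
Lemma HNL_parts y : dot (grad dl y) (grad dl y) = 1 ->
  HNL Om y = Complex (hre dl y) (him dl y).
Proof.
move=> p1; have [l1 l2] := Lf_parts p1; have [n1 n2] := Nf_parts p1.
apply/eqP; rewrite eq_complex /HNL Re_Hess Im_Hess l1 l2 n1 n2 /=.
rewrite !D2_opp opprK !JmapZ -/dl !D2_half hreE himE.
by rewrite mulrDr mulrBr opprK addrC eqxx addrC eqxx.
Qed.

Section Point.
Variables (x : pt R).
Hypothesis Bx : bdry Om x.
Let n := grad sg x.
Let X := Amap n.
Let Y := Jmap X.
Let T := Jmap n.

Lemma near_unit : \forall y \near x, dot (grad dl y) (grad dl y) = 1.
Proof.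
have [nd _ _ _ _] := sdist_regular oOm bOm ud Bx.
by apply: filterS nd => y [].
Qed.

Let gE : grad dl x = n.
Proof. by have [_ _ gE _ _] := sdist_regular oOm bOm ud Bx. Qed.

Let px1 : dot (grad dl x) (grad dl x) = 1.
Proof. exact: nbhs_singleton near_unit. Qed.

Lemma Lf_at : reV (Lf Om x) = 2^-1 *: X /\ imV (Lf Om x) = - (2^-1 *: Y).
Proof. by have [-> ->] := Lf_parts px1; rewrite -/dl gE JmapZ. Qed.

Lemma Nf_at : reV (Nf Om x) = 2^-1 *: n /\ imV (Nf Om x) = - (2^-1 *: T).
Proof. by have [-> ->] := Nf_parts px1; rewrite -/dl gE JmapZ. Qed.

Lemma Hess_LL f : complex.Re (Hess f (Lf Om) (Lf Om) x) =
  4^-1 * (D2 f x X X + D2 f x Y Y).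
Proof.
rewrite Re_Hess; have [-> ->] := Lf_at.
by rewrite !D2_opp opprK !D2_half mulrDr.
Qed.

Lemma Re_Lf_HNL : complex.Re (vder (Lf Om x) (HNL Om) x) =
  2^-1 * (dot X (grad (hre dl) x) + dot Y (grad (him dl) x)).
Proof.
rewrite Re_vder; have [-> ->] := Lf_at.
have -> : grad (fun y => complex.Re (HNL Om y)) x = grad (hre dl) x.
  by apply: near_grad; apply: filterS near_unit => y p1; rewrite (HNL_parts p1).
have -> : grad (fun y => complex.Im (HNL Om y)) x = grad (him dl) x.
  by apply: near_grad; apply: filterS near_unit => y p1; rewrite (HNL_parts p1).
by rewrite dotNl opprK !dotZl mulrDr.
Qed.

(** [L] is a linear image of the gradient of the distance, so differentiating it
inserts the Hessian. *)
Lemma nabla_LbarL (hd := hmul dl x) (D := nabla (fconj (Lf Om)) (Lf Om) x) :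
  reV D = 4^-1 *: (Amap (hd X) + Jmap (Amap (hd Y))) /\
  imV D = 4^-1 *: (Amap (hd Y) - Jmap (Amap (hd X))).
Proof.
have [d1 _] := sdist_diff oOm bOm ud Bx.
pose p k y := (grad dl y *m Amx) 0 k; pose q k y := (grad dl y *m (Amx *m Jmx)) 0 k.
have [dp gp] : (forall k, differentiable (p k) x) /\
    forall k v, dot v (grad (p k) x) = Amap (hd v) 0 k.
  by split=> k; have [h1 h2] := linear_coord_diff Amx k d1 => // v; rewrite h2 mulAmx.
have [dq gq] : (forall k, differentiable (q k) x) /\
    forall k v, dot v (grad (q k) x) = Jmap (Amap (hd v)) 0 k.
  by split=> k; have [h1 h2] := linear_coord_diff (Amx *m Jmx) k d1 => // v; rewrite h2 mulAJmx.
have gR k v : dot v (grad (fun y => complex.Re (Lf Om y 0 k)) x) = 2^-1 * Amap (hd v) 0 k.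
  rewrite -gp -dotZr; congr dot; rewrite (_ : grad _ _ = grad (fun y => 2^-1 * p k y) x).
    by apply/rowP => m; rewrite !mxE pdZ.
  apply: near_grad; near=> y.
  have [E _] : reV (Lf Om y) = 2^-1 *: Amap (grad dl y) /\
      imV (Lf Om y) = - Jmap (2^-1 *: Amap (grad dl y)).
    by apply: Lf_parts; near: y; exact: near_unit.
  move/rowP/(_ k) : E; rewrite [LHS]mxE => ->.
  by rewrite [LHS]mxE /p mulAmx.
have gI k v : dot v (grad (fun y => complex.Im (Lf Om y 0 k)) x) = - 2^-1 * Jmap (Amap (hd v)) 0 k.
  rewrite -gq -dotZr; congr dot; rewrite (_ : grad _ _ = grad (fun y => - 2^-1 * q k y) x).
    by apply/rowP => m; rewrite !mxE pdZ.
  apply: near_grad; near=> y.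
  have [_ E] : reV (Lf Om y) = 2^-1 *: Amap (grad dl y) /\
      imV (Lf Om y) = - Jmap (2^-1 *: Amap (grad dl y)).
    by apply: Lf_parts; near: y; exact: near_unit.
  move/rowP/(_ k) : E; rewrite [LHS]mxE => ->.
  by rewrite JmapZ 2!mxE /q mulAJmx mulNr.
have [l1 l2] := Lf_at.
have E k : D 0 k = vder (fconj (Lf Om) x) (fun y => Lf Om y 0 k) x by rewrite /D [LHS]mxE.
split; apply/rowP => k; rewrite [LHS]mxE E.
- rewrite Re_vder reV_conj imV_conj l1 l2 opprK !dotZl gR gI [RHS]mxE [_ 0 k in RHS]mxE.
  by move: (Amap (hd X) 0 k) (Jmap (Amap (hd Y)) 0 k) => A B; field.
- rewrite Im_vder reV_conj imV_conj l1 l2 opprK !dotZl gR gI [RHS]mxE [(_ - _ : pt R) 0 k in RHS]mxE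
    [(- _ : pt R) 0 k in RHS]mxE.
  by move: (Amap (hd Y) 0 k) (Jmap (Amap (hd X)) 0 k) => A B; field.
Unshelve. all: by end_near. Qed.

(** Both [Hess_delta (N, L)] and [Lbar psi / 2] carry a factor [1/4] in real terms,
whence the factors 16. *)
Lemma cmod_HNL_denom psi (W := D2 sg x) : W X X + W Y Y = 0 ->
  16 * cmod (HNL Om x) ^+ 2 = W X T ^+ 2 + W Y T ^+ 2 /\
  16 * denom Om psi x ^+ 2 = (W Y T + dot X (grad psi x)) ^+ 2 +
     (dot Y (grad psi x) - W X T) ^+ 2.
Proof.
move=> LX; have [h1 h2] := sdist_h_values oOm bOm ud Bx.
rewrite /denom !cmod_sqr Re_add Im_add Re_mul Im_mul half_complex HNL_parts //=.
rewrite vder_real /= reV_conj imV_conj; have [-> ->] := Lf_at.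
rewrite opprK !dotZl -/dl h1 h2 -/X -/Y -/T -/(W X T) -/(W Y T).
move: (W X T) (W Y T) (dot X _) (dot Y _) => A B C D.
by split; field.
Qed.

Lemma Levi_flat_second : D2 sg x X X + D2 sg x Y Y = 0 ->
  complex.Re (- vder (Lf Om x) (HNL Om) x
    + Hess (sdist Om) (Nf Om) (nabla (fconj (Lf Om)) (Lf Om)) x) =
  4^-1 * (D2 sg x X X ^+ 2 + D2 sg x X Y ^+ 2).
Proof.
move=> LX; rewrite Re_add Re_opp Re_Lf_HNL Re_Hess.
have [-> ->] := nabla_LbarL; have [-> ->] := Nf_at.
rewrite -(c2_value oOm bOm ud Bx LX) -/n -/X -/Y -/T; congr (_ + _).
by rewrite !D2_opp !D2_hmul !hmulZ !dotZr -mulrBr.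
Qed.

End Point.
End BoundaryQuantities.

(** * Suprema over the Levi-flat set *)

Section SupremaOnLeviFlat.
Context {R : realType}.
Implicit Types (f g rho psi : pt R -> R) (x y v w a b : pt R) (i j k : 'I_4).

(** All terms of the Leibniz rule but one contain [f x] or the derivative of [f]
along [a]. *)
Lemma D2_mul_vanishing V f g x a : smooth_on V f -> smooth_on V g -> V x ->
  f x = 0 -> dot a (grad f x) = 0 ->
  D2 (fun y => f y * g y) x a a = g x * D2 f x a a.
Proof.
move=> sf sg Vx fx0 fa.
have nV : \forall y \near x, V y by apply: open_nbhs_nbhs; split=> //; exact: sf.1.
have s1 (h : pt R -> R) y : smooth_on V h -> V y -> differentiable h y.
  by move=> sh; exact: (sh.2 [::]).
have s2 (h : pt R -> R) k y : smooth_on V h -> V y -> differentiable (pd k h) y.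
  by move=> sh; exact: (sh.2 [:: k]).
have E k l : pd l (pd k (fun y => f y * g y)) x =
    pd l f x * pd k g x + pd k f x * pd l g x + g x * pd l (pd k f) x.
  rewrite -(@near_pd _ (fun y => f y * pd k g y + g y * pd k f y)); last first.
    move: nV; apply: filterS => y Vy; rewrite (pdM k (s1 _ _ sf Vy) (s1 _ _ sg Vy)).
    by move: (pd k f y) (pd k g y) (f y) (g y) => A B C D; ring.
  have m1 := differentiableM (s1 _ _ sf Vx) (s2 _ k _ sg Vx).
  have m2 := differentiableM (s1 _ _ sg Vx) (s2 _ k _ sf Vx).
  rewrite (pdD l m1 m2) (pdM l (s1 _ _ sf Vx) (s2 _ k _ sg Vx)).
  rewrite (pdM l (s1 _ _ sg Vx) (s2 _ k _ sf Vx)) fx0.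
  move: (pd l f x) (pd k g x) (pd k f x) (pd l g x) (pd l (pd k f) x) (pd l (pd k g) x) (g x).
  by move=> A B C D F G H; ring.
transitivity (dot a (grad f x) * dot a (grad g x) + dot a (grad g x) * dot a (grad f x)
    + g x * D2 f x a a); last by rewrite fa mulr0 !mul0r !add0r.
rewrite {1 3}/dot !D2E !mulr_suml !mulr_sumr -!big_split /=; apply: eq_bigr => k _.
rewrite /dot !mulr_sumr -!big_split /=; apply: eq_bigr => l _.
rewrite E [grad f x 0 k]mxE [grad f x 0 l]mxE [grad g x 0 k]mxE [grad g x 0 l]mxE.
move: (pd l f x) (pd k g x) (pd k f x) (pd l g x) (pd l (pd k f) x) (g x) (a 0 k) (a 0 l).
by move=> A B C D F G H I; ring.
Qed.

Lemma D2_scale V f (t : R) x a b : smooth_on V f -> V x ->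
  D2 (fun y => t * f y) x a b = t * D2 f x a b.
Proof.
move=> sf Vx; rewrite !D2E mulr_sumr; apply: eq_bigr => k _.
rewrite mulr_sumr; apply: eq_bigr => l _.
have nV : \forall y \near x, V y by apply: open_nbhs_nbhs; split=> //; exact: sf.1.
have -> : pd l (pd k (fun y => t * f y)) x = t * pd l (pd k f) x; last first.
  by move: (a 0 k) (b 0 l) (pd l (pd k f) x) => A B C; ring.
rewrite -(pdZ t l (sf.2 [:: k] _ Vx)); apply: near_pd.
by move: nV; apply: filterS => y Vy; rewrite pdZ //; exact: (sf.2 [::]).
Qed.

Lemma grad_scale f (t : R) x a : differentiable f x ->
  dot a (grad (fun y => t * f y) x) = t * dot a (grad f x).
Proof.
by move=> df; rewrite -dotZr; congr dot; apply/rowP => k; rewrite !mxE pdZ.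
Qed.

Lemma max_on_ge (S : set (pt R)) f (M : R) x : (forall y, S y -> f y <= M) -> S x ->
  f x <= max_on S f.
Proof.
by move=> fM Sx; apply: ub_le_sup; [exists M => _ [y Sy <-]; exact: fM|exists x].
Qed.

Lemma max_on_ge0 (S : set (pt R)) f : (forall x, 0 <= f x) -> 0 <= max_on S f.
Proof.
move=> f0; have [[[_ [x Sx _]] ub]|ns] := pselect (has_sup [set f x | x in S]).
  by apply: le_trans (f0 x) (ub_le_sup ub _); exists x.
by rewrite /max_on sup_out.
Qed.

Context (Om U : set (pt R)) (sg : pt R -> R) (oOm : open Om) (bOm : bounded_set Om)
  (ud : unit_defining Om U sg).

(** The defining function [rho] of the Levi-flat condition is arbitrary. At a
boundary point its complex Hessian on the complex tangent line is a positive
multiple of that of its own normalization, and all normalizations have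
there the same tangential second derivatives as the signed distance. *)
Lemma Levi_flat_trace x (X := Amap (grad sg x)) : Levi_flat Om x ->
  bdry Om x /\ D2 sg x X X + D2 sg x (Jmap X) (Jmap X) = 0.
Proof.
move=> [Bx [rho drho lf]]; split=> //.
have [V [s [psi [us spsi rhoE]]]] := unit_defining_exists drho.
have [BV ss _ Hb] := us; have [s0 _] := Hb x Bx; have Vx := BV x Bx.
have [_ _ g1 _ _] := sdist_regular oOm bOm ud Bx.
have [_ _ g2 _ _] := sdist_regular oOm bOm us Bx.
have nV : \forall y \near x, V y by apply: open_nbhs_nbhs; split=> //; exact: ss.1.
have E v : dot v (grad sg x) = 0 -> D2 rho x v v = expR (psi x) * D2 sg x v v.
  move=> vn; have vn' : dot v (grad s x) = 0 by rewrite -g2 g1.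
  rewrite -(sdist_D2 oOm bOm ud v Bx vn) (sdist_D2 oOm bOm us v Bx vn').
  rewrite -(D2_mul_vanishing ss (smooth_exp spsi) Vx s0 vn').
  by apply: near_D2; move: nV; apply: filterS => y /rhoE.
have := lf; rewrite /Levi_form (Hess_LL oOm bOm ud Bx) -/X !E ?dotA ?dotJA // -mulrDr.
move/eqP; rewrite !mulf_eq0 gt_eqF ?invr_gt0 //= gt_eqF ?expR_gt0 //=.
by move/eqP.
Qed.

(** Suprema over the Levi-flat set are bounded by maxima over the boundary, which is
compact. *)
Lemma bdry_upper_bound f : (forall y, U y -> differentiable f y) -> bdry Om !=set0 ->
  exists M, forall y, bdry Om y -> f y <= M.
Proof.
move=> df B0; have [BU _ _ _] := ud.
have cf : {within bdry Om, continuous f}.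
  apply: continuous_in_subspaceT => y /set_mem By.
  by apply: differentiable_continuous; apply: df; exact: BU.
have [c _ Hc] := EVT_max_rV B0 (bdry_compact bOm) cf.
by exists (f c) => y By; apply: Hc; exact/mem_set.
Qed.

Lemma gradform_smooth B C y : U y -> differentiable (gradform B C sg) y.
Proof.
move=> Uy; have [_ ssg _ _] := ud.
by have [] := gradform_diff B C (fun j => ssg.2 [:: j] y Uy) (fun k l => ssg.2 [:: l; k] y Uy).
Qed.

Let differentiable_sqr f y : differentiable f y -> differentiable (fun z => f z ^+ 2) y.
Proof. by move=> df; exact: (differentiableM df df). Qed.

(** On the Levi-flat set the maximised expression equals a polynomial in second
derivatives of [sg], which is continuous on the boundary. *)
Lemma constC2_ge x (X := Amap (grad sg x)) : Levi_flat Om x ->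
  8^-1 * (D2 sg x X X ^+ 2 + D2 sg x X (Jmap X) ^+ 2) <= constC2 Om.
Proof.
move=> Lx; pose f y := 4^-1 * (gradform Amx Amx sg y ^+ 2 + gradform Amx (Amx *m Jmx) sg y ^+ 2).
have fE y (Z := Amap (grad sg y)) : f y = 4^-1 * (D2 sg y Z Z ^+ 2 + D2 sg y Z (Jmap Z) ^+ 2).
  by rewrite /f /gradform mulAJmx mulAmx.
have df y : U y -> differentiable f y.
  move=> Uy; apply: differentiableM; first exact: differentiable_cst.
  by apply: differentiableD; apply: differentiable_sqr; exact: gradform_smooth.
have [Bx _] := Levi_flat_trace Lx.
have [M HM] := bdry_upper_bound df (ex_intro _ x Bx).
pose F y := complex.Re (- vder (Lf Om y) (HNL Om) y
        + Hess (sdist Om) (Nf Om) (nabla (fconj (Lf Om)) (Lf Om)) y).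
have FE y : Levi_flat Om y -> F y = f y.
  move=> Ly; have [By LX] := Levi_flat_trace Ly; rewrite fE.
  exact: (Levi_flat_second oOm bOm ud By LX).
have := @max_on_ge (Levi_flat Om) F M x.
rewrite FE // fE -/X => H.
have -> : constC2 Om = 2^-1 * max_on (Levi_flat Om) F by [].
apply: le_trans (ler_wpM2l _ (H _ Lx)).
- by rewrite mulrA ler_wpM2r ?addr_ge0 ?sqr_ge0 // le_eqVlt; apply/orP; left; apply/eqP; field.
- by [].
- by move=> y Ly; rewrite FE //; apply: HM; have [] := Levi_flat_trace Ly.
Qed.

Lemma constC_ge0 : 0 <= constC Om.
Proof.
by rewrite /constC le_max; apply/orP; left; apply: max_on_ge0 => y; exact: cmod_ge0.
Qed.

Lemma constC1_ge x : Levi_flat Om x -> 2 * cmod (HNL Om x) <= constC1 Om.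
Proof.
move=> Lx; pose f y := gradform Amx Jmx sg y ^+ 2 + gradform (Amx *m Jmx) Jmx sg y ^+ 2.
have df y : U y -> differentiable f y.
  by move=> Uy; apply: differentiableD; apply: differentiable_sqr; exact: gradform_smooth.
have [Bx _] := Levi_flat_trace Lx.
have [M HM] := bdry_upper_bound df (ex_intro _ x Bx).
have H : cmod (HNL Om x) <= max_on (Levi_flat Om) (fun y => cmod (HNL Om y)).
  apply: (@max_on_ge _ (fun y => cmod (HNL Om y)) (M + 1)) => // y Ly.
  have [By LX] := Levi_flat_trace Ly.
  have [E _] := cmod_HNL_denom oOm bOm ud By (fun=> 0) LX.
  have := HM y By; rewrite /f /gradform mulAJmx mulAmx mulJmx -E.
  move: (cmod _) (sqr_ge0 (cmod (HNL Om y) - 1)) (sqr_ge0 (cmod (HNL Om y))) => c.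
  by rewrite !expr2 => A1 A2 A3; nra.
rewrite /constC1; apply: le_trans (ler_wpM2l _ H) _ => //.
by rewrite lerDr mulr_ge0 // constC_ge0.
Qed.

End SupremaOnLeviFlat.

(** * The inequality with the constants *)

Lemma divide_by_square {F : realFieldType} (k D A B : F) : 0 < D ->
  k * D ^+ 2 <= A + B * D -> k <= A / D ^+ 2 + B / D.
Proof.
move=> D0 H; have D2 : 0 < D ^+ 2 by rewrite exprn_gt0.
have -> : A / D ^+ 2 + B / D = (A + B * D) / D ^+ 2 by field; rewrite gt_eqF.
by rewrite ler_pdivlMr.
Qed.

Lemma cauchy_schwarz_plane {F : realFieldType} (D c p q u v : F) : 0 <= D -> 0 <= c ->
  16 * D ^+ 2 = p ^+ 2 + q ^+ 2 -> 16 * c ^+ 2 = u ^+ 2 + v ^+ 2 ->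
  p * v - q * u <= 16 * (D * c).
Proof.
move=> D0 c0 E1 E2; apply: le_trans (ler_norm _) _.
rewrite -(ler_pXn2r (n := 2)) ?nnegrE ?mulr_ge0 // real_normK ?num_real //.
have -> : (16 * (D * c)) ^+ 2 = (16 * D ^+ 2) * (16 * c ^+ 2) by ring.
rewrite E1 E2 -subr_ge0.
have -> : (p ^+ 2 + q ^+ 2) * (u ^+ 2 + v ^+ 2) - (p * v - q * u) ^+ 2 =
  (p * u + q * v) ^+ 2 by ring.
exact: sqr_ge0.
Qed.

Lemma rate_mono {F : realFieldType} (e t : F) : e < t -> t < 1 -> (1 - e)^-1 - 1 <= t / (1 - t).
Proof.
move=> et t1; have t10 : 0 < 1 - t by rewrite subr_gt0.
have -> : t / (1 - t) = (1 - t)^-1 - 1 by field; rewrite gt_eqF.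
by rewrite lerD2r lef_pV2 ?posrE //; lra.
Qed.

(** [flat_inequality] divided by 16, with the product terms on its right-hand side
estimated by the Cauchy-Schwarz inequality. Here [D] and [c] stand for the moduli
[|Lbar psi / 2 + h|] and [|h|], and [H] for [Hess_psi (L, L)]. *)
Lemma final_algebra {F : realFieldType} (k D c H q p r u v A B : F) :
  0 < D -> 0 <= c ->
  k * (p ^+ 2 + r ^+ 2) + 4 * H <= 2 * q + 2 * (p * v - r * u) ->
  16 * c ^+ 2 = u ^+ 2 + v ^+ 2 -> 16 * D ^+ 2 = p ^+ 2 + r ^+ 2 ->
  8^-1 * q <= A -> 2 * c <= B ->
  k * D ^+ 2 <= A - 4^-1 * H + B * D.
Proof.
move=> D0 c0 H1 Ec ED qA cB.
have CS := cauchy_schwarz_plane (ltW D0) c0 ED Ec.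
have K : D * (2 * c) <= D * B by rewrite ler_wpM2l // ltW.
rewrite -ED in H1.
have E1 : k * (16 * D ^+ 2) = 16 * (k * D ^+ 2) by ring.
have E2 : D * (2 * c) = 2 * (D * c) by ring.
rewrite E1 in H1; rewrite E2 in K; rewrite (mulrC B).
move: (k * D ^+ 2) (D * c) (D * B) (p * v - r * u) H1 CS K => a b d e H1 CS K.
lra.
Qed.

Theorem theorem1p4 (R : realType) (Om : set 'rV[R]_4)
    (Om_open : open Om) (Om_connected : connected Om)
    (Om_bounded : bounded_set Om)
    (Om_smooth : smooth_boundary Om) (Om_pseudoconvex : pseudoconvex Om)
    (Sigma_nonempty : Levi_flat Om !=set0)
    (eta0 : R) (eta0E : DF_index Om = eta0%:E)
    (eta : R) (eta_lt : eta < eta0) :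
  exists2 psi : 'rV[R]_4 -> R, smooth_near (Levi_flat Om) psi &
    forall x, Levi_flat Om x ->
      (1 - eta)^-1 - 1 <=
        (constC2 Om - 4^-1 * complex.Re (Hess psi (Lf Om) (Lf Om) x))
          / denom Om psi x ^+ 2
        + constC1 Om / denom Om psi x
      \/ denom Om psi x = 0.
Proof.
(* an exponent t above eta, together with its defining function rho *)
have [_ [t [/andP[t0 t1] [rho drho P]] <-]] : exists2 a,
    [set tau%:E | tau in DF_exponent Om] a & (eta%:E < a)%E.
  by apply: ereal_sup_gt; rewrite -/(DF_index Om) eta0E lte_fin.
rewrite lte_fin => et.
have [U [sg [psi [ud spsi rhoE]]]] := unit_defining_exists drho.
have [BU ssg _ _] := ud.
exists (fun y => t * psi y).
  exists U => [y [By _]|]; first exact: BU.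
  by apply: smooth_M => //; apply: smooth_cst; exact: ssg.1.
move=> x Lx; have [Bx LX] := Levi_flat_trace Om_open Om_bounded ud Lx.
have Ux := BU x Bx.
have [Dz|Dnz] := eqVneq (denom Om (fun y => t * psi y) x) 0; [by right|left].
have D0 : 0 < denom Om (fun y => t * psi y) x by rewrite lt_neqAle eq_sym Dnz cmod_ge0.
apply: le_trans (rate_mono et t1) _; apply: divide_by_square => //.
have dpsi : differentiable psi x := spsi.2 [::] x Ux.
have t01 : 0 < t < 1 by rewrite t0 t1.
have I := flat_inequality Om_open Om_bounded ud Bx LX drho spsi rhoE P t01.
have [Ec ED] := cmod_HNL_denom Om_open Om_bounded ud Bx (fun y => t * psi y) LX.
rewrite !(grad_scale _ _ dpsi) in ED.
apply: (final_algebra D0 (cmod_ge0 (HNL Om x)) _ Ec ED (constC2_ge Om_open Om_bounded ud Lx)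
  (constC1_ge Om_open Om_bounded ud Lx)).
rewrite (Hess_LL Om_open Om_bounded ud Bx) !(D2_scale _ _ _ spsi Ux).
apply: le_trans I; rewrite le_eqVlt; apply/orP; left; apply/eqP; congr (_ + _).
by move: (D2 psi x _ _) (D2 psi x (Jmap _) _) => a b; field.
Qed.
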